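(* Let $\varepsilon\neq0$ be real, let $\Gamma_\varepsilon=\{(x_1,x_2)\in\mathbb{R}^2:\ x_1x_2=\varepsilon\}$, let $\alpha,\beta$ be positive real numbers, and let $$\Lambda=(\alpha\mathbb{Z}\times\{0\})\cup(\{0\}\times\beta\mathbb{Z}).$$ Then $(\Gamma_\varepsilon,\Lambda)$ is a Heisenberg uniqueness pair if and only if $\alpha\beta\le 1/|\varepsilon|$.
   Context: For a finite complex-valued Borel measure $\mu$ on $\mathbb{R}^2$, its Fourier transform is $\widehat\mu(\xi)=\int_{\mathbb{R}^2}\mathrm{e}^{\pi \mathrm{i}\langle x,\xi\rangle}\,\mathrm{d}\mu(x)$, where $\langle x,\xi\rangle=x_1\xi_1+x_2\xi_2$. Let $\Gamma\subset\mathbb{R}^2$ be a smooth curve or a finite disjoint union of smooth curves, and let $\Lambda\subset\mathbb{R}^2$. The pair $(\Gamma,\Lambda)$ is called a Heisenberg uniqueness pair if every finite complex Borel measure $\mu$ on $\mathbb{R}^2$ with $\operatorname{supp}\mu\subset\Gamma$, which is absolutely continuous with respect to arc length measure on $\Gamma$ and satisfies $\widehat\mu(\xi)=0$ for all $\xi\in\Lambda$, is the zero measure. *)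

(* Defs.v *)
From HB Require Import structures.
From mathcomp Require Import all_boot all_order all_algebra.
From mathcomp Require Import all_classical all_reals all_analysis.
From mathcomp Require Import complex.

Set Implicit Arguments.
Unset Strict Implicit.
Unset Printing Implicit Defensive.

Import Order.TTheory GRing.Theory Num.Theory.
Import numFieldNormedType.Exports.

Local Open Scope complex_scope.
Local Open Scope ring_scope.
Local Open Scope classical_set_scope.

(* A library charge is finite and sigma-additive, so a finite complex measure
   is exactly a pair of charges, its real and imaginary parts. *)
Record complex_measure d (T : measurableType d) (R : realType) :=
  ComplexMeasure {
    re_part : {charge set T -> \bar R} ;
    im_part : {charge set T -> \bar R} }.

Definition complex_measure_val d (T : measurableType d) (R : realType)
    (mu : complex_measure T R) (A : set T) : R[i] :=
  fine (re_part mu A) +i* fine (im_part mu A).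

Coercion complex_measure_val : complex_measure >-> Funclass.

(* Integral of f against the signed measure nu, as the difference of the
   integrals against the two parts of its Jordan decomposition; the Hahn sets
   P and N are unique up to nu-null sets, so their choice is immaterial. *)
Definition charge_integral d (T : measurableType d) (R : realType)
    (nu : {charge set T -> \bar R}) (f : T -> R) : R :=
  let hahn := projT2 (cid (projT2 (cid (Hahn_decomposition nu)))) in
  \int[jordan_pos hahn]_x f x - \int[jordan_neg hahn]_x f x.

(* (u + i v) d(nu1 + i nu2) = (u dnu1 - v dnu2) + i (u dnu2 + v dnu1) *)
Definition complex_integral d (T : measurableType d) (R : realType)
    (mu : complex_measure T R) (f : T -> R[i]) : R[i] :=
  let u x := complex.Re (f x) in
  let v x := complex.Im (f x) in
  (charge_integral (re_part mu) u - charge_integral (im_part mu) v) +i*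
  (charge_integral (im_part mu) u + charge_integral (re_part mu) v).

(* exp(i t) for real t *)
Definition expi (R : realType) (t : R) : R[i] := cos t +i* sin t.

Definition fourier (R : realType) (mu : complex_measure (R * R)%type R)
    (xi : R * R) : R[i] :=
  complex_integral mu (fun x => expi (pi * (x.1 * xi.1 + x.2 * xi.2))).

Definition supp (R : realType) (mu : complex_measure (R * R)%type R) :
    set (R * R) :=
  [set x : R * R | forall U : set (R * R), open_nbhs x U ->
    exists A : set (R * R), [/\ measurable A, A `<=` U & mu A != 0]].

(* An injective regular smooth parametrization on a nondegenerate interval.
   The interval may contain endpoints, where the derivatives are still
   two-sided; thus a closed curve such as the circle is parametrized by a
   half-open interval. *)
Record smooth_curve (R : realType) := SmoothCurve {
  curve_dom : interval R ;
  curve_x : R -> R ;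
  curve_y : R -> R ;
  curve_dom_nondegenerate : [set` curve_dom]° !=set0 ;
  curve_smooth_x : forall (k : nat) t, t \in curve_dom ->
    derivable (curve_x^`(k)) t 1 ;
  curve_smooth_y : forall (k : nat) t, t \in curve_dom ->
    derivable (curve_y^`(k)) t 1 ;
  curve_regular : forall t, t \in curve_dom ->
    (curve_x^`() t, curve_y^`() t) != (0, 0) ;
  curve_injective : {in curve_dom &, injective (fun t => (curve_x t, curve_y t))}
}.

Definition curve_point (R : realType) (c : smooth_curve R) (t : R) : R * R :=
  (curve_x c t, curve_y c t).

Definition curve_image (R : realType) (c : smooth_curve R) : set (R * R) :=
  curve_point c @` [set` curve_dom c].

Definition curve_speed (R : realType) (c : smooth_curve R) (t : R) : R :=
  let dx := (curve_x c)^`() t in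
  let dy := (curve_y c)^`() t in
  Num.sqrt (dx ^+ 2 + dy ^+ 2).

Definition disjoint_union_of_curves (R : realType) (Gamma : set (R * R))
    (n : nat) (c : 'I_n -> smooth_curve R) : Prop :=
  [/\ (0 < n)%N,
      trivIset setT (fun i => curve_image (c i)) &
      Gamma = \bigcup_i curve_image (c i)].

(* Arc length measure on the disjoint union of the curves c i, as a measure on
   the plane: A |-> \sum_i \int_(t | c i t \in A) |(c i)'(t)| dt. *)
Definition arc_length (R : realType) (n : nat) (c : 'I_n -> smooth_curve R)
    (A : set (R * R)) : \bar R :=
  (\sum_(i < n) \int[lebesgue_measure]_(t in
     [set` curve_dom (c i)] `&` curve_point (c i) @^-1` A)
     (curve_speed (c i) t)%:E)%E.

Definition absolutely_continuous d (T : measurableType d) (R : realType)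
    (mu : complex_measure T R) (m : set T -> \bar R) : Prop :=
  re_part mu `<< m /\ im_part mu `<< m.

(* Arc length depends only on the set Gamma, not on the parametrization, so
   quantifying the parametrization existentially amounts to requiring Gamma to
   be a finite disjoint union of smooth curves. *)
Definition heisenberg_uniqueness_pair (R : realType)
    (Gamma Lambda : set (R * R)) : Prop :=
  exists (n : nat) (c : 'I_n -> smooth_curve R),
    disjoint_union_of_curves Gamma c /\
    forall mu : complex_measure (R * R)%type R,
      supp mu `<=` Gamma ->
      absolutely_continuous mu (arc_length c) ->
      (forall xi, Lambda xi -> fourier mu xi = 0) ->
      forall A, measurable A -> mu A = 0.

Definition hyperbola (R : realType) (eps : R) : set (R * R) :=
  [set x | x.1 * x.2 = eps].

(* a Z = {a m : m in Z} *)
Definition integer_multiples (R : realType) (a : R) : set R :=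
  [set a * m%:~R | m in [set: int]].

Definition lattice_cross (R : realType) (alpha beta : R) : set (R * R) :=
  (integer_multiples alpha `*` [set 0]) `|`
  ([set 0] `*` integer_multiples beta).

(* Main.v *)
(* On the hyperbola use the coordinate t = alpha x_1; then beta x_2 = g / t with
   g = alpha beta eps.  The Fourier transform of nu vanishes on the cross iff the
   images of nu under t and under g / t have vanishing trigonometric moments,
   that is, both vanish modulo 2.

   Case |g| <= 1.  Inside the period cell (-1, 1) the positive and negative parts
   of nu live on disjoint sets, so |nu| of a subset B of the cell is at most |nu|
   of its nontrivial translates B + 2k.  Using this for t and then for g / t shows
   that |nu| (|t| in A) does not decrease when A is replaced by T^-2 A, where
   T x = dist (|g| / x, 2 Z) is a folded Gauss map of (0, 1).  T behaves as if it
   had an infinite invariant density of the type 1 / (1 - x^2): the Lebesgue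
   measure of T^-2k [0, a] tends to 0 for every a < 1, and absolute continuity
   gives nu = 0.

   Case |g| > 1.  The dynamics is expanding.  A Lasota-Yorke estimate for a
   transfer operator lifted from the circle R / 2 Z to a set |t| <= r, with
   r^2 < |g|, yields an absolutely continuous probability measure h on |t| <= r
   that has the same image modulo 2 under t and g / t.  As g / t maps |t| <= r
   off itself, h minus its image under g / t is a nonzero counterexample. *)

From HB Require Import structures.
Require Import Defs.
From mathcomp Require Import all_boot all_order all_algebra.
From mathcomp Require Import all_classical all_reals all_analysis.
From mathcomp Require Import measurable_realfun complex ring lra.

Set Implicit Arguments.
Unset Strict Implicit.
Unset Printing Implicit Defensive.

Import Order.TTheory GRing.Theory Num.Theory.
Import numFieldNormedType.Exports.

Local Open Scope ring_scope.
Local Open Scope classical_set_scope.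

(** The hard case is [|g| = 1]. For [|g| < 1] the density of the image of Lebesgue measure under T^n
    is at most |g|^n / (1 - x^2) and decays geometrically. At [|g| = 1] this bound does not decay: 1
    is a neutral fixed point of T. Decay then holds only on average over n. Finite mass, set against
    the divergent integral of 1 / (1 - x^2), forces the averaged density, relative to the invariant
    one, to be small at some point within a bounded number of steps from 0, and a maximum principle
    carries the smallness back to 0. Pointwise estimates are available because the densities have
    two opposite monotonicity properties, which replace a regularity theory.

    For [|g| > 1] the variation of a density is measured by duality, through integrals of
    derivatives of bounded test functions. A Poisson kernel minus 1 is such a derivative, with a
    bound independent of its width; this turns bounded variation into domination by Lebesgue
    measure. The same domination makes a limit of averages along an ultrafilter sigma-additive. *)

Lemma measurable_floor (R : realType) :
  measurable_fun [set: R] (fun x : R => (Num.floor x)%:~R : R).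
Proof.
apply: nondecreasing_measurable => // x y xy.
by rewrite ler_int le_floor.
Qed.

Lemma measurable_invr (R : realType) :
  measurable_fun [set: R] (fun x : R => x^-1).
Proof.
rewrite -(setUv [set (0 : R)]); apply/measurable_funU => //.
  exact: measurableC.
split; first exact: measurable_fun_set1.
apply: open_continuous_measurable_fun.
  by apply: closed_openC; exact: closed_eq.
by move=> x; rewrite inE/= => /eqP x0; exact: inv_continuous.
Qed.

(** * Transfer operator of the folded map *)

Section TransferOperator.
Variable R : realType.
Variable c : R.
Hypotheses (c0 : 0 < c) (c1 : c <= 1).
Implicit Types (x y : R) (g : R -> R) (j n : nat).

(** The offset starts at 2: the folded map is used only at points [s <= c], where [c / s >= 1], so
    the translate by 0 never occurs. The two branches below solve [fold (c / s) = x] with [c / s]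
    below or above an even integer. *)
Definition even_nat j : R := (j.+1).*2%:R.
Definition branch_l j x := c / (even_nat j - x).
Definition branch_r j x := c / (even_nat j + x).
(** Each coefficient is the modulus of the derivative of its branch. Thus [transfer] is the
    Perron-Frobenius operator of the folded map, and [transfer_iter n] is the density of the image
    of Lebesgue measure under its n-th iterate. *)
Definition branch_sum_term g x j :=
  c / (even_nat j - x) ^+ 2 * g (branch_l j x) +
  c / (even_nat j + x) ^+ 2 * g (branch_r j x).
Definition transfer g x := fine (\sum_(0 <= j <oo) (branch_sum_term g x j)%:E).
Definition transfer_iter n : R -> R := iter n transfer (fun=> 1).

Local Notation e_ := even_nat.
Local Notation bl := branch_l.
Local Notation br := branch_r.
Local Notation tm := branch_sum_term.
Local Notation rg := transfer_iter.

Lemma even_nat_ge2 j : 2 <= e_ j.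
Proof. by rewrite /even_nat (ler_nat R 2) -[2%N]/(1.*2) leq_double. Qed.

Lemma even_natS j : e_ j.+1 = e_ j + 2.
Proof. by rewrite /even_nat doubleS -addn2 natrD. Qed.

Lemma branch_l_itv j x : 0 <= x < 1 -> 0 <= bl j x < 1.
Proof.
move=> /andP[x0 x1]; have e2 := even_nat_ge2 j.
move: c0 c1 => cp cl; rewrite /branch_l.
apply/andP; split; first by rewrite divr_ge0//; lra.
by rewrite ltr_pdivrMr; lra.
Qed.

Lemma branch_r_itv j x : 0 <= x < 1 -> 0 <= br j x < 1.
Proof.
move=> /andP[x0 x1]; have e2 := even_nat_ge2 j.
move: c0 c1 => cp cl; rewrite /branch_r.
apply/andP; split; first by rewrite divr_ge0//; lra.
by rewrite ltr_pdivrMr; lra.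
Qed.

Lemma ler_quot (k x y : R) : 1 <= k -> 0 <= x -> x <= y -> y < 1 ->
  (k - x) / (k - y) <= (1 - x) / (1 - y).
Proof.
move=> k1 x0 xy y1; rewrite ler_pdivrMr; last lra.
rewrite mulrAC ler_pdivlMr; last lra.
nra.
Qed.

Definition dominated g K := forall y, 0 <= y < 1 -> 0 <= g y <= K / (1 - y ^+ 2).

Lemma sq_lt1 y : 0 <= y < 1 -> y ^+ 2 < 1.
Proof. by move=> /andP[y0 y1]; nra. Qed.

(* For c = 1 the density 1/(1-x^2) is invariant, by telescoping. *)
Definition wl x j := ((e_ j - x) ^+ 2 - 1)^-1.
Definition wr x j := ((e_ j + x) ^+ 2 - 1)^-1.

Lemma wl_ge0 x j : 0 <= x < 1 -> 0 < wl x j.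
Proof.
by move=> /andP[x0 x1]; have e2 := even_nat_ge2 j; rewrite invr_gt0; nra.
Qed.
Lemma wr_ge0 x j : 0 <= x < 1 -> 0 < wr x j.
Proof.
by move=> /andP[x0 x1]; have e2 := even_nat_ge2 j; rewrite invr_gt0; nra.
Qed.

(** For [u = e_ j - x] or [u = e_ j + x], 1 / (u^2 - 1) is half of 1 / (u - 1) - 1 / (u + 1).
    Consecutive even offsets share an odd endpoint, so only the terms at 1 and at 2n + 1 survive. *)
Lemma sum_weights x n : 0 <= x < 1 ->
  \sum_(0 <= j < n) (wl x j + wr x j) =
  (1 - x ^+ 2)^-1 - ((n.*2.+1%:R - x)^-1 + (n.*2.+1%:R + x)^-1) / 2.
Proof.
move=> /andP[x0 x1]; elim: n => [|n IH].
  rewrite big_geq//= (_ : 1%:R = 1)//; field.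
  by apply/and3P; split; [lra|lra|]; rewrite subr_eq0 eq_sym lt_eqF// sq_lt1// x0.
rewrite big_nat_recr//= IH /wl /wr.
have -> : n.+1.*2.+1%:R = n.*2.+1%:R + 2 :> R by rewrite doubleS -addn2 -natrD.
have -> : e_ n = n.*2.+1%:R + 1 :> R by rewrite /even_nat doubleS -natr1.
have: 1 <= n.*2.+1%:R :> R by rewrite ler1n.
move: (n.*2.+1%:R) => k k1.
field.
have x2 : x ^+ 2 < 1 by rewrite sq_lt1// x0.
by repeat (apply/andP; split); nra.
Qed.

Lemma sum_weights_le x n : 0 <= x < 1 ->
  \sum_(0 <= j < n) (wl x j + wr x j) <= (1 - x ^+ 2)^-1.
Proof.
move=> x01; rewrite sum_weights// lerBlDr lerDl.
move: x01 => /andP[x0 x1].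
have k1 : 1 <= n.*2.+1%:R :> R by rewrite ler1n.
by rewrite divr_ge0// addr_ge0// invr_ge0; lra.
Qed.

Definition nonneg01 g := forall y, 0 <= y < 1 -> 0 <= g y.

Lemma dominated_nonneg g K : dominated g K -> nonneg01 g.
Proof. by move=> h y /h /andP[]. Qed.

Lemma branch_coef_ge0 (u : R) : 0 <= c / u ^+ 2.
Proof. by rewrite divr_ge0 ?sqr_ge0// ltW. Qed.

Lemma tm_ge0 g x j : nonneg01 g -> 0 <= x < 1 -> 0 <= tm g x j.
Proof.
move=> g0 x01; rewrite addr_ge0// mulr_ge0 ?branch_coef_ge0//.
  by rewrite g0// branch_l_itv.
by rewrite g0// branch_r_itv.
Qed.

(** [transfer] is defined through [fine], which sends an infinite sum to 0; a bound on the partial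
    sums is what identifies it with the series. *)
Lemma sum_term_fin g x B : nonneg01 g -> 0 <= x < 1 ->
  (forall n, \sum_(0 <= j < n) tm g x j <= B) ->
  (transfer g x)%:E = (\sum_(0 <= j <oo) (tm g x j)%:E)%E /\ transfer g x <= B.
Proof.
move=> g0 x01 hB.
have le_B : (\sum_(0 <= j <oo) (tm g x j)%:E <= B%:E)%E.
  apply: lime_le.
    by apply: is_cvg_ereal_nneg_natsum => j _; rewrite lee_fin tm_ge0.
  by apply: nearW => n; rewrite sumEFin lee_fin.
have fin : (\sum_(0 <= j <oo) (tm g x j)%:E)%E \is a fin_num.
  rewrite ge0_fin_numE ?(le_lt_trans le_B) ?ltry//.
  by apply: nneseries_ge0 => j _ _; rewrite lee_fin tm_ge0.
rewrite /transfer fineK//; split => //.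
by rewrite -lee_fin fineK.
Qed.

Lemma transfer_ge0 g x : nonneg01 g -> 0 <= x < 1 -> 0 <= transfer g x.
Proof.
move=> g0 x01; apply: fine_ge0; apply: nneseries_ge0 => j _ _.
by rewrite lee_fin tm_ge0.
Qed.

(** One branch applied to the reference density [K / (1 - y ^+ 2)] at [y = c / u]. Since
    [c ^+ 2 <= 1], the weight is at most the one for [c = 1], and the factor [c] in front is the
    gain per iteration. *)
Lemma branch_weight_le (u v K : R) : 1 < u -> 0 <= K ->
  v <= K / (1 - (c / u) ^+ 2) ->
  c / u ^+ 2 * v <= c * K * (u ^+ 2 - 1)^-1.
Proof.
move=> u1 K0 hv; apply: (le_trans (ler_wpM2l (branch_coef_ge0 u) hv)).
move: (c0) (c1) => cp cl.
have u0 : u ^+ 2 != 0 by rewrite sqrf_eq0 gt_eqF//; lra.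
have c2 : c ^+ 2 <= 1 by rewrite expr_le1// ltW.
have u2 : 1 < u ^+ 2 by rewrite exprn_egt1.
have -> : 1 - (c / u) ^+ 2 = (u ^+ 2 - c ^+ 2) / u ^+ 2.
  by rewrite expr_div_n mulrBl divff.
rewrite invf_div mulrA mulrA [c / _ * K]mulrAC divfK//.
by rewrite ler_wpM2l ?mulr_ge0 ?(ltW cp)// lef_pV2 ?posrE; lra.
Qed.

Lemma term_l_le g x j K : 0 <= x < 1 -> 0 <= K ->
  g (bl j x) <= K / (1 - bl j x ^+ 2) ->
  c / (e_ j - x) ^+ 2 * g (bl j x) <= c * K * wl x j.
Proof.
move=> /andP[x0 x1] K0 hg; have e2 := even_nat_ge2 j.
by apply: branch_weight_le => //; lra.
Qed.

Lemma term_r_le g x j K : 0 <= x < 1 -> 0 <= K ->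
  g (br j x) <= K / (1 - br j x ^+ 2) ->
  c / (e_ j + x) ^+ 2 * g (br j x) <= c * K * wr x j.
Proof.
move=> /andP[x0 x1] K0 hg; have e2 := even_nat_ge2 j.
by apply: branch_weight_le => //; lra.
Qed.

Lemma sum_tm_le g x K n : dominated g K -> 0 <= K -> 0 <= x < 1 ->
  \sum_(0 <= j < n) tm g x j <= c * K / (1 - x ^+ 2).
Proof.
move=> gK K0 x01; apply: (@le_trans _ _ (c * K * \sum_(0 <= j < n) (wl x j + wr x j))).
  rewrite big_distrr/=; apply: ler_sum => j _; rewrite mulrDr lerD//.
    by apply: term_l_le => //; have /andP[] := gK _ (branch_l_itv j x01).
  by apply: term_r_le => //; have /andP[] := gK _ (branch_r_itv j x01).
by rewrite ler_wpM2l ?sum_weights_le// mulr_ge0// ltW.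
Qed.

Lemma transferE g K x : dominated g K -> 0 <= K -> 0 <= x < 1 ->
  (transfer g x)%:E = (\sum_(0 <= j <oo) (tm g x j)%:E)%E.
Proof.
move=> gK K0 x01; have [] := @sum_term_fin g x (c * K / (1 - x ^+ 2)) => //.
  exact: dominated_nonneg gK.
by move=> n; apply: sum_tm_le.
Qed.

Lemma dominated_transfer g K : dominated g K -> 0 <= K ->
  dominated (transfer g) (c * K).
Proof.
move=> gK K0 x x01; rewrite transfer_ge0//=; last exact: dominated_nonneg gK.
have [] := @sum_term_fin g x (c * K / (1 - x ^+ 2)) => //.
  exact: dominated_nonneg gK.
by move=> n; apply: sum_tm_le.
Qed.

Lemma dominated_iter n : dominated (rg n) (c ^+ n).
Proof.
elim: n => [y y01|n IH].
  rewrite /rg/= ler01 expr0 div1r -[leLHS]invr1 lef_pV2 ?posrE ?ltr01//.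
    by rewrite lerBlDr lerDl sqr_ge0.
  by rewrite subr_gt0 sq_lt1.
by rewrite /rg/= exprS; apply: dominated_transfer => //; rewrite exprn_ge0 ?ltW.
Qed.

Lemma rg_ge0 n x : 0 <= x < 1 -> 0 <= rg n x.
Proof. by move=> x01; have /andP[] := @dominated_iter n _ x01. Qed.

Lemma rgE n x : 0 <= x < 1 ->
  (rg n.+1 x)%:E = (\sum_(0 <= j <oo) (tm (rg n) x j)%:E)%E.
Proof.
by move=> x01; apply: (transferE (@dominated_iter n)); rewrite // exprn_ge0 ?ltW.
Qed.

Lemma rg_cmp (A B : R) n x y : 0 <= A -> 0 <= B -> 0 <= x < 1 -> 0 <= y < 1 ->
  (forall j, A * tm (rg n) x j <= B * tm (rg n) y j) ->
  A * rg n.+1 x <= B * rg n.+1 y.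
Proof.
move=> A0 B0 x01 y01 h.
have n0 : nonneg01 (rg n) by move=> z; exact: rg_ge0.
rewrite -lee_fin !EFinM !rgE// -!nneseriesZl; last 2 first.
- by move=> j _; rewrite lee_fin tm_ge0.
- by move=> j _; rewrite lee_fin tm_ge0.
apply: lee_nneseries => [j _|j _]; first by rewrite -EFinM lee_fin mulr_ge0// tm_ge0.
by rewrite -!EFinM lee_fin h.
Qed.

(** In use [p / u] and [q / v] are [1 - c / u] and [1 - c / v], or the same with plus signs, so the
    inequality between squares is the induction hypothesis at the branch points. The condition
    [a * q <= b * p] passes from these weights to the weights [a], [b] at the original points. *)
Lemma branch_cmp (a b p q u v gx gy : R) : 0 <= a -> 0 <= b -> 0 < p -> 0 < q ->
  0 < u -> 0 < v -> 0 <= gy ->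
  (p / u) ^+ 2 * gx <= (q / v) ^+ 2 * gy -> a * q <= b * p ->
  a ^+ 2 * (c / u ^+ 2 * gx) <= b ^+ 2 * (c / v ^+ 2 * gy).
Proof.
move=> a0 b0 p0 q0 u0 v0 gy0 h aqbp.
have -> : a ^+ 2 * (c / u ^+ 2 * gx) = a ^+ 2 * c / p ^+ 2 * ((p / u) ^+ 2 * gx).
  by field; rewrite ?gt_eqF.
have k0 : 0 <= a ^+ 2 * c / p ^+ 2.
  by rewrite divr_ge0 ?sqr_ge0// mulr_ge0 ?sqr_ge0// ltW.
apply: (le_trans (ler_wpM2l k0 h)).
have -> : a ^+ 2 * c / p ^+ 2 * ((q / v) ^+ 2 * gy) =
    (a * q) ^+ 2 * (c / (v ^+ 2 * p ^+ 2) * gy).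
  by field; rewrite ?gt_eqF.
have -> : b ^+ 2 * (c / v ^+ 2 * gy) = (b * p) ^+ 2 * (c / (v ^+ 2 * p ^+ 2) * gy).
  by field; rewrite ?gt_eqF.
apply: ler_wpM2r; last by rewrite ler_pXn2r// nnegrE mulr_ge0// ltW.
by rewrite mulr_ge0// divr_ge0 ?(ltW c0)// mulr_ge0// sqr_ge0.
Qed.

Lemma branch_l_le j x y : 0 <= x -> x <= y -> y < 1 -> bl j x <= bl j y.
Proof.
move=> x0 xy y1; have e2 := even_nat_ge2 j.
by rewrite /bl ler_wpM2l ?(ltW c0)// lef_pV2 ?posrE; lra.
Qed.

Lemma branch_r_le j x y : 0 <= x -> x <= y -> y < 1 -> br j y <= br j x.
Proof.
move=> x0 xy y1; have e2 := even_nat_ge2 j.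
by rewrite /br ler_wpM2l ?(ltW c0)// lef_pV2 ?posrE; lra.
Qed.

Lemma onemB_quot (u : R) : u != 0 -> 1 - c / u = (u - c) / u.
Proof. by move=> u0; rewrite mulrBl divff. Qed.

Lemma onepD_quot (u : R) : u != 0 -> 1 + c / u = (u + c) / u.
Proof. by move=> u0; rewrite mulrDl divff. Qed.

(* Both monotonicity properties hold for the densities 1/(x-e)^2 with
   |e| >= 1, and each of them is needed to propagate the other one through the
   decreasing branches. *)
Lemma rg_harnack n x y : 0 <= x -> x <= y -> y < 1 ->
  (1 - y) ^+ 2 * rg n y <= (1 - x) ^+ 2 * rg n x /\
  (1 + x) ^+ 2 * rg n x <= (1 + y) ^+ 2 * rg n y.
Proof.
elim: n x y => [|n IH] x y x0 xy y1.
  by rewrite /rg/= !mulr1; split; rewrite ler_pXn2r// ?nnegrE; lra.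
have x01 : 0 <= x < 1 by apply/andP; split; lra.
have y01 : 0 <= y < 1 by apply/andP; split; lra.
have key j : 2 <= e_ j /\ c <= 1 by split; [exact: even_nat_ge2|].
split; apply: rg_cmp; rewrite ?sqr_ge0// => j; rewrite /tm !mulrDr;
  have [e2 cl] := key j; have cp : 0 < c by []; (apply: lerD;
  [have /andP[lx0 lx1] := branch_l_itv j x01;
   have /andP[ly0 ly1] := branch_l_itv j y01;
   have [h1 h2] := IH _ _ lx0 (branch_l_le j x0 xy y1) ly1
  |have /andP[lx0 lx1] := branch_r_itv j x01;
   have /andP[ly0 ly1] := branch_r_itv j y01;
   have [h1 h2] := IH _ _ ly0 (branch_r_le j x0 xy y1) lx1]).
- apply: (@branch_cmp _ _ (e_ j - y - c) (e_ j - x - c)); rewrite ?rg_ge0//; try lra.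
  + by rewrite -!onemB_quot; [exact: h1|apply: lt0r_neq0; lra..].
  + nra.
- apply: (@branch_cmp _ _ (e_ j + y + c) (e_ j + x + c)); rewrite ?rg_ge0//; try lra.
  + by rewrite -!onepD_quot; [exact: h2|apply: lt0r_neq0; lra..].
  + nra.
- apply: (@branch_cmp _ _ (e_ j - x + c) (e_ j - y + c)); rewrite ?rg_ge0//; try lra.
  + by rewrite -!onepD_quot; [exact: h2|apply: lt0r_neq0; lra..].
  + nra.
- apply: (@branch_cmp _ _ (e_ j + x - c) (e_ j + y - c)); rewrite ?rg_ge0//; try lra.
  + by rewrite -!onemB_quot; [exact: h1|apply: lt0r_neq0; lra..].
  + nra.
Qed.

End TransferOperator.

(** * The folded map *)

(** The distance from [t] to the even integers; the floor selects a nearest one. *)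
Definition fold {R : realType} (t : R) : R :=
  `|t - 2 * (Num.floor ((t + 1) / 2))%:~R|.

Lemma foldD {R : realType} (k : int) (t : R) : fold (t + 2 * k%:~R) = fold t.
Proof.
rewrite /fold; have -> : (t + 2 * k%:~R + 1) / 2 = (t + 1) / 2 + k%:~R by field.
by rewrite floorDrz ?intr_int// intrD intrKfloor; congr `|_|; ring.
Qed.

Lemma fold_id {R : realType} (t : R) : -1 <= t < 1 -> fold t = `|t|.
Proof.
move=> /andP[t0 t1]; rewrite /fold.
have -> : Num.floor ((t + 1) / 2) = 0.
  by apply/floor_def/andP; split; rewrite ?add0r /=; lra.
by rewrite mulr0 subr0.
Qed.

Lemma fold_decomp {R : realType} (t : R) :
  exists (k : int) (u : R), [/\ t = u + 2 * k%:~R, -1 <= u < 1 & fold t = `|u|].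
Proof.
exists (Num.floor ((t + 1) / 2)), (t - 2 * (Num.floor ((t + 1) / 2))%:~R).
split; first by rewrite subrK.
  have /andP[h1 h2] := floor_itv ((t + 1) / 2).
  by move: h2; rewrite intrD /= => h2; apply/andP; split; lra.
by [].
Qed.

Lemma measurable_fold (R : realType) : measurable_fun [set: R] (@fold R).
Proof.
apply: measurableT_comp; first exact: normr_measurable.
apply: measurable_funB => //.
apply: measurable_funM => //.
apply: (measurableT_comp (@measurable_floor R)).
by apply: measurable_funM => //; apply: measurable_funD.
Qed.

(** * Distortion bounds for Lebesgue measure of iterated preimages of intervals *)

Section Escape.
Variable R : realType.
Variable c : R.
Hypotheses (c0 : 0 < c) (c1 : c <= 1).
Implicit Types (x y s : R) (n j : nat) (A B : set R).
Local Notation e_ := (@even_nat R).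
Local Notation bl := (branch_l c).
Local Notation br := (branch_r c).
Local Notation tm := (branch_sum_term c).
Local Notation rg := (transfer_iter c).
Local Notation mu := (@lebesgue_measure R).

(** The restriction [s <= c] keeps only points with [c / s >= 1]: these are the ones that the
    wandering argument produces, and for them the selected even integer is at least 2. *)
Definition fold_preimage A : set R := [set s | 0 < s <= c /\ A (fold (c / s))].
Local Notation T := fold_preimage.
Definition preim_iter n := iter n T.

Lemma preim_iterS n A : preim_iter n.+1 A = preim_iter n (T A).
Proof. exact: iterSr. Qed.

Lemma measurable_fold_preimage A : measurable A -> measurable (T A).
Proof.
move=> mA; have -> : T A = `]0, c]%classic `&` ((@fold R) \o (fun s => c / s)) @^-1` A.
  by apply/seteqP; split => s; rewrite /T/= in_itv/=.
have mf : measurable_fun [set: R] (@fold R \o (fun s => c / s)).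
  apply: (measurableT_comp (@measurable_fold R)).
  by apply: measurable_funM => //; exact: measurable_invr.
by apply: measurableI => //; rewrite -[X in measurable X]setTI; exact: mf.
Qed.

Lemma measurable_preim_iter n A : measurable A -> measurable (preim_iter n A).
Proof. by move=> mA; elim: n => //= n; exact: measurable_fold_preimage. Qed.

Lemma fold_preimage_sub A B : A `<=` B -> T A `<=` T B.
Proof. by move=> AB s [? /AB]. Qed.

Lemma preim_iter_sub n A B : A `<=` B -> preim_iter n A `<=` preim_iter n B.
Proof. by move=> AB; elim: n => //= n; exact: fold_preimage_sub. Qed.

Lemma preim_iter_bigcup n (F : nat -> set R) :
  preim_iter n (\bigcup_i F i) = \bigcup_i preim_iter n (F i).
Proof.
elim: n => //= n ->; apply/seteqP; split => s.
  by move=> [s0 [i _ Fi]]; exists i.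
by move=> [i _ [s0 Fi]]; split => //; exists i.
Qed.

Lemma preim_iter_disjoint n A B : A `&` B = set0 -> preim_iter n A `&` preim_iter n B = set0.
Proof.
move=> AB; elim: n => //= n IH; rewrite -subset0 => s [[s0 As] [_ Bs]].
by have : (preim_iter n A `&` preim_iter n B) (fold (c / s)) by []; rewrite IH.
Qed.

Lemma preim_iterU n A B : preim_iter n (A `|` B) = preim_iter n A `|` preim_iter n B.
Proof.
elim: n => //= n ->; apply/seteqP; split => s.
  by move=> [s0 [|]]; [left|right].
by move=> [|] [s0 h]; split => //; [left|right].
Qed.

Lemma fold_l j u : 0 <= u < 1 -> fold (e_ j - u) = u.
Proof.
move=> /andP[u0 u1]; have -> : e_ j - u = - u + 2 * (j.+1 : int)%:~R.
  by rewrite /even_nat addrC; congr (_ + _); rewrite -muln2 natrM mulrC.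
by rewrite foldD fold_id ?normrN ?ger0_norm//; apply/andP; split; lra.
Qed.

Lemma fold_r j u : 0 <= u < 1 -> fold (e_ j + u) = u.
Proof.
move=> /andP[u0 u1]; have -> : e_ j + u = u + 2 * (j.+1 : int)%:~R.
  by rewrite /even_nat addrC; congr (_ + _); rewrite -muln2 natrM mulrC.
by rewrite foldD fold_id ?ger0_norm//; apply/andP; split; lra.
Qed.

Lemma fold_preimage_itv_l j x y : 0 <= x -> x <= y -> y < 1 ->
  `]bl j x, bl j y[ `<=` T `]x, y[.
Proof.
move=> x0 xy y1 s; rewrite /= in_itv/= /branch_l => /andP[h1 h2].
have e2 := @even_nat_ge2 R j; move: (c0) => cp.
have s0 : 0 < s by apply: le_lt_trans h1; rewrite divr_ge0//; lra.
have k1 : c / s < e_ j - x by rewrite ltr_pdivrMr// mulrC -ltr_pdivrMr//; lra.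
have k2 : e_ j - y < c / s by rewrite ltr_pdivlMr// mulrC -ltr_pdivlMr//; lra.
split.
  by rewrite s0/= -[s]mul1r -ler_pdivlMr//; lra.
have -> : c / s = e_ j - (e_ j - c / s) by rewrite subKr.
by rewrite fold_l/= ?in_itv/=; apply/andP; split; lra.
Qed.

Lemma fold_preimage_itv_r j x y : 0 <= x -> x <= y -> y < 1 ->
  `]br j y, br j x[ `<=` T `]x, y[.
Proof.
move=> x0 xy y1 s; rewrite /= in_itv/= /branch_r => /andP[h1 h2].
have e2 := @even_nat_ge2 R j; move: (c0) => cp.
have s0 : 0 < s by apply: le_lt_trans h1; rewrite divr_ge0//; lra.
have k1 : c / s < e_ j + y by rewrite ltr_pdivrMr// mulrC -ltr_pdivrMr//; lra.
have k2 : e_ j + x < c / s by rewrite ltr_pdivlMr// mulrC -ltr_pdivlMr//; lra.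
split.
  by rewrite s0/= -[s]mul1r -ler_pdivlMr//; lra.
have -> : c / s = e_ j + (c / s - e_ j) by rewrite addrC subrK.
by rewrite fold_r/= ?in_itv/=; apply/andP; split; lra.
Qed.

Lemma fold_preimage_cover x y : 0 <= x -> y < 1 ->
  T `[x, y] `<=` \bigcup_j (`[bl j x, bl j y] `|` `[br j y, br j x]).
Proof.
move=> x0 y1 s [/andP[s0 sc]]; rewrite /= in_itv/= => /andP[xf fy].
have t1 : 1 <= c / s by rewrite ler_pdivlMr// mul1r.
have [k [u [tu /andP[u1 u2] fu]]] := fold_decomp (c / s).
move: xf fy; rewrite fu => xf fy.
have sE : s = c / (c / s) by rewrite invf_div mulrCA divff ?mulr1// gt_eqF.
have : 0 < k by rewrite -(ltr0z R); lra.
case: k tu => // -[//|j] tu _; exists j => //.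
have ej : 2 * (j.+1 : int)%:~R = e_ j :> R by rewrite /even_nat -muln2 natrM mulrC.
have e2 := @even_nat_ge2 R j; move: (c0) => cp.
rewrite ej in tu; have [u0|u0] := leP 0 u.
- right; rewrite /= in_itv/= sE tu /branch_r; move: xf fy; rewrite ger0_norm// => xf fy.
  by rewrite !ler_pM2l// !lef_pV2 ?posrE; try apply/andP; try split; lra.
- left; rewrite /= in_itv/= sE tu /branch_l; move: xf fy; rewrite ltr0_norm// => xf fy.
  by rewrite !ler_pM2l// !lef_pV2 ?posrE; try apply/andP; try split; lra.
Qed.

(** Length times a quotient of distances to 1 or -1 changes under a branch by exactly the derivative
    [c / u ^+ 2] at one endpoint, up to replacing [p / q] by the quotient at the original endpoints.
    No distortion accumulates in the inductions that follow. *)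
Lemma branch_len (u v p q : R) : u != 0 -> v != 0 -> q != 0 ->
  (c / v - c / u) * ((p / u) / (q / v)) = (u - v) * (p / q) * (c / u ^+ 2).
Proof. by move=> u0 v0 q0; field; rewrite u0 v0 q0. Qed.

Lemma branch_lenN (u v p q : R) : u != 0 -> v != 0 -> q != 0 ->
  (c / u - c / v) * ((p / u) / (q / v)) = (v - u) * (p / q) * (c / u ^+ 2).
Proof. by move=> u0 v0 q0; field; rewrite u0 v0 q0. Qed.

Lemma ler_quotD (k x y : R) : 1 <= k -> 0 <= x -> x <= y ->
  (k + y) / (k + x) <= (1 + y) / (1 + x).
Proof.
move=> k1 x0 xy; rewrite ler_pdivrMr; last lra.
rewrite mulrAC ler_pdivlMr; last lra.
nra.
Qed.

Lemma measure_series_le n x y z K : 0 <= K -> 0 <= z < 1 ->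
    0 <= x -> x <= y -> y < 1 ->
  (forall j, (mu (preim_iter n `[bl j x, bl j y]) <=
     (K * (c / (e_ j - z) ^+ 2 * rg n (bl j z)))%:E)%E) ->
  (forall j, (mu (preim_iter n `[br j y, br j x]) <=
     (K * (c / (e_ j + z) ^+ 2 * rg n (br j z)))%:E)%E) ->
  (mu (preim_iter n.+1 `[x, y]) <= (K * rg n.+1 z)%:E)%E.
Proof.
move=> K0 z01 x0 xy y1 hl hr; rewrite EFinM rgE// -nneseriesZl; last first.
  by move=> j _; rewrite lee_fin tm_ge0// => w; exact: rg_ge0.
pose F j := preim_iter n (`[bl j x, bl j y] `|` `[br j y, br j x]).
have mF j : measurable (F j).
  by apply: measurable_preim_iter; apply: measurableU; exact: measurable_itv.
apply: (@le_trans _ _ (\sum_(0 <= j <oo) mu (F j))%E).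
  apply: measure_sigma_subadditive => //.
    by apply: measurable_preim_iter; exact: measurable_itv.
  by rewrite -preim_iter_bigcup preim_iterS; apply: preim_iter_sub; exact: fold_preimage_cover.
apply: lee_nneseries => [j _|j _]; first by [].
rewrite /F preim_iterU -EFinM mulrDr EFinD.
apply: le_trans (leeD (hl j) (hr j)).
by apply: measureU2; apply: measurable_preim_iter; exact: measurable_itv.
Qed.

Lemma branch_step (d' d r' r K g : R) : d' = d -> 0 <= d -> r' <= r ->
  0 <= K * g -> d' * r' * K * g <= d * r * (K * g).
Proof. by move=> -> d0 rr Kg; rewrite -mulrA ler_wpM2r// ler_wpM2l. Qed.

(** The factors are those obtained by integrating over the interval the two monotonicity properties
    of [rg_harnack]. The induction reaches them directly on measures, without a change of variables.
    Decreasing branches exchange the endpoints, so each of the two bounds is needed to propagate the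
    other. *)
Lemma preim_iter_upper n x y : 0 <= x -> x <= y -> y < 1 ->
  (mu (preim_iter n `[x, y]) <= ((y - x) * ((1 - x) / (1 - y)) * rg n x)%:E)%E /\
  (mu (preim_iter n `[x, y]) <= ((y - x) * ((1 + y) / (1 + x)) * rg n y)%:E)%E.
Proof.
elim: n x y => [|n IH] x y x0 xy y1.
  rewrite /preim_iter/= /transfer_iter/= !mulr1 lebesgue_measure_itv/= lte_fin.
  have h1 : y - x <= (y - x) * ((1 - x) / (1 - y)).
    by rewrite ler_peMr ?subr_ge0// ler_pdivlMr; lra.
  have h2 : y - x <= (y - x) * ((1 + y) / (1 + x)).
    by rewrite ler_peMr ?subr_ge0// ler_pdivlMr; lra.
  case: ifPn => _; rewrite -?EFinB !lee_fin//.
  by split; [apply: le_trans h1|apply: le_trans h2]; rewrite subr_ge0.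
have x01 : 0 <= x < 1 by apply/andP; split; lra.
have y01 : 0 <= y < 1 by apply/andP; split; lra.
have key j : 2 <= e_ j /\ c <= 1 by split; [exact: even_nat_ge2|].
have IHl j := IH _ _ (proj1 (andP (branch_l_itv c0 c1 j x01)))
   (branch_l_le c0 j x0 xy y1) (proj2 (andP (branch_l_itv c0 c1 j y01))).
have IHr j := IH _ _ (proj1 (andP (branch_r_itv c0 c1 j y01)))
   (branch_r_le c0 j x0 xy y1) (proj2 (andP (branch_r_itv c0 c1 j x01))).
have cg (u v : R) : 0 <= v -> 0 <= c / u ^+ 2 * v.
  by move=> v0; rewrite mulr_ge0// branch_coef_ge0.
have gl j z : 0 <= z < 1 -> 0 <= rg n (bl j z).
  by move=> z01; apply: rg_ge0 => //; exact: branch_l_itv.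
have gr j z : 0 <= z < 1 -> 0 <= rg n (br j z).
  by move=> z01; apply: rg_ge0 => //; exact: branch_r_itv.
have K1 : 0 <= (y - x) * ((1 - x) / (1 - y)).
  by rewrite mulr_ge0 ?subr_ge0// divr_ge0; lra.
have K2 : 0 <= (y - x) * ((1 + y) / (1 + x)).
  by rewrite mulr_ge0 ?subr_ge0// divr_ge0; lra.
move: (c0) => cp.
split; apply: measure_series_le => // j; have [e2 cl] := key j.
- apply: (le_trans (IHl j).1); rewrite lee_fin /branch_l.
  rewrite !onemB_quot ?branch_len; try (apply: lt0r_neq0; lra).
  apply: branch_step; [ring|lra| |exact: cg (gl _ _ x01)].
  have -> : e_ j - x - c = e_ j - c - x by ring.
  have -> : e_ j - y - c = e_ j - c - y by ring.
  by apply: ler_quot => //; lra.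
- apply: (le_trans (IHr j).2); rewrite lee_fin /branch_r.
  rewrite !onepD_quot ?branch_lenN; try (apply: lt0r_neq0; lra).
  apply: branch_step; [ring|lra| |exact: cg (gr _ _ x01)].
  apply: (@le_trans _ _ 1); first by rewrite ler_pdivrMr; lra.
  by rewrite ler_pdivlMr; lra.
- apply: (le_trans (IHl j).2); rewrite lee_fin /branch_l.
  rewrite !onepD_quot ?branch_lenN; try (apply: lt0r_neq0; lra).
  apply: branch_step; [ring|lra| |exact: cg (gl _ _ y01)].
  apply: (@le_trans _ _ 1); first by rewrite ler_pdivrMr; lra.
  by rewrite ler_pdivlMr; lra.
- apply: (le_trans (IHr j).1); rewrite lee_fin /branch_r.
  rewrite !onemB_quot ?branch_len; try (apply: lt0r_neq0; lra).
  apply: branch_step; [ring|lra| |exact: cg (gr _ _ y01)].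
  have -> : e_ j + x - c = e_ j - c + x by ring.
  have -> : e_ j + y - c = e_ j - c + y by ring.
  by apply: ler_quotD => //; lra.
Qed.

Lemma mem_branch_l j x y s : 0 <= x -> x <= y -> y < 1 ->
  `]bl j x, bl j y[%classic s -> Num.floor ((c / s + 1) / 2) = j.+1 /\ c / s < e_ j.
Proof.
move=> x0 xy y1; rewrite /= in_itv/= /branch_l => /andP[h1 h2].
have e2 := @even_nat_ge2 R j; move: (c0) => cp.
have s0 : 0 < s by apply: le_lt_trans h1; rewrite divr_ge0//; lra.
have k1 : c / s < e_ j - x by rewrite ltr_pdivrMr// mulrC -ltr_pdivrMr//; lra.
have k2 : e_ j - y < c / s by rewrite ltr_pdivlMr// mulrC -ltr_pdivlMr//; lra.
have ej : (j.+1 : int)%:~R = e_ j / 2 by rewrite /even_nat -muln2 natrM mulfK.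
split; last lra.
by apply/floor_def/andP; rewrite intrD ej; split; lra.
Qed.

Lemma mem_branch_r j x y s : 0 <= x -> x <= y -> y < 1 ->
  `]br j y, br j x[%classic s -> Num.floor ((c / s + 1) / 2) = j.+1 /\ e_ j < c / s.
Proof.
move=> x0 xy y1; rewrite /= in_itv/= /branch_r => /andP[h1 h2].
have e2 := @even_nat_ge2 R j; move: (c0) => cp.
have s0 : 0 < s by apply: le_lt_trans h1; rewrite divr_ge0//; lra.
have k1 : c / s < e_ j + y by rewrite ltr_pdivrMr// mulrC -ltr_pdivrMr//; lra.
have k2 : e_ j + x < c / s by rewrite ltr_pdivlMr// mulrC -ltr_pdivlMr//; lra.
have ej : (j.+1 : int)%:~R = e_ j / 2 by rewrite /even_nat -muln2 natrM mulfK.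
split; last lra.
by apply/floor_def/andP; rewrite intrD ej; split; lra.
Qed.

(** A lower bound needs disjoint pieces, hence open branch intervals: the floor identifies [j], and
    the side of [e_ j] on which [c / s] lies identifies the branch. *)
Lemma measure_series_ge n x y z K : 0 <= K -> 0 <= z < 1 ->
    0 <= x -> x <= y -> y < 1 ->
  (forall j, (mu (preim_iter n `]bl j x, bl j y[) >=
     (K * (c / (e_ j - z) ^+ 2 * rg n (bl j z)))%:E)%E) ->
  (forall j, (mu (preim_iter n `]br j y, br j x[) >=
     (K * (c / (e_ j + z) ^+ 2 * rg n (br j z)))%:E)%E) ->
  (mu (preim_iter n.+1 `]x, y[) >= (K * rg n.+1 z)%:E)%E.
Proof.
move=> K0 z01 x0 xy y1 hl hr; rewrite EFinM rgE// -nneseriesZl; last first.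
  by move=> j _; rewrite lee_fin tm_ge0// => w; exact: rg_ge0.
pose G j := `]bl j x, bl j y[ `|` `]br j y, br j x[.
pose F j := preim_iter n (G j).
have mG j : measurable (G j) by apply: measurableU; exact: measurable_itv.
have mF j : measurable (F j) by exact: measurable_preim_iter.
have tF : trivIset setT F.
  apply/trivIsetP => i j _ _ ij; apply: preim_iter_disjoint.
  rewrite -subset0 => s [Gi Gj]; move/eqP : ij; apply.
  have floorG k : G k s -> Num.floor ((c / s + 1) / 2) = k.+1.
    by move=> [/mem_branch_l|/mem_branch_r] [].
  by have := floorG _ Gi; rewrite (floorG _ Gj) => -[].
apply: (@le_trans _ _ (mu (\bigcup_j F j))); last first.
  have mU : measurable (\bigcup_j F j) by apply: bigcup_measurable => j _.
  have mT : measurable (preim_iter n.+1 `]x, y[).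
    by apply: measurable_preim_iter; exact: measurable_itv.
  apply: le_measure; [by rewrite inE|by rewrite inE|].
  rewrite -preim_iter_bigcup preim_iterS; apply: preim_iter_sub => s [j _ [|]].
    exact: fold_preimage_itv_l.
  exact: fold_preimage_itv_r.
have -> : mu (\bigcup_j F j) = (\sum_(0 <= j <oo) mu (F j))%E.
  rewrite measure_bigcup//; last by move=> j _; exact: mF.
  by apply: eq_eseriesl => j; rewrite in_setT.
apply: lee_nneseries => [j _|j _].
  rewrite -EFinM lee_fin mulr_ge0// tm_ge0// => w; exact: rg_ge0.
rewrite /F /G preim_iterU measureU; last 3 first.
- by apply: measurable_preim_iter; exact: measurable_itv.
- by apply: measurable_preim_iter; exact: measurable_itv.
- apply: preim_iter_disjoint; rewrite -subset0 => s [].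
  move=> /mem_branch_l => /(_ x0 xy y1)[_ h1] /mem_branch_r => /(_ x0 xy y1)[_].
  by rewrite ltNge (ltW h1).
by rewrite -EFinM mulrDr EFinD leeD.
Qed.

Lemma branch_stepV (d' d r' r K g : R) : d' = d -> 0 <= d -> r' <= r ->
  0 <= K * g -> d * r' * (K * g) <= d' * r * K * g.
Proof. by move=> -> d0 rr Kg; rewrite -[leRHS]mulrA ler_wpM2r// ler_wpM2l. Qed.

Lemma ler_quotV (k x y : R) : 1 <= k -> 0 <= x -> x <= y -> y < 1 ->
  (1 - y) / (1 - x) <= (k - y) / (k - x).
Proof.
move=> k1 x0 xy y1; rewrite ler_pdivrMr; last lra.
rewrite mulrAC ler_pdivlMr; last lra.
nra.
Qed.

Lemma ler_quotDV (k x y : R) : 1 <= k -> 0 <= x -> x <= y ->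
  (1 + x) / (1 + y) <= (k + x) / (k + y).
Proof.
move=> k1 x0 xy; rewrite ler_pdivrMr; last lra.
rewrite mulrAC ler_pdivlMr; last lra.
nra.
Qed.

Lemma preim_iter_lower n x y : 0 <= x -> x <= y -> y < 1 ->
  (((y - x) * ((1 - y) / (1 - x)) * rg n y)%:E <= mu (preim_iter n `]x, y[))%E /\
  (((y - x) * ((1 + x) / (1 + y)) * rg n x)%:E <= mu (preim_iter n `]x, y[))%E.
Proof.
elim: n x y => [|n IH] x y x0 xy y1.
  rewrite /preim_iter/= /transfer_iter/= !mulr1 lebesgue_measure_itv/= lte_fin.
  have h1 : (y - x) * ((1 - y) / (1 - x)) <= y - x.
    by rewrite ler_piMr ?subr_ge0// ler_pdivrMr; lra.
  have h2 : (y - x) * ((1 + x) / (1 + y)) <= y - x.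
    by rewrite ler_piMr ?subr_ge0// ler_pdivrMr; lra.
  case: ltP => xy'; rewrite -?EFinB !lee_fin//.
  by split; [apply: le_trans h1 _|apply: le_trans h2 _]; rewrite subr_le0.
have x01 : 0 <= x < 1 by apply/andP; split; lra.
have y01 : 0 <= y < 1 by apply/andP; split; lra.
have key j : 2 <= e_ j /\ c <= 1 by split; [exact: even_nat_ge2|].
have IHl j := IH _ _ (proj1 (andP (branch_l_itv c0 c1 j x01)))
   (branch_l_le c0 j x0 xy y1) (proj2 (andP (branch_l_itv c0 c1 j y01))).
have IHr j := IH _ _ (proj1 (andP (branch_r_itv c0 c1 j y01)))
   (branch_r_le c0 j x0 xy y1) (proj2 (andP (branch_r_itv c0 c1 j x01))).
have cg (u v : R) : 0 <= v -> 0 <= c / u ^+ 2 * v.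
  by move=> v0; rewrite mulr_ge0// branch_coef_ge0.
have gl j z : 0 <= z < 1 -> 0 <= rg n (bl j z).
  by move=> z01; apply: rg_ge0 => //; exact: branch_l_itv.
have gr j z : 0 <= z < 1 -> 0 <= rg n (br j z).
  by move=> z01; apply: rg_ge0 => //; exact: branch_r_itv.
have K1 : 0 <= (y - x) * ((1 - y) / (1 - x)).
  by rewrite mulr_ge0 ?subr_ge0// divr_ge0; lra.
have K2 : 0 <= (y - x) * ((1 + x) / (1 + y)).
  by rewrite mulr_ge0 ?subr_ge0// divr_ge0; lra.
move: (c0) => cp.
split; apply: measure_series_ge => // j; have [e2 cl] := key j.
- apply: (le_trans _ (IHl j).1); rewrite lee_fin /branch_l.
  rewrite !onemB_quot ?branch_lenN; try (apply: lt0r_neq0; lra).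
  apply: branch_stepV; [ring|lra| |exact: cg (gl _ _ y01)].
  have -> : e_ j - x - c = e_ j - c - x by ring.
  have -> : e_ j - y - c = e_ j - c - y by ring.
  by apply: ler_quotV => //; lra.
- apply: (le_trans _ (IHr j).2); rewrite lee_fin /branch_r.
  rewrite !onepD_quot ?branch_len; try (apply: lt0r_neq0; lra).
  apply: branch_stepV; [ring|lra| |exact: cg (gr _ _ y01)].
  apply: (@le_trans _ _ 1); first by rewrite ler_pdivrMr; lra.
  by rewrite ler_pdivlMr; lra.
- apply: (le_trans _ (IHl j).2); rewrite lee_fin /branch_l.
  rewrite !onepD_quot ?branch_len; try (apply: lt0r_neq0; lra).
  apply: branch_stepV; [ring|lra| |exact: cg (gl _ _ x01)].
  apply: (@le_trans _ _ 1); first by rewrite ler_pdivrMr; lra.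
  by rewrite ler_pdivlMr; lra.
- apply: (le_trans _ (IHr j).1); rewrite lee_fin /branch_r.
  rewrite !onemB_quot ?branch_lenN; try (apply: lt0r_neq0; lra).
  apply: branch_stepV; [ring|lra| |exact: cg (gr _ _ x01)].
  have -> : e_ j + x - c = e_ j - c + x by ring.
  have -> : e_ j + y - c = e_ j - c + y by ring.
  by apply: ler_quotDV => //; lra.
Qed.

End Escape.

(** * The critical parameter [c = 1]: averaged escape towards the neutral fixed point *)

Section EscapeCritical.
Variable R : realType.
Implicit Types (x y : R) (n i N : nat).
Local Notation rg := (transfer_iter (1 : R)).
Local Notation bl := (branch_l (1 : R)).
Local Notation br := (branch_r (1 : R)).
Local Notation tm := (branch_sum_term (1 : R)).
Local Notation e_ := (@even_nat R).
Local Notation mu := (@lebesgue_measure R).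

(** The orbit of 0 under the branch [bl 0], that is under x -> 1 / (2 - x), which converges to the
    neutral fixed point 1. *)
Definition orbit_pt i : R := i%:R / i.+1%:R.
Local Notation x_ := orbit_pt.
Definition iter_sum N x := \sum_(0 <= n < N) rg n x.
Local Notation G := iter_sum.

Lemma orbit_ptE i : x_ i = 1 - i.+1%:R^-1.
Proof. by rewrite /orbit_pt -natr1; field; rewrite natr1 pnatr_eq0. Qed.

Lemma orbit_pt_itv i : 0 <= x_ i < 1.
Proof.
rewrite divr_ge0//=.
by rewrite ltr_pdivrMr ?ltr0n// mul1r ltr_nat.
Qed.

Lemma orbit_pt_le i j : (i <= j)%N -> x_ i <= x_ j.
Proof. by move=> ij; rewrite !orbit_ptE lerD2l lerN2 lef_pV2 ?posrE ?ler_nat. Qed.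

Lemma orbit_ptS i : x_ i.+1 = bl 0 (x_ i).
Proof.
rewrite !orbit_ptE /branch_l /even_nat -[i.+2%:R]natr1 -[1.*2]/2%N.
have : (0 : R) < i.+1%:R by rewrite ltr0n.
move: (i.+1%:R) => k k0; field.
by rewrite !gt_eqF//=; nra.
Qed.

Lemma iter_sum_ge0 N x : 0 <= x < 1 -> 0 <= G N x.
Proof. by move=> x01; apply: sumr_ge0 => n _; apply: rg_ge0. Qed.

Lemma tm_iter_sum N x j : tm (G N) x j = \sum_(0 <= n < N) tm (rg n) x j.
Proof. by rewrite /branch_sum_term /iter_sum big_split/= !mulr_sumr. Qed.

(** Uses [G N.+1 = 1 + transfer (G N)] together with monotonicity of [G] in [N], so that the same
    [G N] may appear on both sides. *)
Lemma iter_sum_le N x B : 0 <= x < 1 ->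
  (forall J, \sum_(0 <= j < J) tm (G N) x j <= B) -> G N x <= 1 + B.
Proof.
move=> x01 hB; case: N hB => [|N] hB.
  rewrite /G big_geq// addr_ge0//.
  by have := hB 0%N; rewrite big_geq.
rewrite /iter_sum big_nat_recl// lerD//.
have nn (M : nat) : nonneg01 (G M) by move=> y; exact: iter_sum_ge0.
have rn n : nonneg01 (rg n) by move=> y; exact: rg_ge0.
have hB' J : \sum_(0 <= j < J) tm (G N) x j <= B.
  apply: le_trans (hB J); apply: ler_sum => j _.
  rewrite !tm_iter_sum big_nat_recr//= lerDl.
  exact: (tm_ge0 ltr01 (lexx _)).
have [E] := sum_term_fin ltr01 (lexx _) (nn N) x01 hB'.
apply: le_trans; rewrite -lee_fin E.
under eq_eseriesr do rewrite tm_iter_sum -sumEFin.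
rewrite nneseries_sum_nat; last first.
  by move=> *; rewrite lee_fin (tm_ge0 ltr01 (lexx _)).
by rewrite -sumEFin; apply: lee_sum => n _; rewrite rgE.
Qed.

(** Relative to the invariant density the transfer operator averages over the branches. All branches
    other than [bl 0] take values in [0, 1/2], and [bl 0] has weight (1 + x) / (3 - x), which is at
    least 1/3. The summand 1 is the first term of [G]. *)
Lemma max_principle N x K K1 : 0 <= x < 1 -> K1 <= K -> 0 <= K ->
  (forall y, 0 <= y <= 1 / 2 -> G N y <= K / (1 - y ^+ 2)) ->
  G N (bl 0 x) <= K1 / (1 - bl 0 x ^+ 2) ->
  (1 - x ^+ 2) * G N x <= 1 + K1 / 3 + 2 * K / 3.
Proof.
move=> x01 K1K K0 hK hK1; have x2 := sq_lt1 x01.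
have /andP[x0 x1] := x01.
have K10 : 0 <= K1.
  have b01 := branch_l_itv ltr01 (lexx (1 : R)) 0 x01.
  have := le_trans (iter_sum_ge0 N b01) hK1.
  by rewrite pmulr_lge0// invr_gt0 subr_gt0 sq_lt1.
have : G N x <= 1 + (K / (1 - x ^+ 2) - (K - K1) * wl x 0).
  apply: iter_sum_le => // -[|J].
    rewrite big_geq//.
    have := @sum_weights_le R x 1 x01; rewrite big_nat1 => h.
    have h0 := wr_ge0 0 x01; have h1 := wl_ge0 0 x01.
    have : (K - K1) * wl x 0 <= K * (1 - x ^+ 2)^-1 by apply: ler_pM => //; lra.
    by lra.
  have : K * \sum_(0 <= j < J.+1) (wl x j + wr x j) <= K / (1 - x ^+ 2).
    by apply: ler_wpM2l => //; exact: sum_weights_le.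
  rewrite !(big_nat_recl J)//= => h.
  have hr j : 1 / (e_ j + x) ^+ 2 * G N (br j x) <= K * wr x j.
    rewrite -[K]mul1r; apply: (term_r_le ltr01 (lexx _)) => //.
    apply: hK; have /andP[-> _]/= := branch_r_itv ltr01 (lexx (1 : R)) j x01.
    have e2 := @even_nat_ge2 R j.
    by rewrite /branch_r !div1r lef_pV2 ?posrE; lra.
  have hl j : 1 / (e_ j.+1 - x) ^+ 2 * G N (bl j.+1 x) <= K * wl x j.+1.
    rewrite -[K]mul1r; apply: (term_l_le ltr01 (lexx _)) => //.
    apply: hK; have /andP[-> _]/= := branch_l_itv ltr01 (lexx (1 : R)) j.+1 x01.
    have e2 := @even_nat_ge2 R j; rewrite /branch_l even_natS.
    by rewrite !div1r lef_pV2 ?posrE; lra.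
  have h0 : 1 / (e_ 0 - x) ^+ 2 * G N (bl 0 x) <= K1 * wl x 0.
    by rewrite -[K1]mul1r; apply: (term_l_le ltr01 (lexx _)).
  have hs : \sum_(0 <= j < J) tm (G N) x j.+1 <=
      K * \sum_(0 <= j < J) (wl x j.+1 + wr x j.+1).
    by rewrite mulr_sumr; apply: ler_sum => j _; rewrite mulrDr lerD.
  have := hr 0%N; rewrite {1}/branch_sum_term; lra.
move=> h.
have : (1 - x ^+ 2) * G N x <=
    (1 - x ^+ 2) * (1 + (K / (1 - x ^+ 2) - (K - K1) * wl x 0)).
  by rewrite ler_wpM2l// subr_ge0 ltW.
move/le_trans; apply.
have -> : (1 - x ^+ 2) * (1 + (K / (1 - x ^+ 2) - (K - K1) * wl x 0)) =
    (1 - x ^+ 2) + K - (K - K1) * ((1 - x ^+ 2) * wl x 0).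
  by field; rewrite gt_eqF// subr_gt0.
have : 1 / 3 <= (1 - x ^+ 2) * wl x 0.
  rewrite /wl /even_nat -[1.*2]/2%N.
  have -> : (2 - x) ^+ 2 - 1 = (1 - x) * (3 - x) by ring.
  have -> : 1 - x ^+ 2 = (1 - x) * (1 + x) by ring.
  rewrite invfM mulrACA divff ?mul1r; last by apply: lt0r_neq0; lra.
  by rewrite ler_pdivlMr; lra.
by move=> h3; have := sqr_ge0 x; nra.
Qed.

(** The intervals between consecutive orbit points have disjoint preimages inside [0, 1]. The
    denominator 2 absorbs the factor (1 + x) / (1 + y) of [preim_iter_lower]. *)
Lemma mass_bound n I :
  \sum_(0 <= i < I) (x_ i.+1 - x_ i) / 2 * rg n (x_ i) <= 1.
Proof.
have sub1 : preim_iter (1 : R) n `[0, 1]%classic `<=` `[0, 1]%classic.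
  case: n => [|n]; first by move=> s; rewrite /preim_iter.
  by move=> s; rewrite /preim_iter iterS => -[/andP[s0 s1] _]; rewrite /= in_itv/= s1 ltW.
have : (mu (preim_iter (1 : R) n `[0%R, 1%R]) <= 1)%E.
  apply: (@le_trans _ _ (mu `[0%R, 1%R]%classic)).
    apply: le_measure; rewrite ?inE//; try exact: measurable_itv.
    by apply: measurable_preim_iter; exact: measurable_itv.
  by rewrite lebesgue_measure_itv/= lte_fin ltr01 -EFinB subr0.
rewrite -lee_fin; apply: le_trans.
pose F i := preim_iter (1 : R) n `]x_ i, x_ i.+1[.
have mF i : measurable (F i) by apply: measurable_preim_iter; exact: measurable_itv.
have tF : trivIset setT F.
  apply/trivIsetP => i j _ _ ij; apply: preim_iter_disjoint.
  wlog: i j ij / (i < j)%N => [hw|ltij].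
    by move: ij; rewrite neq_ltn => /orP[|] h; [|rewrite setIC]; apply: hw; rewrite // neq_ltn h ?orbT.
  rewrite -subset0 => s []/=; rewrite !in_itv/= => /andP[_ h1] /andP[h2 _].
  by have := lt_trans h1 (le_lt_trans (orbit_pt_le ltij) h2); rewrite ltxx.
have -> : (\sum_(0 <= i < I) (x_ i.+1 - x_ i) / 2 * rg n (x_ i))%:E =
   (\sum_(0 <= i < I) ((x_ i.+1 - x_ i) / 2 * rg n (x_ i))%:E)%E.
  by rewrite sumEFin.
apply: (@le_trans _ _ (\sum_(0 <= i < I) mu (F i))%E).
  apply: lee_sum => i _.
  have xx := orbit_pt_le (leqnSn i); have /andP[xi0 _] := orbit_pt_itv i.
  have /andP[_ xi1] := orbit_pt_itv i.+1.
  apply: le_trans (preim_iter_lower ltr01 (lexx (1 : R)) n xi0 xx xi1).2.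
  rewrite lee_fin ler_wpM2r//; first by apply: rg_ge0 => //; exact: orbit_pt_itv.
  rewrite ler_wpM2l ?subr_ge0//.
  by rewrite ler_pdivlMr; lra.
rewrite big_mkord -measure_bigsetU//.
have mU : measurable (\big[setU/set0]_(i < I) F i).
  by apply: bigsetU_measurable => i _.
have mT : measurable (preim_iter (1 : R) n `[0, 1]%classic).
  by apply: measurable_preim_iter; exact: measurable_itv.
apply: le_measure; [by rewrite inE|by rewrite inE|].
- rewrite -bigcup_mkord => s [i _]; apply: preim_iter_sub => t /=.
  have /andP[xi0 _] := orbit_pt_itv i; have /andP[_ xi1] := orbit_pt_itv i.+1.
  by rewrite !in_itv/= => /andP[h1 h2]; apply/andP; split; lra.
Qed.

(** The summed density relative to the invariant one, the quantity to which the maximum principle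
    applies. *)
Definition rel_sum N x := (1 - x ^+ 2) * G N x.
Local Notation V := rel_sum.

Lemma relK N x : 0 <= x < 1 -> G N x = V N x / (1 - x ^+ 2).
Proof.
by move=> x01; rewrite /V mulrAC divff ?mul1r// gt_eqF// subr_gt0 sq_lt1.
Qed.

Lemma rel_sum_le N x : 0 <= x < 1 -> V N x <= N%:R.
Proof.
move=> x01; have x2 : 0 < 1 - x ^+ 2 by rewrite subr_gt0 sq_lt1.
rewrite /V mulrC -ler_pdivlMr// /G -(subn0 N) -sumr_const_nat mulr_suml subn0.
apply: ler_sum => n _.
have /andP[_] := dominated_iter ltr01 (lexx (1 : R)) n x01.
by rewrite expr1n.
Qed.

(** The decreasing property in [rg_harnack] costs two factors 2, from [1 - x_ i <= 2 * (1 - y)] and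
    from [1 + y <= 2 * (1 + x_ i)]. *)
Lemma rel_sum_collar N i y : x_ i <= y -> y <= x_ i.+1 -> V N y <= 4 * V N (x_ i).
Proof.
move=> xy yx; have x01 := orbit_pt_itv i; have /andP[x0 x1] := x01.
have /andP[_ x1'] := orbit_pt_itv i.+1.
have y1 : y < 1 by apply: le_lt_trans yx x1'.
rewrite /V /G [leRHS]mulrA !mulr_sumr; apply: ler_sum => n _.
have [h _] := rg_harnack ltr01 (lexx (1 : R)) n x0 xy y1.
have r0 : 0 <= rg n (x_ i) by apply: rg_ge0.
have h2 : 1 - x_ i <= 2 * (1 - y).
  have : 1 - x_ i <= 2 * (1 - x_ i.+1).
    rewrite !orbit_ptE !subKr.
    rewrite ler_pdivlMr ?ltr0n// mulrC ler_pdivrMr ?ltr0n//.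
    by rewrite -natrM ler_nat mul2n -addnn !addnS ltnS leq_addr.
  by move=> h2; lra.
have -> : 1 - y ^+ 2 = (1 + y) / (1 - y) * (1 - y) ^+ 2.
  by field; apply: lt0r_neq0; lra.
rewrite -[leLHS]mulrA.
have k0 : 0 <= (1 + y) / (1 - y) by rewrite divr_ge0; lra.
apply: (le_trans (ler_wpM2l k0 h)).
rewrite mulrA; apply: ler_wpM2r => //.
have -> : 1 - x_ i ^+ 2 = (1 - x_ i) * (1 + x_ i) by ring.
rewrite mulrAC ler_pdivrMr; last lra.
have bc : 1 + y <= 2 * (1 + x_ i) by lra.
have a0 : 0 <= 1 - x_ i by lra.
have b0 : 0 <= 1 + y by lra.
have := ler_wpM2l a0 (ler_pM a0 b0 h2 bc).
move: (1 - x_ i) (1 + y) (1 + x_ i) (1 - y) => a b e d.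
by rewrite (_ : a * (a * b) = b * a ^+ 2); [|ring];
  rewrite (_ : a * (2 * d * (2 * e)) = 4 * (a * e) * d); [|ring].
Qed.

(** The weight 1 / (i + 2) is at most twice [(x_ i.+1 - x_ i) / (1 - x_ i ^+ 2)]; the bound is
    therefore the total mass of [N] densities, written against a discrete integral of the invariant
    density. *)
Lemma weighted_mass N I :
  \sum_(0 <= i < I) (i.+2%:R)^-1 * V N (x_ i) <= 4 * N%:R.
Proof.
apply: (@le_trans _ _ (\sum_(0 <= n < N) 4 *
    \sum_(0 <= i < I) (x_ i.+1 - x_ i) / 2 * rg n (x_ i))).
  under eq_bigr do rewrite /V /G 2!mulr_sumr.
  rewrite exchange_big/=; apply: ler_sum => n _; rewrite mulr_sumr.
  apply: ler_sum => i _; rewrite !mulrA; apply: ler_wpM2r.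
    by apply: rg_ge0 => //; exact: orbit_pt_itv.
  have := orbit_pt_itv i; rewrite !orbit_ptE -[i.+2%:R]natr1.
  have : (1 : R) <= i.+1%:R by rewrite ler1n.
  move: (i.+1%:R) => k k1 /andP[_ h].
  have -> : 1 - (1 - k^-1) ^+ 2 = (2 - k^-1) / k by field; lra.
  have -> : 4 * (1 - (k + 1)^-1 - (1 - k^-1)) / 2 = (k + 1)^-1 * (2 / k).
    by field; rewrite !gt_eqF//; lra.
  apply: ler_wpM2l; first by rewrite invr_ge0; lra.
  by apply: ler_wpM2r; rewrite ?invr_ge0; lra.
rewrite -mulr_sumr ler_wpM2l//.
have -> : N%:R = \sum_(0 <= n < N) (1 : R) by rewrite sumr_const_nat subn0.
by apply: ler_sum => n _; exact: mass_bound.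
Qed.

(** The harmonic series diverges, so values above [eta * N] at all orbit points up to a large [I]
    would violate [weighted_mass]. [I] does not depend on [N]. The index 0 is avoided because the
    next step needs [1 / 2 <= x_ i]. *)
Lemma exists_small_rel_sum (eta : R) : 0 < eta ->
  exists I, forall N, exists2 i, (0 < i < I)%N & V N (x_ i) <= eta * N%:R.
Proof.
move=> eta0.
have [I hI] : exists I, 4 / eta < \sum_(1 <= i < I) (i.+2%:R : R)^-1.
  apply: contrapT => /forallNP h; apply: (@dvg_harmonic R).
  apply: nondecreasing_is_cvgn.
    by apply: nondecreasing_series => n _ _; exact: harmonic_ge0.
  (* The sum in question starts at 1/3; [1 + 1 / 2] accounts for the two harmonic terms before
     it. *)
  exists (1 + 1 / 2 + 4 / eta) => _ [n _ <-].
  have := h n.+1; move/negP; rewrite -leNgt big_add1/= => {}h.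
  apply: (@le_trans _ _ (series harmonic n.+2)).
    apply: nondecreasing_series => [k _ _|]; first exact: harmonic_ge0.
    by rewrite -addn2 leq_addr.
  rewrite /series/= !big_nat_recl//= addrA invr1 -[2%:R^-1]div1r.
  by lra.
have I1 : (1 < I)%N.
  rewrite ltnNge; apply/negP => I1; move: hI; rewrite big_geq// ltNge.
  by rewrite divr_ge0 ?(ltW eta0).
exists I => -[|N].
  by exists 1%N; rewrite ?I1//= mulr0 /V /G big_geq// mulr0.
apply: contrapT => /forall2NP h.
have : eta * N.+1%:R * \sum_(1 <= i < I) (i.+2%:R)^-1 <=
    \sum_(1 <= i < I) (i.+2%:R)^-1 * V N.+1 (x_ i).
  rewrite mulr_sumr; apply: ler_sum_nat => i iI.
  rewrite mulrC ler_wpM2l ?invr_ge0//.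
  by have [/negP/negP|/negP] := h i; [rewrite iI|rewrite -ltNge => /ltW].
have := weighted_mass N.+1 I; rewrite big_ltn ?(ltnW I1)//.
have V0 : 0 <= 2%:R^-1 * V N.+1 (x_ 0).
  have x01 := orbit_pt_itv 0.
  by rewrite mulr_ge0// mulr_ge0 ?iter_sum_ge0// subr_ge0 ltW// sq_lt1.
have : eta * N.+1%:R * (4 / eta) = 4 * N.+1%:R by field; rewrite gt_eqF.
have : eta * N.+1%:R * (4 / eta) < eta * N.+1%:R * \sum_(1 <= i < I) (i.+2%:R)^-1.
  by rewrite ltr_pM2l// mulr_gt0// ltr0n.
by lra.
Qed.

Lemma half_le_orbit i : (0 < i)%N -> 1 / 2 <= x_ i.
Proof. by move=> i0; rewrite (_ : 1 / 2 = x_ 1) ?orbit_pt_le// /orbit_pt. Qed.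

(** Pulling back along [bl 0] from the interval [x_i, x_(i+1)] reaches 0 in [i] steps. Each step
    keeps a third of the gain [S - E] over the supremum and costs 1. After [i] steps the supremum is
    bounded in terms of itself, which limits its excess over [E] to i 3^i, independently of [N]. *)
Lemma sup_rel_sum_bound N i (E : R) : (0 < i)%N -> 0 <= E ->
  (forall y, x_ i <= y <= x_ i.+1 -> V N y <= E) ->
  V N 0 <= E + i%:R * 3 ^+ i.
Proof.
move=> i0 E0 hE.
pose A := [set V N x | x in `[0, x_ i]].
have xi1 := orbit_pt_itv i; have /andP[xi0 xi1'] := xi1.
have uA : has_ubound A.
  exists N%:R => _ [x + <-]; rewrite /= in_itv/= => /andP[x0 xi].
  by apply: rel_sum_le; rewrite x0 (le_lt_trans xi).
have A0 : A (V N 0) by exists 0 => //; rewrite /= in_itv/= lexx.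
have le_sup y : 0 <= y <= x_ i -> V N y <= sup A.
  by move=> yi; apply: ub_le_sup => //; exists y => //; rewrite /= in_itv.
pose S := Num.max (sup A) E.
have SE : E <= S by rewrite le_max lexx orbT.
have leS y : 0 <= y <= x_ i -> V N y <= S.
  by move=> yi; rewrite le_max le_sup.
have p3 k : 0 < (3^-1 : R) ^+ k by rewrite exprn_gt0// invr_gt0.
have p31 k : (3^-1 : R) ^+ k <= 1 by rewrite exprn_ile1 ?invr_ge0// invf_le1// ler1n.
have claim k : (k <= i)%N -> forall x, x_ (i - k) <= x <= x_ i.+1 ->
    V N x <= S - (3^-1) ^+ k * (S - E) + k%:R.
  elim: k => [_ x|k IH ki x].
    by rewrite subn0 expr0 mul1r => /hE; lra.
  move=> /andP[h1 h2]; have [xix|xxi] := leP (x_ i) x.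
    have : V N x <= E by rewrite hE// xix.
    have : 0 <= (1 - (3^-1) ^+ k.+1) * (S - E).
      by rewrite mulr_ge0// subr_ge0.
    have : 0 <= k.+1%:R :> R by [].
    by move: (3^-1 ^+ k.+1) => p; lra.
  have x01 : 0 <= x < 1.
    have /andP[z0 _] := orbit_pt_itv (i - k.+1).
    by rewrite (le_trans z0 h1) (lt_trans xxi).
  have /andP[x0 x1] := x01.
  have b1 : x_ (i - k) <= bl 0 x.
    rewrite -subSS -subnSK ?subSS// orbit_ptS.
    apply: (branch_l_le ltr01) => //.
    by have /andP[] := orbit_pt_itv (i - k.+1).
  have b2 : bl 0 x <= x_ i.+1.
    by rewrite orbit_ptS; apply: (branch_l_le ltr01) => //; exact: ltW.
  have hb := IH (ltnW ki) (bl 0 x); rewrite b1 b2 in hb; have {}hb := hb isT.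
  (* The first constant is [S + k] rather than [S], so that it dominates the second one even if the
     accumulated cost [k] exceeds the gain. *)
  have hm := @max_principle N x (S + k%:R) (S - 3^-1 ^+ k * (S - E) + k%:R) x01.
  have q0 : 0 <= 3^-1 ^+ k * (S - E) by rewrite mulr_ge0 ?(ltW (p3 _))// subr_ge0.
  have kk : 0 <= k%:R :> R by [].
  apply: le_trans (hm _ _ _ _) _.
  - by lra.
  - by lra.
  - move=> y /andP[y0 y1].
    have y01 : 0 <= y < 1 by apply/andP; split; lra.
    rewrite relK// ler_wpM2r ?invr_ge0 ?subr_ge0 ?(ltW (sq_lt1 y01))//.
    have := leS y; rewrite y0 (le_trans y1 (half_le_orbit i0)) => /(_ isT).
    by lra.
  - have z01 := branch_l_itv ltr01 (lexx (1 : R)) 0 x01.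
    by rewrite relK// ler_wpM2r ?invr_ge0 ?subr_ge0 ?(ltW (sq_lt1 z01)).
  - have -> : (3^-1 : R) ^+ k.+1 * (S - E) = 3^-1 ^+ k * (S - E) / 3.
      by rewrite exprS; ring.
    by rewrite -[k.+1%:R]natr1; move: (3^-1 ^+ k * (S - E)) (k%:R : R) => q r; lra.
have {claim}hi y : 0 <= y <= x_ i -> V N y <= S - (3^-1) ^+ i * (S - E) + i%:R.
  move=> /andP[y0 yi]; apply: claim => //; rewrite subnn.
  by rewrite /orbit_pt mul0r y0 (le_trans yi)// orbit_pt_le.
have supS : sup A <= S - (3^-1) ^+ i * (S - E) + i%:R.
  apply: ge_sup; first by exists (V N 0).
  by move=> _ [y + <-]; rewrite /= in_itv; exact: hi.
have ii : 0 <= i%:R * 3 ^+ i :> R by rewrite mulr_ge0// exprn_ge0.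
have V0 : V N 0 <= sup A by apply: le_sup; rewrite lexx.
have [sE|Es] := leP (sup A) E; first lra.
have SA : S = sup A by rewrite /S max_l// ltW.
have : (3^-1) ^+ i * (sup A - E) <= i%:R by rewrite -SA; lra.
rewrite -ler_pdivlMl// exprVn invrK; lra.
Qed.

Lemma small_iter_sum0 (eta : R) : 0 < eta ->
  exists C : R, forall N, G N 0 <= eta * N%:R + C.
Proof.
(* The quarter absorbs the factor 4 of [rel_sum_collar]. *)
move=> eta0; have e4 : 0 < eta / 4 by rewrite divr_gt0.
have [I hI] := exists_small_rel_sum e4.
exists (I%:R * 3 ^+ I) => N; have [i /andP[i0 iI] hi] := hI N.
have -> : G N 0 = V N 0 by rewrite /V expr0n/= subr0 mul1r.
have E0 : 0 <= eta * N%:R by rewrite mulr_ge0// ltW.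
have := @sup_rel_sum_bound N i _ i0 E0; move=> /(_ _)/le_trans; apply.
  move=> y /andP[h1 h2]; apply: le_trans (rel_sum_collar N h1 h2) _.
  by lra.
rewrite lerD2l ler_pM// ?ler_nat ?exprn_ge0// 1?ltnW//.
by rewrite ler_weXn2l ?ler1n// ltnW.
Qed.

End EscapeCritical.

(** For [c < 1] this is the geometric bound. For [c = 1], the sums at 0 grow by at most an
    arbitrarily small multiple of [N], so the even terms cannot all stay above [d]. Even indices are
    required because the argument on the line applies the folded map in pairs. *)
Lemma transfer_iter_small (R : realType) (c d : R) : 0 < c -> c <= 1 -> 0 < d ->
  exists k, transfer_iter c k.*2 0 < d.
Proof.
move=> c0 c1 d0; have z01 : 0 <= (0 : R) < 1 by rewrite lexx ltr01.
have [cE|cN1] := eqVneq c 1; last first.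
  have : (fun n => c ^+ n) @ \oo --> (0 : R).
    by apply: cvg_expr; rewrite ger0_norm ?ltW// lt_neqAle cN1.
  move=> /cvgrPdist_lt/(_ _ d0)[n _ /(_ n.*2)]/=.
  rewrite -addnn leq_addr => /(_ isT); rewrite sub0r normrN => h.
  exists n; rewrite -addnn; apply: le_lt_trans (le_lt_trans (ler_norm _) h).
  have /andP[_] := dominated_iter c0 c1 (n + n) z01.
  by rewrite expr0n/= subr0 divr1.
(* With [d / 4] the sum of [2 M] terms is at most [M d / 2 + C], which is less than [M d] once
   [M > 2 C / d]. *)
subst c; have d4 : 0 < d / 4 by rewrite divr_gt0.
have [C hC] := small_iter_sum0 d4.
have [M hM] : exists M : nat, 2 * C / d < M%:R.
  by exists (Num.truncn (2 * C / d)).+1; exact: truncnS_gt.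
apply: contrapT => /forallNP h.
have hM' : M%:R * d <= iter_sum M.*2 0.
  rewrite /iter_sum; elim: M {hM} => [|M IH]; first by rewrite mul0r big_geq.
  rewrite doubleS 2?big_nat_recr//= -natr1 mulrDl mul1r -addrA lerD//.
  have r0 := rg_ge0 ltr01 (lexx (1 : R)) M.*2.+1 z01.
  have /negP := h M; rewrite -leNgt => /le_trans; apply.
  by rewrite lerDl; exact: r0.
have := hC M.*2; rewrite (_ : M.*2%:R = M%:R * 2) => [h1|]; last first.
  by rewrite -muln2 natrM.
by move: hM; rewrite ltr_pdivrMr//; lra.
Qed.

(** With left endpoint 0, the first bound of [preim_iter_upper] involves the density at 0 only, at
    the price of the factor 1 / (1 - a). *)
Theorem fold_escape (R : realType) (c a d : R) : 0 < c -> c <= 1 ->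
  0 <= a < 1 -> 0 < d ->
  exists k, (@lebesgue_measure R (preim_iter c k.*2 `[0%R, a]) < d%:E)%E.
Proof.
move=> c0 c1 /andP[a0 a1] d0.
have d1 : 0 < d * (1 - a) by rewrite mulr_gt0// subr_gt0.
have [k hk] := transfer_iter_small c0 c1 d1; exists k.
apply: le_lt_trans (preim_iter_upper c0 c1 k.*2 (lexx 0) a0 a1).1 _.
rewrite lte_fin !subr0 mul1r.
apply: (@le_lt_trans _ _ (1 / (1 - a) * transfer_iter c k.*2 0)).
  apply: ler_wpM2r; first by apply: rg_ge0; rewrite // lexx ltr01.
  by rewrite ler_wpM2r ?invr_ge0 ?subr_ge0 ?ltW.
by rewrite mul1r mulrC ltr_pdivrMr ?subr_gt0.
Qed.

(** * Bounded integrands *)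

Section BoundedMeasurable.
Context d (X : measurableType d) (R : realType).
Implicit Types (f g : X -> R) (A : set X).

Definition bounded_measurable f :=
  measurable_fun [set: X] f /\ exists M : R, forall x, `|f x| <= M.
Local Notation bm := bounded_measurable.

Lemma bm_cst (r : R) : bm (fun=> r).
Proof. by split; [exact: measurable_cst|exists `|r|]. Qed.

Lemma bm_add f g : bm f -> bm g -> bm (fun x => f x + g x).
Proof.
move=> [mf [M hM]] [mg [N hN]]; split; first exact: measurable_funD.
by exists (M + N) => x; rewrite (le_trans (ler_normD _ _))// lerD.
Qed.

Lemma bm_opp f : bm f -> bm (fun x => - f x).
Proof.
move=> [mf [M hM]]; split; first exact: measurable_funN.
by exists M => x; rewrite normrN.
Qed.

Lemma bm_sub f g : bm f -> bm g -> bm (fun x => f x - g x).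
Proof. by move=> hf hg; apply: bm_add => //; exact: bm_opp. Qed.

Lemma bm_mul f g : bm f -> bm g -> bm (fun x => f x * g x).
Proof.
move=> [mf [M hM]] [mg [N hN]]; split; first exact: measurable_funM.
by exists (M * N) => x; rewrite normrM ler_pM.
Qed.

Lemma bm_scale (r : R) f : bm f -> bm (fun x => r * f x).
Proof. by move=> hf; apply: bm_mul => //; exact: bm_cst. Qed.

Lemma bm_indic A : measurable A -> bm (\1_A : X -> R).
Proof.
move=> mA; split; first exact: measurable_indic.
by exists 1 => x; rewrite indicE; case: (_ \in _); rewrite ?normr1 ?normr0.
Qed.

Variable m : {finite_measure set X -> \bar R}.

Lemma bm_integrable f : bm f -> m.-integrable [set: X] (EFin \o f).
Proof.
move=> [mf [M hM]]; apply: measurable_bounded_integrable => //.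
  by rewrite -ge0_fin_numE// fin_num_measure.
exists M; split; first by rewrite num_real.
by move=> N MN x _; exact: le_trans (hM x) (ltW MN).
Qed.

Lemma bm_integralD f g : bm f -> bm g ->
  \int[m]_x (f x + g x) = \int[m]_x f x + \int[m]_x g x.
Proof. by move=> hf hg; apply: RintegralD => //; exact: bm_integrable. Qed.

Lemma bm_integralB f g : bm f -> bm g ->
  \int[m]_x (f x - g x) = \int[m]_x f x - \int[m]_x g x.
Proof. by move=> hf hg; apply: RintegralB => //; exact: bm_integrable. Qed.

Lemma bm_integralZ (r : R) f : bm f ->
  \int[m]_x (r * f x) = r * \int[m]_x f x.
Proof. by move=> hf; apply: RintegralZl => //; exact: bm_integrable. Qed.

Lemma bm_integral_le f g : bm f -> bm g -> (forall x, f x <= g x) ->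
  \int[m]_x f x <= \int[m]_x g x.
Proof.
by move=> hf hg fg; apply: le_Rintegral => //; exact: bm_integrable.
Qed.

Lemma bm_integral_indic A : measurable A -> \int[m]_x \1_A x = fine (m A).
Proof. by move=> mA; rewrite /Rintegral integral_indic// setIT. Qed.

Lemma bm_integral_cvg (F : nat -> X -> R) f (M : R) :
  (forall n, measurable_fun [set: X] (F n)) ->
  (forall n x, `|F n x| <= M) -> (forall x, F n x @[n --> \oo] --> f x) ->
  (\int[m]_x F n x) @[n --> \oo] --> \int[m]_x f x.
Proof.
move=> mF hM Ff.
have mf : measurable_fun [set: X] f.
  by apply: (measurable_fun_cvg mF) => x _; exact: Ff.
have [] := @dominated_convergence _ X R m setT measurableT
  (fun n => EFin \o F n) (EFin \o f) (cst M%:E).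
- by move=> n; exact/measurable_EFinP.
- exact/measurable_EFinP.
- by apply: aeW => x _; apply: cvg_EFin; [exact: nearW|exact: Ff].
- exact: (bm_integrable (bm_cst M)).
- by apply: aeW => x n _ /=; rewrite lee_fin.
move=> intf _ h; have := fine_cvg _; apply.
rewrite fineK//; exact: integrable_fin_num.
Qed.

End BoundedMeasurable.

(** * Integrals over one period: shifts and derivatives of periodic functions *)

Section ShiftInvariance.
Variable R : realType.
Local Notation mu := (@lebesgue_measure R).
Implicit Types (f : R -> R) (a b h : R).

Lemma integral_shift f a b h : a <= b -> continuous f ->
  (\int[mu]_(x in `[(a + h)%R, (b + h)%R]) (f x)%:E =
   \int[mu]_(x in `[a, b]) (f (x + h))%:E)%E.
Proof.
move=> ab cf.
have dF : (fun x : R => x + h)^`() = fun=> 1.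
  by apply/funext => x; rewrite derive1E deriveD// !derive_val addr0.
rewrite (@integration_by_substitution_increasing R (fun x => x + h)%R f a b)//.
- by apply: eq_integral => x _; rewrite dF /= mulr1.
- by move=> x y _ _ xy; rewrite ltrD2r.
- by move=> x _; rewrite dF; exact: cst_continuous.
- by rewrite dF; apply: is_cvg_cst.
- by rewrite dF; apply: is_cvg_cst.
- have cF : continuous (fun x : R => x + h).
    by move=> x; apply: cvgD; [exact: cvg_id|exact: cvg_cst].
  split => [x _| |]; first exact: derivableD.
  + by apply: cvg_at_right_filter; exact: cF.
  + by apply: cvg_at_left_filter; exact: cF.
- exact: continuous_subspaceT.
Qed.

Lemma continuous_shift f h : continuous f -> continuous (fun x : R => f (x + h)).
Proof.
move=> cf x; apply: (@continuous_comp _ _ _ (fun x => x + h) f); last exact: cf.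
by apply: cvgD; [exact: cvg_id|exact: cvg_cst].
Qed.

Lemma integral_itv_split f a b e : a <= b -> b <= e -> continuous f ->
  (forall x, 0 <= f x) ->
  (\int[mu]_(x in `[a, e]) (f x)%:E =
   \int[mu]_(x in `[a, b]) (f x)%:E + \int[mu]_(x in `[b, e]) (f x)%:E)%E.
Proof.
move=> ab be cf f0.
have mf D : measurable_fun D (EFin \o f).
  apply/measurable_EFinP; apply: measurable_funS (continuous_measurable_fun cf) => //.
rewrite -(@integral_itv_obnd_cbnd R b (BRight e))//.
rewrite -ge0_integral_setU//=; last 2 first.
- by move=> x _; rewrite lee_fin.
- apply/disj_setPS => x [/=]; rewrite !in_itv/= => /andP[_ xb] /andP[bx _].
  by move: xb; rewrite leNgt bx.
by rewrite -itv_bndbnd_setU// bnd_simp.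
exact: mf.
Qed.

(** [ltr0Sn R 1] states [0 < 2]: this is the uniform probability on the period [0, 2]. *)
Local Notation U := (uniform_prob (ltr0Sn R 1)).

Lemma uniform_shift f h : 0 <= h -> continuous f -> (forall x, f (x + 2) = f x) ->
  (exists M : R, forall x, `|f x| <= M) ->
  \int[U]_x f (x + h) = \int[U]_x f x.
Proof.
move=> h0 cf pf [M hM].
have bf : bounded_measurable f by split; [exact: continuous_measurable_fun|exists M].
have cfh := @continuous_shift f h cf.
have bfh : bounded_measurable (fun x : R => f (x + h)).
  by split; [exact: continuous_measurable_fun|exists M].
have bM := @bm_cst _ R R M.
(* Adding the bound [M] makes the integrand nonnegative, as the integral formula for the uniform law
   requires. *)
apply: (@addIr _ (\int[U]_x M)).
rewrite -!bm_integralD//; congr fine.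
pose F x := f x + M.
have F0 x : 0 <= F x by have := hM x; rewrite ler_norml /F; lra.
have cF : continuous F by move=> x; apply: cvgD; [exact: cf|exact: cvg_cst].
have cFh : continuous (fun x => F (x + h)).
  by move=> x; apply: cvgD; [exact: cfh|exact: cvg_cst].
have pF x : F (x + 2) = F x by rewrite /F pf.
have m1 : measurable_fun [set: R] (fun x => (f x + M)%:E).
  by apply/measurable_EFinP; exact: (continuous_measurable_fun cF).
have m2 : measurable_fun [set: R] (fun x => (f (x + h) + M)%:E).
  by apply/measurable_EFinP; exact: (continuous_measurable_fun cFh).
rewrite (integral_uniform _ m1); last by move=> x; rewrite lee_fin F0.
rewrite (integral_uniform _ m2); last by move=> x; rewrite lee_fin F0.
congr (_ * _)%E.
transitivity (\int[mu]_(x in `[0%R, 2%R]) (F (x + h))%:E)%E => //.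
rewrite -integral_shift// add0r.
have i1 : (\int[mu]_(x in `[0%R, (2 + h)%R]) (F x)%:E =
   \int[mu]_(x in `[0%R, h]) (F x)%:E + \int[mu]_(x in `[h, (2 + h)%R]) (F x)%:E)%E.
  by apply: integral_itv_split => //; lra.
have i2 : (\int[mu]_(x in `[0%R, (2 + h)%R]) (F x)%:E =
   \int[mu]_(x in `[0%R, 2%R]) (F x)%:E + \int[mu]_(x in `[2%R, (2 + h)%R]) (F x)%:E)%E.
  by apply: integral_itv_split => //; lra.
have i3 : (\int[mu]_(x in `[2%R, (2 + h)%R]) (F x)%:E =
   \int[mu]_(x in `[0%R, h]) (F x)%:E)%E.
  rewrite -[X in `[X, _]](add0r 2) (addrC 2 h) integral_shift//.
  by apply: eq_integral => x _; rewrite pF.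
have fin : (\int[mu]_(x in `[0%R, h]) (F x)%:E)%E \is a fin_num.
  apply: integrable_fin_num => //; apply: continuous_compact_integrable.
    exact: segment_compact.
  exact: continuous_subspaceT.
by rewrite -[LHS](addeK _ fin) [X in (X - _)%E]addeC -i1 i2 i3 addeK.
Qed.

(** [df] is only bounded and measurable. Instead of the fundamental theorem of calculus, difference
    quotients are used: their integrals vanish by shift invariance, and the mean value theorem
    bounds them for dominated convergence. *)
Lemma uniform_derive0 (f df : R -> R) : (forall x : R, is_derive x (1 : R) f (df x)) ->
  (forall x, f (x + 2) = f x) -> bounded_measurable f -> bounded_measurable df ->
  \int[U]_x df x = 0.
Proof.
move=> fdf pf [mf bf] [mdf [M hM]].
have cf : continuous f.
  by move=> x; apply/differentiable_continuous/derivable1_diffP; exact: (@ex_derive _ _ _ _ _ _ _ (fdf x)).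
pose F n x := n.+1%:R * (f (x + n.+1%:R^-1) - f x).
have F0 n : \int[U]_x F n x = 0.
  have bfn : bounded_measurable (fun x : R => f (x + n.+1%:R^-1)).
    split; last by have [N hN] := bf; exists N.
    exact: (continuous_measurable_fun (@continuous_shift f n.+1%:R^-1 cf)).
  have bmf : bounded_measurable f by split.
  rewrite (@bm_integralZ _ _ _ U _ _ (bm_sub bfn bmf)).
  have := bm_integralB U bfn bmf => /= ->.
  by rewrite uniform_shift// ?subrr ?mulr0// invr_ge0.
have Fdf x : F n x @[n --> \oo] --> df x.
  have [dx dxE] := fdf x.
  have cd : (fun h => h^-1 *: (f (h *: 1 + x) - f x)) h @[h --> 0^'] --> df x.
    by rewrite -dxE; exact: dx.
  rewrite (_ : F ^~ x = fun n => (n.+1%:R^-1)^-1 *: (f (n.+1%:R^-1 *: 1 + x) - f x)); last first.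
    by apply/funext => n; rewrite invrK /GRing.scale/= mulr1 [_ + x]addrC.
  apply: ((cvgr_dnbhsP _ _ _).1 cd (fun n => n.+1%:R^-1)).
  by split; [move=> n; rewrite invr_eq0|exact: cvg_harmonic].
have FM n x : `|F n x| <= M.
  have h0 : (0 : R) < n.+1%:R^-1 by rewrite invr_gt0.
  have [c _] := @MVT R f df x (x + n.+1%:R^-1) (ltr_pwDr h0 (lexx x))
    (fun y _ => fdf y) (continuous_subspaceT cf).
  rewrite /F addrAC subrr add0r => ->.
  by rewrite mulrCA divff ?mulr1.
have mF n : measurable_fun [set: R] (F n).
  apply: measurable_funM => //; apply: measurable_funB => //.
  apply: (measurableT_comp mf); exact: measurable_funD.
have := @bm_integral_cvg _ _ R U F df M mF FM Fdf.
under eq_fun do rewrite F0.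
by move=> h; apply: (cvg_unique _ h) => //; exact: cvg_cst.
Qed.

End ShiftInvariance.

(** * Transfer operator on the line *)

Section Calculus.
Variable R : realType.
Implicit Types (f : R -> R) (x d C : R).

(** Serves where differentiation rules do not apply, in particular for [y |y|] at 0 and for the
    lifted potentials at even integers. *)
Lemma is_derive_quadratic f x d C :
  (forall h, `|f (x + h) - f x - d * h| <= C * h ^+ 2) -> is_derive x (1 : R) f d.
Proof.
move=> hf; apply/is_derive1_caratheodory.
exists (fun z => if z == x then d else (f z - f x) / (z - x)).
have C0 : 0 <= C by have := le_trans (normr_ge0 _) (hf 1); rewrite expr1n mulr1.
split => [z| |]; last by rewrite eqxx.
  have [->|zx] := eqVneq z x; first by rewrite !subrr mulr0.
  by rewrite divfK// subr_eq0.
have gd z : `|(if z == x then d else (f z - f x) / (z - x)) - d| <= C * `|z - x|.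
  have [->|zx] := eqVneq z x; first by rewrite !subrr normr0 mulr0.
  have zx0 : 0 < `|z - x| by rewrite normr_gt0 subr_eq0.
  have -> : (f z - f x) / (z - x) - d = (f z - f x - d * (z - x)) / (z - x).
    by field; rewrite subr_eq0.
  rewrite normf_div ler_pdivrMr// -mulrA -expr2 real_normK ?num_real//.
  by have := hf (z - x); rewrite (_ : x + (z - x) = z)//; ring.
apply/cvgrPdist_le => eps eps0; rewrite eqxx.
have d0 : 0 < eps / (C + 1) by rewrite divr_gt0// ltr_wpDl.
near=> z; rewrite distrC; apply: le_trans (gd z) _.
have : `|x - z| <= eps / (C + 1).
  by near: z; apply: (@cvgr_dist_le _ _ _ (nbhs x) _ id x) => //; exact: cvg_id.
rewrite distrC ler_pdivlMr ?ltr_wpDl// mulrDr mulr1 mulrC.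
by have := normr_ge0 (z - x); lra.
Unshelve. all: by end_near. Qed.

Lemma is_derive_mul_norm x : is_derive x (1 : R) (fun y => y * `|y|) (2 * `|x|).
Proof.
apply: (@is_derive_quadratic _ _ _ 1) => h; rewrite mul1r ler_norml.
have s1 := sqr_ge0 (x + h); have s2 := sqr_ge0 x; have s3 := sqr_ge0 h.
have [x0|x0] := leP 0 x; have [xh0|xh0] := leP 0 (x + h).
- by rewrite !ger0_norm//; apply/andP; split; lra.
- have s4 := mulr_ge0_le0 x0 (ltW xh0).
  by rewrite (ger0_norm x0) (ltr0_norm xh0); apply/andP; split; lra.
- have s4 := mulr_le0_ge0 (ltW x0) xh0.
  by rewrite (ltr0_norm x0) (ger0_norm xh0); apply/andP; split; lra.
- by rewrite !ltr0_norm//; apply/andP; split; lra.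
Qed.

Lemma is_derive_add f (g : R -> R) x (a b : R) : is_derive x (1 : R) f a ->
  is_derive x (1 : R) g b -> is_derive x (1 : R) (fun y => f y + g y) (a + b).
Proof. by move=> fa gb; exact: is_deriveD. Qed.

Lemma is_derive_mul f (g : R -> R) x (a b : R) : is_derive x (1 : R) f a ->
  is_derive x (1 : R) g b -> is_derive x (1 : R) (fun y => f y * g y) (f x * b + g x * a).
Proof. by move=> fa gb; exact: is_deriveM. Qed.

Lemma is_derive_scale f x (k a : R) : is_derive x (1 : R) f a ->
  is_derive x (1 : R) (fun y => k * f y) (k * a).
Proof. by move=> fa; exact: is_deriveZ. Qed.

Lemma is_derive_addr f x (k a : R) : is_derive x (1 : R) f a ->
  is_derive x (1 : R) (fun y => f y + k) a.
Proof.
by move=> fa; rewrite -[a]addr0; apply: is_derive_add => //; exact: is_derive_cst.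
Qed.

Lemma is_derive_comp_fun f (g : R -> R) x (a b : R) : is_derive (g x) (1 : R) f a ->
  is_derive x (1 : R) g b -> is_derive x (1 : R) (fun y => f (g y)) (a * b).
Proof. by move=> fa gb; exact: (@is_derive1_comp _ f g x a b fa gb). Qed.

(* A second difference of u |u| makes the step from 1 to 0 of class C^1. *)
Definition cutoff (e x : R) : R :=
  let u := (x - 1) / e in
  2^-1 - ((u + 1) * `|u + 1| - 2 * (u * `|u|) + (u - 1) * `|u - 1|) / 4.

Definition dcutoff (e x : R) : R :=
  let u := (x - 1) / e in
  - (`|u + 1| - 2 * `|u| + `|u - 1|) / (2 * e).

Lemma is_derive_affine_comp f x d (a b : R) :
  is_derive (a * x + b) (1 : R) f d -> is_derive x (1 : R) (fun y => f (a * y + b)) (a * d).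
Proof.
move=> fd.
have aff : is_derive x (1 : R) (fun y : R => a * y + b) a.
  by apply: (@is_derive_quadratic _ _ _ 0) => h; rewrite mul0r normr_le0 subr_eq0 subr_eq; apply/eqP; ring.
by rewrite [a * d]mulrC; exact: (@is_derive1_comp _ f (fun y => a * y + b) x d a fd aff).
Qed.

Lemma is_derive_cutoff e x : e != 0 ->
  is_derive x (1 : R) (cutoff e) (dcutoff e x).
Proof.
move=> e0; have N (b : R) : is_derive x (1 : R)
    (fun y => (e^-1 * y + b) * `|e^-1 * y + b|) (e^-1 * (2 * `|e^-1 * x + b|)).
  exact: (is_derive_affine_comp (is_derive_mul_norm _)).
have -> : cutoff e = fun y => - 4^-1 * (((e^-1 * y + (1 - e^-1)) * `|e^-1 * y + (1 - e^-1)|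
   + (- 2) * ((e^-1 * y + (- e^-1)) * `|e^-1 * y + (- e^-1)|))
   + ((e^-1 * y + (- 1 - e^-1)) * `|e^-1 * y + (- 1 - e^-1)|)) + 2^-1.
  apply/funext => y; rewrite /cutoff.
  have -> : (y - 1) / e + 1 = e^-1 * y + (1 - e^-1) by field.
  have -> : (y - 1) / e - 1 = e^-1 * y + (- 1 - e^-1) by field.
  have -> : (y - 1) / e = e^-1 * y + (- e^-1) by field.
  by field.
have := is_derive_addr 2^-1 (is_derive_scale (- 4^-1) (is_derive_add
   (is_derive_add (N (1 - e^-1)) (is_derive_scale (- 2) (N (- e^-1)))) (N (- 1 - e^-1)))).
congr is_derive; rewrite /dcutoff.
have -> : (x - 1) / e + 1 = e^-1 * x + (1 - e^-1) by field.
have -> : (x - 1) / e - 1 = e^-1 * x + (- 1 - e^-1) by field.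
have -> : (x - 1) / e = e^-1 * x + (- e^-1) by field.
by field.
Qed.

Variable e : R.
Hypotheses (e0 : 0 < e) (e1 : e < 1).

Lemma cutoff_l x : x <= 1 - e -> cutoff e x = 1.
Proof.
move=> xe; rewrite /cutoff.
have : (x - 1) / e <= -1 by rewrite ler_pdivrMr//; lra.
move: ((x - 1) / e) => u u1.
rewrite (ler0_norm (_ : u + 1 <= 0)) ?(ler0_norm (_ : u <= 0)) ?(ler0_norm (_ : u - 1 <= 0)); lra.
Qed.

Lemma cutoff_r x : 1 + e <= x -> cutoff e x = 0.
Proof.
move=> xe; rewrite /cutoff.
have : 1 <= (x - 1) / e by rewrite ler_pdivlMr//; lra.
move: ((x - 1) / e) => u u1.
rewrite (ger0_norm (_ : 0 <= u + 1)) ?(ger0_norm (_ : 0 <= u)) ?(ger0_norm (_ : 0 <= u - 1)); lra.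
Qed.

Lemma cutoff_itv x : 0 <= cutoff e x <= 1.
Proof.
have [h|h] := leP x (1 - e); first by rewrite cutoff_l// ler01 lexx.
have [h'|h'] := leP (1 + e) x; first by rewrite cutoff_r// ler01 lexx.
rewrite /cutoff.
have : -1 <= (x - 1) / e by rewrite ler_pdivlMr//; lra.
have : (x - 1) / e <= 1 by rewrite ler_pdivrMr//; lra.
move: ((x - 1) / e) => u u1 u2.
rewrite (ger0_norm (_ : 0 <= u + 1)) ?(ler0_norm (_ : u - 1 <= 0)); try lra.
by have [u0|u0] := leP 0 u; rewrite ?(ger0_norm u0) ?(ltr0_norm u0); apply/andP; split; nra.
Qed.

Lemma dcutoff_le x : `|dcutoff e x| <= e^-1.
Proof.
rewrite /dcutoff mulNr normrN normrM [X in _ * X]ger0_norm ?invr_ge0 ?mulr_ge0 ?(ltW e0)//.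
move: ((x - 1) / e) => u; rewrite invfM mulrA.
rewrite -[leRHS]mul1r ler_wpM2r ?invr_ge0 ?(ltW e0)// ler_pdivrMr// mul1r.
have -> : `|u + 1| - 2 * `|u| + `|u - 1| = (`|u + 1| - `|u|) + (`|u - 1| - `|u|) by ring.
apply: le_trans (ler_normD _ _) _.
have h1 := ler_dist_dist (u + 1) u; have h2 := ler_dist_dist (u - 1) u.
rewrite (_ : u + 1 - u = 1) in h1; last by ring.
rewrite (_ : u - 1 - u = -1) in h2; last by ring.
by move: h1 h2; rewrite normrN normr1; lra.
Qed.

Lemma measurable_cutoff : measurable_fun [set: R] (cutoff e).
Proof.
apply: continuous_measurable_fun => x.
apply/differentiable_continuous/derivable1_diffP.
exact: (@ex_derive _ _ _ _ _ _ _ (is_derive_cutoff x (lt0r_neq0 e0))).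
Qed.

Lemma measurable_dcutoff : measurable_fun [set: R] (dcutoff e).
Proof.
have ma (b : R) : measurable_fun [set: R] (fun x : R => `|(x - 1) / e + b|).
  apply: measurableT_comp; first exact: normr_measurable.
  by apply: measurable_funD => //; apply: measurable_funM => //; apply: measurable_funD.
apply: measurable_funM => //; apply: measurable_funN; apply: measurable_funD => //.
apply: measurable_funB => //; apply: measurable_funM => //.
by under eq_fun do rewrite -[_ / e]addr0; exact: ma.
Qed.

End Calculus.

Section Mod2.
Variable R : realType.
Implicit Types (x y : R).

Definition mod2 x : R := x - 2 * (Num.floor (x / 2))%:~R.

Lemma mod2_itv x : 0 <= mod2 x < 2.
Proof.
rewrite /mod2; have /andP[h1] := floor_itv (x / 2).
by rewrite intrD /= => h2; apply/andP; split; lra.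
Qed.

Lemma mod2D x (k : int) : mod2 (x + 2 * k%:~R) = mod2 x.
Proof.
rewrite /mod2 (_ : (x + 2 * k%:~R) / 2 = x / 2 + k%:~R); last by field.
by rewrite floorDrz ?intr_int// intrD intrKfloor; ring.
Qed.

Lemma mod2_id x : 0 <= x < 2 -> mod2 x = x.
Proof.
move=> /andP[x0 x2]; rewrite /mod2 (_ : Num.floor (x / 2) = 0) ?mulr0 ?subr0//.
by apply/floor_def; rewrite add0r /=; apply/andP; split; lra.
Qed.

Lemma mod2_eq x : exists k : int, x = mod2 x + 2 * k%:~R.
Proof. by exists (Num.floor (x / 2)); rewrite subrK. Qed.

Lemma measurable_mod2 : measurable_fun [set: R] mod2.
Proof.
apply: measurable_funB => //; apply: measurable_funM => //.
apply: (measurableT_comp (@measurable_floor R)).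
by apply: measurable_funM.
Qed.

Definition periodic2 (T : Type) (f : R -> T) := forall x, f (x + 2) = f x.

Lemma periodic2_int (T : Type) (f : R -> T) : periodic2 f ->
  forall x (k : int), f (x + 2 * k%:~R) = f x.
Proof.
move=> pf x; have pn (n : nat) y : f (y + 2 * n%:R) = f y.
  elim: n => [|n IH]; first by rewrite mulr0 addr0.
  by rewrite -[n.+1%:R]natr1 mulrDr mulr1 addrA pf IH.
case=> n; first exact: pn.
by rewrite NegzE mulrNz mulrN -[RHS](pn n.+1) -[in RHS](subrK (2 * n.+1%:R) x) pn.
Qed.

Lemma periodic2_mod2 (T : Type) (f : R -> T) x : periodic2 f -> f (mod2 x) = f x.
Proof. by move=> pf; have [k {2}->] := mod2_eq x; rewrite periodic2_int. Qed.

End Mod2.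

(** * Lifting the circle [R / 2 Z] to the line, and the dual of the transfer operator *)

Section LiftOperator.
Variables (R : realType) (g e : R).
Hypotheses (e0 : 0 < e) (e1 : e < 1) (eg : (1 + e) ^+ 2 < `|g|).
Implicit Types (x y c M : R) (f h phi D : R -> R) (n : nat).
Local Notation p_ := (cutoff e).
Local Notation dp_ := (dcutoff e).
Local Notation bm := (@bounded_measurable _ R R).
Local Notation U := (uniform_prob (ltr0Sn R 1)).

(** Mass at a point of the circle is shared between the representatives [y] and [y - 2]. The cutoff
    vanishes for y >= 1 + e and equals 1 for y <= 1 - e, so all lifted mass lies in [-1 - e, 1 + e],
    with weights smooth enough to be differentiated. *)
Definition lift_avg f x :=
  let y := mod2 x in p_ y * f y + (1 - p_ y) * f (y - 2).
(** Dual to lifting a measure, applying [t -> g / t] and reducing modulo 2. The value 0 at even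
    integers is forced by the derivative identity in [test_function_potential], since potentials
    vanish to second order there. *)
Definition transfer_dual f x :=
  if mod2 x == 0 then 0 else lift_avg (fun y => f (g / y)) x.
Local Notation L := lift_avg.
Local Notation K := transfer_dual.

Lemma cutoff_ge0 x : 0 <= p_ x. Proof. by have /andP[] := cutoff_itv e0 x. Qed.
Lemma cutoff_le1 x : 0 <= 1 - p_ x. Proof. by have /andP[_] := cutoff_itv e0 x; rewrite subr_ge0. Qed.

Lemma lift_avg_add f h x : L (fun y => f y + h y) x = L f x + L h x.
Proof. by rewrite /L; ring. Qed.

Lemma lift_avg_scale c f x : L (fun y => c * f y) x = c * L f x.
Proof. by rewrite /L; ring. Qed.

Lemma lift_avg_le f h x : (forall y, f y <= h y) -> L f x <= L h x.
Proof. by move=> fh; rewrite /L lerD// ler_wpM2l// ?cutoff_ge0 ?cutoff_le1. Qed.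

Lemma lift_avg_cst c x : L (fun=> c) x = c. Proof. by rewrite /L; ring. Qed.

Lemma lift_avg_norm f M x : (forall y, `|f y| <= M) -> `|L f x| <= M.
Proof.
move=> fM; rewrite ler_norml -{1}(lift_avg_cst (- M) x) -{2}(lift_avg_cst M x).
by apply/andP; split; apply: lift_avg_le => y; have := fM y; rewrite ler_norml => /andP[].
Qed.

Lemma transfer_dual_add f h : K (fun y => f y + h y) = fun x => K f x + K h x.
Proof. by apply/funext => x; rewrite /K; case: ifPn => _; rewrite ?addr0// lift_avg_add. Qed.

Lemma transfer_dual_scale c f : K (fun y => c * f y) = fun x => c * K f x.
Proof. by apply/funext => x; rewrite /K; case: ifPn => _; rewrite ?mulr0// lift_avg_scale. Qed.

Lemma transfer_dual_le f h : (forall y, f y <= h y) -> forall x, K f x <= K h x.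
Proof. by move=> fh x; rewrite /K; case: ifPn => _ //; apply: lift_avg_le. Qed.

Lemma transfer_dual_norm f M : (forall y, `|f y| <= M) -> forall x, `|K f x| <= M.
Proof.
move=> fM x; rewrite /K; case: ifPn => _; last exact: lift_avg_norm.
by rewrite normr0; apply: le_trans (fM x).
Qed.

Lemma measurable_lift_avg f : measurable_fun [set: R] f -> measurable_fun [set: R] (L f).
Proof.
move=> mf; have mp : measurable_fun [set: R] (p_ \o @mod2 R).
  exact: (measurableT_comp (measurable_cutoff e0) (@measurable_mod2 R)).
apply: measurable_funD; apply: measurable_funM => //.
- exact: (measurableT_comp mf (@measurable_mod2 R)).
- exact: measurable_funB.
- apply: (measurableT_comp mf); apply: measurable_funB => //.
  exact: measurable_mod2.
Qed.

Lemma measurable_transfer_dual f : measurable_fun [set: R] f -> measurable_fun [set: R] (K f).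
Proof.
move=> mf; apply: measurable_fun_ifT => //.
  by apply: measurable_fun_eqr => //; exact: measurable_mod2.
apply: measurable_lift_avg; apply: (measurableT_comp mf).
by apply: measurable_funM => //; exact: measurable_invr.
Qed.

Lemma bm_transfer_dual f : bm f -> bm (K f).
Proof.
by move=> [mf [M hM]]; split; [exact: measurable_transfer_dual|exists M; exact: transfer_dual_norm].
Qed.

Lemma bm_lift_avg f : bm f -> bm (L f).
Proof.
by move=> [mf [M hM]]; split; [exact: measurable_lift_avg|exists M => x; exact: lift_avg_norm].
Qed.

Definition dual_iter n f := iter n K f.

Lemma bm_dual_iter n f : bm f -> bm (dual_iter n f).
Proof. by move=> bf; elim: n => //= n; exact: bm_transfer_dual. Qed.

Lemma dual_iter_add n f h : dual_iter n (fun y => f y + h y) = fun x => dual_iter n f x + dual_iter n h x.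
Proof. by elim: n => //= n ->; rewrite transfer_dual_add. Qed.

Lemma dual_iter_scale n c f : dual_iter n (fun y => c * f y) = fun x => c * dual_iter n f x.
Proof. by elim: n => //= n ->; rewrite transfer_dual_scale. Qed.

Lemma dual_iter_le n f h : (forall y, f y <= h y) -> forall x, dual_iter n f x <= dual_iter n h x.
Proof. by move=> fh; elim: n => //= n IH x; exact: transfer_dual_le. Qed.

Lemma dual_iter_norm n f M : (forall y, `|f y| <= M) -> forall x, `|dual_iter n f x| <= M.
Proof. by move=> fM; elim: n => //= n IH x; exact: transfer_dual_norm. Qed.

Lemma dual_iter_cvg n (F : nat -> R -> R) f : (forall x, F k x @[k --> \oo] --> f x) ->
  forall x, dual_iter n (F k) x @[k --> \oo] --> dual_iter n f x.
Proof.
move=> Ff; elim: n => //= n IH x; rewrite /K; case: ifPn => _; first exact: cvg_cst.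
by apply: cvgD; apply: cvgM; try exact: cvg_cst; exact: IH.
Qed.

(** For periodic [f], the integral of [f] against the n-th image of the uniform law; the operator
    acts on functions, so no measure has to be constructed at this stage. *)
Definition dual_mean n f := \int[U]_x dual_iter n f x.

Lemma dual_mean_add n f h : bm f -> bm h -> dual_mean n (fun y => f y + h y) = dual_mean n f + dual_mean n h.
Proof. by move=> bf bh; rewrite /dual_mean dual_iter_add bm_integralD//; exact: bm_dual_iter. Qed.

Lemma dual_mean_scale n c f : bm f -> dual_mean n (fun y => c * f y) = c * dual_mean n f.
Proof. by move=> bf; rewrite /dual_mean dual_iter_scale bm_integralZ//; exact: bm_dual_iter. Qed.

Lemma dual_mean_le n f h : bm f -> bm h -> (forall y, f y <= h y) -> dual_mean n f <= dual_mean n h.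
Proof.
by move=> bf bh fh; apply: bm_integral_le; [exact: bm_dual_iter|exact: bm_dual_iter|exact: dual_iter_le].
Qed.

Lemma uniform_cst c : \int[U]_x c = c.
Proof.
rewrite Rintegral_cst//; rewrite [X in fine X](_ : _ = 1%E) ?mulr1//.
exact: (@probability_setT _ _ R U).
Qed.

Lemma dual_mean_norm n f M : bm f -> (forall y, `|f y| <= M) -> `|dual_mean n f| <= M.
Proof.
move=> bf fM; rewrite ler_norml -{1}[- M]uniform_cst -{2}[M]uniform_cst.
apply/andP; split; apply: bm_integral_le; try exact: bm_cst; try exact: bm_dual_iter;
  by move=> x; have := dual_iter_norm n fM x; rewrite ler_norml => /andP[].
Qed.

Lemma dual_meanS n f : dual_mean n.+1 f = dual_mean n (K f).
Proof. by rewrite /dual_mean /dual_iter iterSr. Qed.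

Lemma dual_mean_cvg n (F : nat -> R -> R) f M : (forall k, measurable_fun [set: R] (F k)) ->
  (forall k x, `|F k x| <= M) -> (forall x, F k x @[k --> \oo] --> f x) ->
  dual_mean n (F k) @[k --> \oo] --> dual_mean n f.
Proof.
move=> mF hM Ff; apply: (@bm_integral_cvg _ _ R U (fun k => dual_iter n (F k)) (dual_iter n f) M).
- by move=> k; have [] := @bm_dual_iter n (F k) (conj (mF k) (ex_intro _ M (hM k))).
- by move=> k x; exact: dual_iter_norm.
- exact: dual_iter_cvg.
Qed.

End LiftOperator.

(** * The Lasota-Yorke inequality in dual form *)

Section LasotaYorke.
Variables (R : realType) (g e : R).
Hypotheses (e0 : 0 < e) (e1 : e < 1) (eg : (1 + e) ^+ 2 < `|g|).
Implicit Types (x y c M : R) (f h phi D : R -> R) (n : nat).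
Local Notation p_ := (cutoff e).
Local Notation dp_ := (dcutoff e).
Local Notation bm := (@bounded_measurable _ R R).
Local Notation U := (uniform_prob (ltr0Sn R 1)).
Local Notation L := (lift_avg e).
Local Notation K := (transfer_dual g e).
Local Notation dual_mean := (dual_mean g e).

(** By the chain rule, the derivative of [phi] at [g / y] is -y^2 / g times the derivative of
    [y -> phi (g / y)]. Hence [K] of the derivative of [phi] is the derivative of [potential phi]
    plus [defect phi], which collects the derivatives of the weights. *)
Definition potential phi x :=
  let y := mod2 x in
  - (y ^+ 2 * p_ y * phi (g / y) + (y - 2) ^+ 2 * (1 - p_ y) * phi (g / (y - 2))) / g.
Definition defect phi x :=
  let y := mod2 x in
  ((2 * y * p_ y + y ^+ 2 * dp_ y) * phi (g / y) +
   (2 * (y - 2) * (1 - p_ y) - (y - 2) ^+ 2 * dp_ y) * phi (g / (y - 2))) / g.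

Definition test_function phi D c :=
  [/\ forall x, is_derive x (1 : R) phi (D x), periodic2 phi,
      forall x, `|phi x| <= c & bm D].

Let g0 : g != 0.
Proof. by rewrite -normr_gt0; apply: le_lt_trans eg; rewrite sqr_ge0. Qed.

Let ng0 : 0 < `|g|. Proof. by rewrite normr_gt0. Qed.

Lemma test_function_bm phi D c : test_function phi D c -> bm phi.
Proof.
move=> [dphi _ pc _]; split; last by exists c.
apply: continuous_measurable_fun => x.
by apply/differentiable_continuous/derivable1_diffP; have [] := dphi x.
Qed.

(** The inverse of the least expansion of [t -> g / t] on |t| <= 1 + e. *)
Definition contraction : R := (1 + e) ^+ 2 / `|g|.
(** Each of the two coefficients in [defect] is at most 4 + 4 / e, because |y| and |y - 2| are at
    most 2 and the cutoff has slope at most 1 / e. *)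
Definition defect_bound : R := (8 + 8 / e) / `|g|.

(** A weighted mean of two squares, each of which can exceed (1 + e)^2 only where its weight
    vanishes. *)
Lemma weight_le y : 0 <= y < 2 ->
  y ^+ 2 * p_ y + (y - 2) ^+ 2 * (1 - p_ y) <= (1 + e) ^+ 2.
Proof.
move=> /andP[y0 y2].
have h1 : y ^+ 2 * p_ y <= (1 + e) ^+ 2 * p_ y.
  have [h|h] := leP (1 + e) y; first by rewrite cutoff_r// !mulr0.
  by rewrite ler_wpM2r ?cutoff_ge0// ler_sqr ?nnegrE; lra.
have h2 : (y - 2) ^+ 2 * (1 - p_ y) <= (1 + e) ^+ 2 * (1 - p_ y).
  have [h|h] := leP y (1 - e); first by rewrite cutoff_l// subrr !mulr0.
  by rewrite ler_wpM2r ?cutoff_le1// -sqrrN ler_sqr ?nnegrE; lra.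
by lra.
Qed.

Lemma potential_le phi c x : (forall y, `|phi y| <= c) ->
  `|potential phi x| <= contraction * c.
Proof.
move=> pc; have c0 : 0 <= c by apply: le_trans (pc 0).
have y02 := mod2_itv x; rewrite /potential; move: (mod2 x) y02 => y y02.
rewrite normf_div normrN /contraction [leRHS]mulrAC ler_pM2r ?invr_gt0//.
apply: le_trans (ler_wpM2r c0 (weight_le y02)).
rewrite mulrDl; apply: le_trans (ler_normD _ _) _.
have p0 := cutoff_ge0 e0 y; have p1 := cutoff_le1 e0 y.
have s0 := sqr_ge0 y; have s1 := sqr_ge0 (y - 2).
have h1 := mulr_ge0 s0 p0; have h2 := mulr_ge0 s1 p1.
rewrite normrM (ger0_norm h1) normrM (ger0_norm h2).
by apply: lerD; apply: ler_wpM2l.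
Qed.

Lemma defect_le phi c x : (forall y, `|phi y| <= c) ->
  `|defect phi x| <= defect_bound * c.
Proof.
move=> pc; have c0 : 0 <= c by apply: le_trans (pc 0).
have y02 := mod2_itv x; rewrite /defect; move: (mod2 x) y02 => y /andP[y0 y2].
rewrite normf_div /defect_bound [leRHS]mulrAC ler_pM2r ?invr_gt0//.
have p0 := cutoff_ge0 e0 y; have p1 := cutoff_le1 e0 y; have dp := dcutoff_le e0 y.
have ei : 0 < e^-1 by rewrite invr_gt0.
have sq1 : y ^+ 2 <= 4 by nra.
have sq2 : (y - 2) ^+ 2 <= 4 by nra.
have h1 : `|2 * y * p_ y + y ^+ 2 * dp_ y| <= 4 + 4 / e.
  apply: le_trans (ler_normD _ _) _; apply: lerD.
    by rewrite ger0_norm ?mulr_ge0//; nra.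
  by rewrite normrM ger0_norm ?sqr_ge0// ler_pM ?sqr_ge0.
have h2 : `|2 * (y - 2) * (1 - p_ y) - (y - 2) ^+ 2 * dp_ y| <= 4 + 4 / e.
  apply: le_trans (ler_normB _ _) _; apply: lerD.
    by rewrite -normrN -mulNr -mulrN ger0_norm ?mulr_ge0//; first nra; lra.
  by rewrite normrM ger0_norm ?sqr_ge0// ler_pM ?sqr_ge0.
apply: le_trans (ler_normD _ _) _; rewrite !normrM.
have -> : (8 + 8 / e) * c = (4 + 4 / e) * c + (4 + 4 / e) * c by ring.
by apply: lerD; apply: ler_pM.
Qed.

Lemma measurable_potential_term f h phi :
  measurable_fun [set: R] f -> measurable_fun [set: R] h ->
  measurable_fun [set: R] phi ->
  measurable_fun [set: R] (fun x => f (mod2 x) * phi (g / h (mod2 x))).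
Proof.
move=> mf mh mphi; apply: measurable_funM.
  exact: (measurableT_comp mf (@measurable_mod2 R)).
apply: (measurableT_comp mphi); apply: measurable_funM => //.
apply: (measurableT_comp (@measurable_invr R)).
exact: (measurableT_comp mh (@measurable_mod2 R)).
Qed.

Lemma bm_defect phi c : bm phi -> (forall y, `|phi y| <= c) -> bm (defect phi).
Proof.
move=> [mphi _] pc; split; last by exists (defect_bound * c) => x; exact: defect_le.
have mp := measurable_cutoff e0; have mdp := measurable_dcutoff e.
have m2 : measurable_fun [set: R] (fun y : R => y - 2) by exact: measurable_funB.
apply: measurable_funM => //; apply: measurable_funD.
  apply: (@measurable_potential_term (fun y => 2 * y * p_ y + y ^+ 2 * dp_ y) id) => //.
  by apply: measurable_funD; apply: measurable_funM.
apply: (@measurable_potential_term (fun y => 2 * (y - 2) * (1 - p_ y) - (y - 2) ^+ 2 * dp_ y) (fun y => y - 2)) => //.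
apply: measurable_funB; apply: measurable_funM => //.
- exact: measurable_funM.
- exact: measurable_funB.
- exact: (measurable_funX _ m2).
Qed.

Lemma dcutoff_l x : x <= 1 - e -> dp_ x = 0.
Proof.
move=> xe; rewrite /dcutoff.
have : (x - 1) / e <= -1 by rewrite ler_pdivrMr//; move: e0; lra.
move: ((x - 1) / e) => u u1.
rewrite (ler0_norm (_ : u + 1 <= 0)) ?(ler0_norm (_ : u <= 0)) ?(ler0_norm (_ : u - 1 <= 0)); lra.
Qed.

Lemma is_derive_local phi D y : (forall x, is_derive x (1 : R) phi (D x)) ->
  y != 0 -> y - 2 != 0 ->
  is_derive y (1 : R) (fun y =>
    - (y ^+ 2 * p_ y * phi (g / y) + (y - 2) ^+ 2 * (1 - p_ y) * phi (g / (y - 2))) / g)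
   (p_ y * D (g / y) + (1 - p_ y) * D (g / (y - 2)) -
   ((2 * y * p_ y + y ^+ 2 * dp_ y) * phi (g / y) +
   (2 * (y - 2) * (1 - p_ y) - (y - 2) ^+ 2 * dp_ y) * phi (g / (y - 2))) / g).
Proof.
move=> dphi y0 y20.
have did := is_derive_id y (1 : R).
have dsh : is_derive y (1 : R) (fun z : R => z - 2) 1 := is_derive_addr (- 2) did.
have dp := is_derive_cutoff y (lt0r_neq0 e0).
have dq : is_derive y (1 : R) (fun z => 1 - p_ z) (- dp_ y).
  have := is_derive_addr 1 (is_derive_scale (- 1) dp); rewrite mulN1r.
  by congr is_derive; apply/funext => z; ring.
have dsq (f : R -> R) a : is_derive y (1 : R) f a ->
    is_derive y (1 : R) (fun z => f z ^+ 2) (2 * f y * a).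
  move=> df; have := is_derive_mul df df.
  by congr is_derive; ring.
have dinv (f : R -> R) a : is_derive y (1 : R) f a -> f y != 0 ->
    is_derive y (1 : R) (fun z => phi (g / f z)) (D (g / f y) * (- g / f y ^+ 2 * a)).
  move=> df fy0; apply: (is_derive_comp_fun (dphi _)).
  have := is_derive_scale g (is_deriveV fy0 df).
  by congr is_derive; rewrite /GRing.scale/=; field.
have := is_derive_scale (- g^-1) (is_derive_add
  (is_derive_mul (is_derive_mul (dsq _ _ did) dp) (dinv _ _ did y0))
  (is_derive_mul (is_derive_mul (dsq _ _ dsh) dq) (dinv _ _ dsh y20))).
congr is_derive; first by apply/funext => z /=; field.
by field; rewrite y0 y20 g0.
Qed.

Lemma potential_periodic phi : periodic2 (potential phi).
Proof. by move=> x; rewrite /potential (_ : mod2 (x + 2) = mod2 x)// -(mod2D x 1) mulr1. Qed.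

(** Close to an even integer a single branch is active, and its factor [h ^+ 2] beats the
    oscillation of [phi (g / h)]. Away from it the uniform bound on the potential suffices. *)
Lemma potential_quadratic phi c (h : R) : (forall y, `|phi y| <= c) ->
  `|potential phi h| <= (contraction * c / (1 - e) ^+ 2 + c / `|g|) * h ^+ 2.
Proof.
move=> pc; have c0 : 0 <= c by apply: le_trans (pc 0).
have k0 : 0 <= contraction * c.
  by rewrite mulr_ge0// divr_ge0// ?sqr_ge0.
have ee : 0 < 1 - e by rewrite subr_gt0.
have h2 := sqr_ge0 h.
have cg : 0 <= c / `|g| by rewrite divr_ge0.
have kc : 0 <= contraction * c / (1 - e) ^+ 2 by rewrite divr_ge0 ?sqr_ge0.
have [hh|hh] := leP (1 - e) `|h|.
  apply: le_trans (potential_le _ pc) _.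
  apply: (@le_trans _ _ (contraction * c / (1 - e) ^+ 2 * h ^+ 2)).
    rewrite [leRHS]mulrAC ler_pdivlMr ?exprn_gt0// ler_wpM2l//.
    by rewrite -[leRHS]real_normK ?num_real// ler_sqr ?nnegrE// ltW.
  by rewrite ler_wpM2r// lerDl.
apply: (@le_trans _ _ (c / `|g| * h ^+ 2)); last by rewrite ler_wpM2r// lerDr.
move: (e0) (e1) => e0' e1'.
have hs (v : R) : `|- (h ^+ 2 * phi v) / g| <= c / `|g| * h ^+ 2.
  have -> : c / `|g| * h ^+ 2 = h ^+ 2 * c / `|g| by ring.
  rewrite normf_div normrN normrM (ger0_norm h2).
  by rewrite ler_wpM2r ?invr_ge0// ler_wpM2l.
rewrite /potential; have [h0|h0] := leP 0 h.
  rewrite ger0_norm// in hh.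
  rewrite mod2_id; last by apply/andP; split; lra.
  by rewrite cutoff_l ?subrr ?mulr0 ?mul0r ?addr0 ?mulr1//; lra.
rewrite ltr0_norm// in hh.
rewrite -(mod2D h 1) mod2_id mulr1; last by apply/andP; split; lra.
rewrite cutoff_r//; last lra.
by rewrite mulr0 mul0r add0r subr0 mulr1 addrK.
Qed.

(** The induction step of the Lasota-Yorke inequality: the potential is again a test function, with
    a smaller bound, and its derivative is [K D] up to the bounded defect. *)
Lemma test_function_potential phi D c : test_function phi D c ->
  test_function (potential phi) (fun x => K D x - defect phi x) (contraction * c).
Proof.
move=> tphi; have [dphi pphi pc bD] := tphi; split.
- move=> x; have [k xE] := mod2_eq x.
  have := mod2_itv x; have [y0 _|y0 /andP[y1 y2]] := eqVneq (mod2 x) 0.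
    have dx0 : defect phi x = 0.
      have h0 : 0 <= 1 - e by rewrite subr_ge0 ltW.
      rewrite /defect y0 (cutoff_l e0 h0) (dcutoff_l h0) subrr.
      by rewrite !(mulr0, mul0r, addr0, subr0).
    rewrite /K y0 eqxx dx0 subr0.
    apply: (@is_derive_quadratic _ _ _ _ (contraction * c / (1 - e) ^+ 2 + c / `|g|)) => h.
    have ph0 : potential phi 0 = 0.
      apply/eqP; rewrite -normr_le0; have := potential_quadratic 0 pc.
      by rewrite expr0n/= mulr0.
    have pxh t : potential phi (x + t) = potential phi t.
      by rewrite {1}xE y0 add0r addrC (periodic2_int (@potential_periodic phi)).
    have := pxh 0; rewrite addr0 ph0 => ->; rewrite pxh mul0r !subr0.
    exact: potential_quadratic.
  have {y1}y1 : 0 < mod2 x by rewrite lt_neqAle eq_sym y0.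
  have y20 : mod2 x - 2 != 0 by rewrite subr_eq0 lt_eqF.
  have := is_derive_local dphi y0 y20.
  rewrite /K (negbTE y0) /lift_avg /defect => dl.
  pose s := fun y => - (y ^+ 2 * p_ y * phi (g / y) + (y - 2) ^+ 2 * (1 - p_ y) * phi (g / (y - 2))) / g.
  have nz : \forall z \near x, s (1 * z + - (2 * k%:~R)) = potential phi z.
    have zx : \forall z \near x, `|x - z| < Num.min (mod2 x) (2 - mod2 x).
      apply: (@cvgr_dist_lt _ _ _ (nbhs x) _ id x); first exact: cvg_id.
      by rewrite lt_min y1 subr_gt0.
    near=> z; have : `|x - z| < Num.min (mod2 x) (2 - mod2 x) by near: z.
    rewrite lt_min !ltr_norml => /andP[/andP[a1 a2] /andP[a3 a4]].
    have zE : mod2 z = z - 2 * k%:~R.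
      rewrite -{1}(subrK (2 * k%:~R) z) mod2D mod2_id//.
      by apply/andP; split; lra.
    by rewrite mul1r /s /potential zE.
  apply: (near_eq_is_derive nz).
  rewrite -[X in is_derive _ _ _ X]mul1r; apply: is_derive_affine_comp.
  by rewrite mul1r {1}xE addrK.
- exact: potential_periodic.
- by move=> x; exact: potential_le.
- apply: bm_sub; first exact: bm_transfer_dual.
  exact: bm_defect (test_function_bm tphi) pc.
Unshelve. all: by end_near. Qed.

End LasotaYorke.

(** * Uniform variation bound and Poisson kernels *)

Section DensityBound.
Variables (R : realType) (g e : R).
Hypotheses (e0 : 0 < e) (e1 : e < 1) (eg : (1 + e) ^+ 2 < `|g|).
Implicit Types (x y c M : R) (f h phi D : R -> R) (n : nat).
Local Notation bm := (@bounded_measurable _ R R).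
Local Notation U := (uniform_prob (ltr0Sn R 1)).
Local Notation L := (lift_avg e).
Local Notation K := (transfer_dual g e).
Local Notation dual_mean := (dual_mean g e).
Local Notation q := (contraction g e).

(** The fixed point of [v -> v * q + defect_bound g e], hence preserved by the induction. *)
Definition variation_bound : R := defect_bound g e / (1 - q).
Local Notation V := variation_bound.

Let ng0 : 0 < `|g|. Proof. by apply: le_lt_trans eg; rewrite sqr_ge0. Qed.

Let q1 : q < 1. Proof. by rewrite /contraction ltr_pdivrMr// mul1r. Qed.

Lemma defect_bound_ge0 : 0 <= defect_bound g e.
Proof. by rewrite divr_ge0// addr_ge0// divr_ge0// ltW. Qed.

Lemma variation_bound_ge0 : 0 <= V.
Proof. by rewrite divr_ge0 ?defect_bound_ge0// subr_ge0 ltW. Qed.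

(** Dual form of the statement that all images of the uniform law have variation at most [V]. For
    [n = 0] the integral of a derivative over a period vanishes; the step splits [K D] into the
    derivative of the potential and the defect. *)
Lemma lasota_yorke n phi D c : test_function phi D c -> `|dual_mean n D| <= V * c.
Proof.
elim: n phi D c => [|n IH] phi D c tphi; have [dphi pphi pc bD] := tphi;
    have c0 : 0 <= c by apply: le_trans (pc 0).
  rewrite /dual_mean /dual_iter/= (uniform_derive0 dphi pphi (test_function_bm tphi) bD).
  by rewrite normr0 mulr_ge0// variation_bound_ge0.
have tS := test_function_potential e0 e1 eg tphi.
have bd := bm_defect e0 eg (test_function_bm tphi) pc.
have [_ _ _ bS] := tS.
rewrite dual_meanS (_ : K D = fun x => (K D x - defect g e phi x) + defect g e phi x); last first.
  by apply/funext => x; rewrite subrK.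
rewrite dual_mean_add//; apply: le_trans (ler_normD _ _) _.
apply: (@le_trans _ _ (V * (q * c) + defect_bound g e * c)).
  apply: lerD; first exact: IH tS.
  by apply: dual_mean_norm => // y; exact: defect_le.
have -> : V * (q * c) + defect_bound g e * c = (V * q + defect_bound g e) * c by ring.
rewrite ler_wpM2r//.
rewrite (_ : V * q + _ = V)// /V; field.
by rewrite subr_eq0 gt_eqF.
Qed.

(** The argument of 1 / (1 - r exp(i pi (x - c))). It is bounded by pi / 2 whatever [r] is, while
    its derivative is a multiple of the Poisson kernel minus 1. *)
Definition poisson_potential (r c x : R) :=
  atan (r * sin (pi * (x - c)) / (1 - r * cos (pi * (x - c)))).
Definition poisson (r c x : R) :=
  (1 - r ^+ 2) / (1 - 2 * r * cos (pi * (x - c)) + r ^+ 2).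

Lemma poisson_denom_gt0 (r t : R) : 0 <= r < 1 -> 0 < 1 - 2 * r * cos t + r ^+ 2.
Proof.
move=> /andP[r0 r1]; have := cos_le1 t => ct.
have : 0 <= 2 * r * (1 - cos t) by rewrite mulr_ge0 ?subr_ge0// mulr_ge0.
have : 0 < (1 - r) ^+ 2 by rewrite exprn_gt0// subr_gt0.
by lra.
Qed.

Lemma is_derive_poisson_potential (r c x : R) : 0 <= r < 1 ->
  is_derive x (1 : R) (poisson_potential r c) (pi / 2 * (poisson r c x - 1)).
Proof.
move=> r01; have /andP[r0 r1] := r01.
have ct := cos_le1 (pi * (x - c)).
have d0 : 1 - r * cos (pi * (x - c)) != 0.
  apply: lt0r_neq0; have : r * cos (pi * (x - c)) <= r by rewrite ler_piMr.
  by lra.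
have := poisson_denom_gt0 (pi * (x - c)) r01.
have sc := cos2Dsin2 (pi * (x - c)).
have dsin : is_derive x (1 : R) (fun y => sin (pi * y + (- (pi * c)))) (pi * cos (pi * x + (- (pi * c)))).
  exact: is_derive_affine_comp.
have dcos : is_derive x (1 : R) (fun y => cos (pi * y + (- (pi * c)))) (pi * - sin (pi * x + (- (pi * c)))).
  exact: is_derive_affine_comp.
have E y : pi * y + - (pi * c) = pi * (y - c) by ring.
have dden := is_derive_addr 1 (is_derive_scale (- r) dcos).
have dnum := is_derive_scale r dsin.
have den0 : - r * cos (pi * x - pi * c) + 1 != 0.
  by rewrite E mulNr addrC.
have dinv := @is_deriveV R (fun y => - r * cos (pi * y - pi * c) + 1) x _ 1 den0 dden.
have := is_derive_comp_fun (is_derive1_atan _) (is_derive_mul dnum dinv).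
rewrite /GRing.scale/= !E => h p0.
move: h; congr is_derive.
  by apply/funext => y; rewrite /poisson_potential !E mulNr [- _ + 1]addrC.
rewrite mulNr [- _ + 1]addrC /poisson.
move: d0 sc p0; set s := sin _; set k := cos _ => d0 sc p0.
have s2 : s ^+ 2 = 1 - k ^+ 2 by rewrite -sc; ring.
have -> : 1 + (r * s / (1 - r * k)) ^+ 2 =
    (1 - 2 * r * k + r ^+ 2) / (1 - r * k) ^+ 2.
  by rewrite !exprMn exprVn s2; field.
have -> : r * s * (- (1 - r * k) ^- 2 * (- r * (pi * - s))) =
    - (r ^+ 2 * pi * s ^+ 2) / (1 - r * k) ^+ 2 by field.
rewrite s2; field.
by rewrite d0 gt_eqF.
Qed.

Lemma poisson_test_function (r c : R) : 0 <= r < 1 ->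
  test_function (poisson_potential r c) (fun x => pi / 2 * (poisson r c x - 1)) (pi / 2).
Proof.
move=> r01; have /andP[r0 r1] := r01; split.
- by move=> x; exact: is_derive_poisson_potential.
- move=> x; rewrite /poisson_potential.
  have -> : pi * (x + 2 - c) = pi * (x - c) + pi *+ 2 by rewrite mulr2n; ring.
  by rewrite sinD2pi cosD2pi.
- move=> x; rewrite ler_norml /poisson_potential.
  by rewrite !ltW ?atan_gtNpi2 ?atan_ltpi2.
- have mcos : measurable_fun [set: R] (fun x : R => cos (pi * (x - c))).
    apply: (measurableT_comp (continuous_measurable_fun (@continuous_cos R))).
    by apply: measurable_funM => //; exact: measurable_funB.
  have bmp : bm (poisson r c).
    split.
      apply: measurable_funM => //; apply: (measurableT_comp (@measurable_invr R)).
      apply: measurable_funD => //; apply: measurable_funB => //.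
      exact: measurable_funM.
    exists ((1 - r ^+ 2) / (1 - r) ^+ 2) => x.
    have pd := poisson_denom_gt0 (pi * (x - c)) r01.
    have r2 : 0 <= 1 - r ^+ 2 by rewrite subr_ge0 expr_le1 ?(ltW r1).
    rewrite ger0_norm; last by rewrite divr_ge0// ltW.
    rewrite ler_wpM2l// lef_pV2 ?posrE// ?exprn_gt0 ?subr_gt0//.
    have ct := cos_le1 (pi * (x - c)).
    have : 0 <= 2 * r * (1 - cos (pi * (x - c))) by rewrite mulr_ge0 ?subr_ge0// mulr_ge0.
    by lra.
  by apply: bm_scale; apply: bm_sub => //; exact: bm_cst.
Qed.

Lemma onem_cos_le (t : R) : 1 - cos t <= t ^+ 2 / 2.
Proof.
have cE : cos t = 1 - 2 * sin (t / 2) ^+ 2.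
  have -> : t = (t / 2) *+ 2 by rewrite mulr2n; field.
  rewrite cos_mulr2n (_ : (t / 2) *+ 2 / 2 = t / 2); last by rewrite mulr2n; field.
  have := cos2Dsin2 (t / 2); rewrite mulr2n => h; lra.
have sle (u : R) : 0 <= u -> sin u ^+ 2 <= u ^+ 2.
  move=> u0; have [z _] := @MVT_segment R (@sin R) (@cos R) 0 u u0
    (fun y _ => is_derive_sin y) (continuous_subspaceT (@continuous_sin R)).
  by rewrite sin0 !subr0 => ->; rewrite exprMn ler_piMl ?sqr_ge0//.
have {}sle : sin (t / 2) ^+ 2 <= (t / 2) ^+ 2.
  have [u0|u0] := leP 0 (t / 2); first exact: sle.
  by rewrite -sqrrN -sinN -[leRHS]sqrrN; apply: sle; rewrite oppr_ge0 ltW.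
by rewrite cE; move: sle; rewrite expr_div_n; lra.
Qed.

Lemma cos_periodic2 (t : R) (k : int) : cos (pi * (t + 2 * k%:~R)) = cos (pi * t).
Proof.
apply: (@periodic2_int _ _ (fun t => cos (pi * t))) => x.
by rewrite mulrDr mulr_natr cosD2pi.
Qed.

Lemma sin_periodic2 (t : R) (k : int) : sin (pi * (t + 2 * k%:~R)) = sin (pi * t).
Proof.
apply: (@periodic2_int _ _ (fun t => sin (pi * t))) => x.
by rewrite mulrDr mulr_natr sinD2pi.
Qed.

(** For the kernel of radius 1 - r, the inequalities 1 - cos t <= t^2 / 2 and pi <= 4 bound the
    denominator by r^2 + 16 r^2, whence 17; the numerator r (2 - r) is at least r. *)
Lemma poisson_ge (r c x : R) (k : int) : 0 < r < 1 -> `|x - c - 2 * k%:~R| <= r ->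
  (17 * r)^-1 <= poisson (1 - r) c x.
Proof.
move=> /andP[r0 r1] xr.
have cosE : cos (pi * (x - c)) = cos (pi * (x - c - 2 * k%:~R)).
  by rewrite -[in LHS](subrK (2 * k%:~R) (x - c)) cos_periodic2.
have r01 : 0 <= 1 - r < 1 by apply/andP; split; lra.
have pd := poisson_denom_gt0 (pi * (x - c)) r01.
rewrite /poisson ler_pdivlMr// mulrC ler_pdivrMr ?mulr_gt0//.
rewrite cosE in pd *.
have h1 := onem_cos_le (pi * (x - c - 2 * k%:~R)).
have h2 : (pi * (x - c - 2 * k%:~R)) ^+ 2 <= 16 * r ^+ 2.
  rewrite exprMn; apply: ler_pM; rewrite ?sqr_ge0//.
    by rewrite (_ : 16 = 4 ^+ 2) ?ler_sqr ?nnegrE ?pi_ge0// //; try ring; have := @pihalf_lt2 R; have := @pi_ge0 R; lra.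
  by rewrite -[leLHS]real_normK ?num_real// ler_sqr ?nnegrE// ltW.
move: h1 h2; move: (cos _) (_ ^+ 2) => k' q' h1 h2.
nra.
Qed.

End DensityBound.

Lemma lebesgue_cover (R : realType) (A : set R) (d : R) :
  (@lebesgue_measure R A < d%:E)%E ->
  exists u v : nat -> R, [/\ forall i, u i <= v i,
    A `<=` \bigcup_i `]u i, v i[%classic &
    forall n, \sum_(0 <= i < n) (v i - u i) <= d].
Proof.
rewrite [X in (X < _)%E](_ : _ = (@wlength R idfun)^* A)%mu//.
rewrite outer_measure_open_itv_cover => /ereal_inf_lt[_ [F [Fitv AF] <-] hd].
have /choice[f fE] : forall i, exists w : R * R,
    [/\ w.1 <= w.2, F i `<=` `]w.1, w.2[%classic & @wlength R idfun (F i) = (w.2 - w.1)%:E].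
  move=> i; have [[a b] /= ->] := Fitv i.
  have [ab|ba] := ltP a b.
    by exists (a, b); split => //=; [exact: ltW|rewrite wlength_itv/= lte_fin ab].
  exists (a, a); split => //=.
    by rewrite set_itv_ge// -leNgt.
  by rewrite subrr wlength_itv/= lte_fin ltNge ba.
exists (fun i => (f i).1), (fun i => (f i).2); split.
- by move=> i; have [] := fE i.
- by move=> x /AF[i _ Fix]; exists i => //; have [_ + _] := fE i; apply.
- move=> n; rewrite -lee_fin; apply: le_trans (ltW hd).
  rewrite -sumEFin.
  apply: (@le_trans _ _ (\sum_(0 <= i < n) @wlength R idfun (F i))%E).
    by apply: lee_sum => i _; have [_ _ ->] := fE i.
  by apply: nneseries_lim_ge => i _ _; have [h _ ->] := fE i; rewrite lee_fin subr_ge0.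
Qed.

(** * From arcs to Borel sets: domination by Lebesgue measure *)

Section BorelBound.
Variables (R : realType) (g e : R).
Hypotheses (e0 : 0 < e) (e1 : e < 1) (eg : (1 + e) ^+ 2 < `|g|).
Implicit Types (x y c M : R) (f h phi D : R -> R) (n : nat) (A B : set R).
Local Notation bm := (@bounded_measurable _ R R).
Local Notation L := (lift_avg e).
Local Notation K := (transfer_dual g e).
Local Notation dual_mean := (dual_mean g e).
Local Notation V := (variation_bound g e).

Let V0 : 0 <= V. Proof. exact: variation_bound_ge0. Qed.

Lemma dual_mean_cst n c : 0 <= c -> dual_mean n (fun=> c) <= c.
Proof.
move=> c0; apply: le_trans (ler_norm _) _; apply: dual_mean_norm => //.
  exact: bm_cst.
by move=> y; rewrite ger0_norm.
Qed.

(** On an arc of radius [r] the indicator is at most 17 r times the Poisson kernel of radius 1 - r.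
    This kernel is 1 + (2 / pi) D with [D] the derivative of a function bounded by pi / 2, so its
    mean is at most 1 + V. *)
Lemma dual_mean_arc n A c (r : R) : 0 < r < 1 -> measurable A ->
  (forall x, A x -> exists k : int, `|x - c - 2 * k%:~R| <= r) ->
  dual_mean n (\1_A) <= 17 * r * (1 + V).
Proof.
move=> r01 mA hA; have /andP[r0 r1] := r01.
have r01' : 0 <= 1 - r < 1 by apply/andP; split; lra.
have tf := poisson_test_function c r01'; have [_ _ _ bD] := tf.
set D := (fun x => _) in tf bD.
have p0 := @pi_gt0 R.
have PE : poisson (1 - r) c = fun x => 1 + 2 / pi * D x.
  apply/funext => x; rewrite /D; move: (poisson _ _ _) (pi : R) p0 => q p p0.
  by field; rewrite gt_eqF.
have b1 : bm (fun x => 2 / pi * D x) by exact: bm_scale.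
have bP : bm (poisson (1 - r) c) by rewrite PE; apply: bm_add => //; exact: bm_cst.
apply: (@le_trans _ _ (dual_mean n (fun x => 17 * r * poisson (1 - r) c x))).
  apply: dual_mean_le => //; [exact: bm_indic|exact: bm_scale|move=> x].
  rewrite indicE; have [xA|xA] := boolP (x \in A).
    have [k hk] := hA x (set_mem xA).
    have := poisson_ge r01 hk.
    by move=> h; rewrite -ler_pdivrMl ?mulr_gt0// (_ : true%:R = 1 :> R)// mulr1.
  apply: mulr_ge0; first by rewrite mulr_ge0// ltW.
  rewrite /poisson divr_ge0//.
    by rewrite subr_ge0 expr_le1//; lra.
  exact/ltW/poisson_denom_gt0.
rewrite dual_mean_scale// ler_wpM2l ?mulr_ge0 ?(ltW r0)// PE dual_mean_add//; last exact: bm_cst.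
apply: lerD; first exact: dual_mean_cst.
rewrite dual_mean_scale//; have := lasota_yorke e0 e1 eg n tf; rewrite -/D => h.
have {}h : dual_mean n D <= V * (pi / 2) := le_trans (ler_norm _) h.
have k0 : 0 <= 2 / pi :> R by rewrite divr_ge0// ltW.
apply: le_trans (ler_wpM2l k0 h) _.
rewrite le_eqVlt; apply/orP; left; apply/eqP.
move: (pi : R) p0 (V) => p p0 v; by field; rewrite gt_eqF.
Qed.

Definition evens : set R := [set x | mod2 x = 0].

Lemma measurable_evens : measurable evens.
Proof.
rewrite (_ : evens = @mod2 R @^-1` [set 0]); last by apply/seteqP; split.
by rewrite -[X in measurable X]setTI; apply: measurable_mod2.
Qed.

Let bL f : bm f -> bm (L f). Proof. exact: bm_lift_avg. Qed.

Let be_ : bm (\1_evens). Proof. by apply: bm_indic; exact: measurable_evens. Qed.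

(** The even integers form one point of the circle, contained in arcs of any small radius. The
    conventional value of [transfer_dual] there is thus invisible to the means. *)
Lemma dual_mean_evens n : dual_mean n (\1_evens) = 0.
Proof.
apply/eqP; rewrite eq_le; apply/andP; split; last first.
  rewrite -[leLHS](_ : dual_mean n (fun x => 0 * (\1_evens x : R)) = 0); last first.
    by rewrite dual_mean_scale ?mul0r.
  apply: dual_mean_le => //; first exact: bm_scale.
  by move=> x; rewrite mul0r.
apply/ler_addgt0Pr => d d0; rewrite add0r.
pose r := Num.min (1 / 2) (d / (17 * (1 + V))).
have V1 : 0 < 17 * (1 + V) by rewrite mulr_gt0// ltr_wpDr.
have r01 : 0 < r < 1.
  by rewrite lt_min divr_gt0// divr_gt0//= gt_min; apply/orP; left; lra.
have /andP[r0 r1] := r01.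
apply: le_trans (@dual_mean_arc n evens 0 r r01 measurable_evens _) _.
  move=> x xe; have [k xk] := mod2_eq x; exists k.
  by rewrite xk xe subr0 add0r subrr normr0 ltW.
have : r <= d / (17 * (1 + V)) by rewrite ge_min lexx orbT.
rewrite ler_pdivlMr//; lra.
Qed.

Lemma dual_mean1 n : dual_mean n (fun=> 1) = 1.
Proof.
elim: n => [|n IH]; first exact: uniform_cst.
rewrite dual_meanS (_ : K (fun=> 1) = fun x => 1 + -1 * (\1_evens x : R)); last first.
  apply/funext => x; rewrite /transfer_dual indicE lift_avg_cst.
  have [h|h] := eqVneq (mod2 x) 0; first by rewrite mem_set// mulr1 subrr.
  by rewrite memNset ?mulr0 ?addr0//; exact/eqP.
by rewrite dual_mean_add ?dual_mean_scale ?dual_mean_evens ?IH ?mulr0 ?addr0//; [exact: bm_cst|exact: bm_scale].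
Qed.

(** Integration against the lift to the line of the n-th circle measure, a lift concentrated on |t|
    <= 1 + e. *)
Definition line_mean n f := dual_mean n (L f).

Lemma line_mean_add n f h : bm f -> bm h -> line_mean n (fun y => f y + h y) = line_mean n f + line_mean n h.
Proof.
move=> bf bh; rewrite /line_mean -(dual_mean_add g e0); [|exact: bL..].
by congr (dual_mean n _); apply/funext => x; exact: lift_avg_add.
Qed.

Lemma line_mean_le n f h : bm f -> bm h -> (forall y, f y <= h y) -> line_mean n f <= line_mean n h.
Proof. by move=> bf bh fh; apply: (dual_mean_le g e0); [exact: bL..|move=> x; exact: lift_avg_le]. Qed.

Lemma line_mean_cst n c : 0 <= c -> line_mean n (fun=> c) <= c.
Proof.
by move=> c0; rewrite /line_mean (_ : L _ = fun=> c); [exact: dual_mean_cst|apply/funext => x; exact: lift_avg_cst].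
Qed.

Lemma line_mean1 n : line_mean n (fun=> 1) = 1.
Proof.
by rewrite /line_mean (_ : L _ = fun=> 1); [exact: dual_mean1|apply/funext => x; exact: lift_avg_cst].
Qed.

Lemma bm_inversion f : bm f -> bm (fun t => f (g / t)).
Proof.
move=> [mf [M hM]]; split; last by exists M.
apply: (measurableT_comp mf); apply: measurable_funM => //; exact: measurable_invr.
Qed.

(** Lifting and then inverting is the operator [K], except at even integers, which are null. For
    periodic [f], inversion therefore shifts [n] by one. *)
Lemma line_mean_inversion n f : bm f -> line_mean n (fun t => f (g / t)) = dual_mean n.+1 f.
Proof.
move=> bf; rewrite dual_meanS /line_mean; have [mf [M hM]] := bf.
have bF1 := bL (bm_inversion bf); have bF2 := bm_transfer_dual g e0 bf.
have hJ : forall y, `|f (g / y)| <= M by move=> y; exact: hM.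
have M0 : 0 <= M by apply: le_trans (hM 0).
have dF x : `|L (fun t => f (g / t)) x - K f x| <= M * \1_evens x.
  rewrite /transfer_dual indicE; have [h|h] := eqVneq (mod2 x) 0.
    rewrite subr0 mem_set// mulr1; exact: (lift_avg_norm e0 x hJ).
  by rewrite subrr normr0 memNset ?mulr0//; exact/eqP.
apply/eqP; rewrite eq_le; apply/andP; split.
- have -> : dual_mean n (K f) = dual_mean n (fun x => K f x + M * \1_evens x).
    by rewrite dual_mean_add ?dual_mean_scale ?dual_mean_evens ?mulr0 ?addr0//; exact: bm_scale.
  apply: dual_mean_le => //; first by apply: bm_add => //; exact: bm_scale.
  by move=> x; have := dF x; rewrite ler_norml => /andP[_]; lra.
- move: (L (fun t => f (g / t))) bF1 dF => F1 bF1 dF.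
  have -> : dual_mean n F1 = dual_mean n (fun x => F1 x + M * \1_evens x).
    by rewrite dual_mean_add ?dual_mean_scale ?dual_mean_evens ?mulr0 ?addr0//; exact: bm_scale.
  apply: dual_mean_le => //; first by apply: bm_add => //; exact: bm_scale.
  by move=> x; have := dF x; rewrite ler_norml => /andP[+ _]; lra.
Qed.

Lemma line_mean_periodic n f : periodic2 f -> line_mean n f = dual_mean n f.
Proof.
move=> pf; rewrite /line_mean; congr (dual_mean n _); apply/funext => x.
have h1 := periodic2_mod2 x pf.
have h2 : f (mod2 x - 2) = f x by rewrite -pf subrK.
by rewrite /lift_avg h1 h2; ring.
Qed.

Lemma line_mean_itv n u v : u <= v -> line_mean n (\1_(`]u, v[%classic)) <= 17 * (1 + V) * (v - u).
Proof.
move=> uv; set A := `]u, v[%classic.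
have mA : measurable A by exact: measurable_itv.
have V1 : 0 < 1 + V by rewrite ltr_wpDr.
have [u_v|vu] := eqVneq u v.
  rewrite u_v subrr mulr0 (_ : (\1_A) = fun=> 0 : R); first exact: line_mean_cst.
  by apply/funext => x; rewrite indicE memNset// /A u_v/= in_itv/= => /andP[]; lra.
have {vu}uv' : u < v by rewrite lt_neqAle vu.
(* The arc estimate needs a radius below 1; for longer intervals the total mass 1 is already below
   the bound. *)
have [r1|r1] := leP 1 ((v - u) / 2).
  apply: (@le_trans _ _ 1).
    apply: le_trans (line_mean_cst n (ler01)); apply: line_mean_le.
    + exact: bm_indic.
    + exact: bm_cst.
    + by move=> y; rewrite indicE; case: (_ \in _).
  have : 0 <= V * (v - u) by rewrite mulr_ge0// subr_ge0.
  by lra.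
pose A' := [set x | A (mod2 x) \/ A (mod2 x - 2)].
have mA' : measurable A'.
  rewrite (_ : A' = (@mod2 R @^-1` A) `|` ((fun x => mod2 x - 2) @^-1` A)); last first.
    by apply/seteqP; split.
  apply: measurableU; rewrite -[X in measurable X]setTI.
    by apply: measurable_mod2.
  by apply: measurable_funB => //; exact: measurable_mod2.
apply: (@le_trans _ _ (dual_mean n (\1_A'))).
  apply: dual_mean_le => //; [exact/bL/bm_indic|exact: bm_indic|move=> x].
  have /andP[c0 c1] := cutoff_itv e0 (mod2 x).
  rewrite /lift_avg !indicE; have [h|h] := boolP (x \in A').
    case: (_ \in A); case: (_ \in A) => /=; lra.
  have -> : (mod2 x \in A) = false.
    by apply/negbTE; apply: contra h => /set_mem h; apply/mem_set; left.
  have -> : (mod2 x - 2 \in A) = false.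
    by apply/negbTE; apply: contra h => /set_mem h; apply/mem_set; right.
  by rewrite /= !mulr0 addr0.
apply: (@le_trans _ _ (17 * ((v - u) / 2) * (1 + V))); last first.
  have : 0 <= V * (v - u) by rewrite mulr_ge0// subr_ge0.
  by lra.
apply: (@dual_mean_arc n A' ((u + v) / 2)) => //.
  by apply/andP; split; lra.
move=> x; have [k xk] := mod2_eq x; rewrite /A' /A /= !in_itv/= => -[] /andP[h1 h2].
  by exists k; rewrite ler_norml; apply/andP; split; lra.
by exists (k + 1); rewrite intrD /= ler_norml; apply/andP; split; lra.
Qed.

Lemma line_mean_bigsetU n k (u v : nat -> R) : (forall i, u i <= v i) ->
  line_mean n (\1_(\big[setU/set0]_(i < k) `]u i, v i[%classic)) <=
  17 * (1 + V) * \sum_(0 <= i < k) (v i - u i).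
Proof.
move=> uv; elim: k => [|k IH].
  rewrite big_ord0 big_geq// mulr0 (_ : \1_set0 = fun=> 0); first exact: line_mean_cst.
  by apply/funext => x; rewrite indicE memNset.
rewrite big_ord_recr /= big_nat_recr//= mulrDr.
have mI (i : nat) : measurable `]u i, v i[%classic by exact: measurable_itv.
have mB : measurable (\big[setU/set0]_(i < k) `]u i, v i[%classic).
  by apply: bigsetU_measurable.
apply: le_trans (lerD IH (line_mean_itv n (uv k))).
rewrite -line_mean_add; [|exact: bm_indic..].
apply: line_mean_le.
- by apply: bm_indic; exact: measurableU.
- by apply: bm_add; exact: bm_indic.
- move=> x; rewrite !indicE in_setU; case: (_ \in _); case: (_ \in _) => /=; lra.
Qed.

(** Finite unions of intervals from a cover are enough, because [line_mean] passes to bounded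
    pointwise limits. *)
Lemma line_mean_borel n A d : measurable A -> (@lebesgue_measure R A < d%:E)%E ->
  line_mean n (\1_A) <= 17 * (1 + V) * d.
Proof.
move=> mA /lebesgue_cover[u [v [uv Auv hd]]].
have V1 : 0 < 1 + V by rewrite ltr_wpDr.
have mB k : measurable (\big[setU/set0]_(i < k) `]u i, v i[%classic).
  by apply: bigsetU_measurable => i _; exact: measurable_itv.
pose F k : R -> R := \1_(A `&` \big[setU/set0]_(i < k) `]u i, v i[%classic).
have bF k : bm (F k) by apply: bm_indic; exact: measurableI.
have F1 k x : `|F k x| <= 1.
  by rewrite /F indicE; case: (_ \in _); rewrite ?normr1 ?normr0.
have Fl x : F k x @[k --> \oo] --> (\1_A x : R).
  apply: (@cvg_near_cst _ _ _ _ _).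
  have [/set_mem xA|xA] := boolP (x \in A); last first.
    near=> k; rewrite /F !indicE in_setI (negbTE xA) //.
  have [i _ xi] := Auv x xA.
  near=> k; rewrite /F !indicE in_setI (mem_set xA) (_ : (x \in _) = true)//.
  apply/mem_set; rewrite -(@bigcup_mkord _ _ (fun i => `]u i, v i[%classic)).
  by exists i => //=; near: k; exact: nbhs_infty_gt.
have hl : line_mean n (F k) @[k --> \oo] --> line_mean n (\1_A).
  apply: (@dual_mean_cvg _ _ _ e0 n (fun k => L (F k)) (L (\1_A)) 1) => //.
  - by move=> k; apply: measurable_lift_avg => //; have [] := bF k.
  - by move=> k x; apply: lift_avg_norm.
  - move=> x; rewrite /lift_avg; apply: cvgD; apply: cvgM; try exact: cvg_cst; exact: Fl.
apply: (cvgr_to_le hl); near=> k.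
apply: (@le_trans _ _ (17 * (1 + V) * \sum_(0 <= i < k) (v i - u i))).
- apply: (@le_trans _ _ (line_mean n (\1_(\big[setU/set0]_(i < k) `]u i, v i[%classic)))).
    apply: line_mean_le => //; first exact: bm_indic.
    move=> x; rewrite /F !indicE in_setI; case: (_ \in A); case: (_ \in _) => /=; lra.
  exact: line_mean_bigsetU.
- by rewrite ler_wpM2l// mulr_ge0// ltW.
Unshelve. all: by end_near. Qed.

Lemma line_mean_supp n : line_mean n (\1_(`[- 1 - e, 1 + e]%classic)) = 1.
Proof.
rewrite /line_mean -[RHS](dual_mean1 n); congr (dual_mean n _); apply/funext => x.
rewrite /lift_avg; have := mod2_itv x; move: (mod2 x) => y /andP[y0 y2].
move: (e0) (e1) => ep e1'; rewrite !indicE.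
have [h|h] := leP y (1 - e).
  rewrite cutoff_l// mem_set ?mul1r ?subrr ?mul0r ?addr0//=.
  by rewrite in_itv/=; apply/andP; split; lra.
have [h'|h'] := leP (1 + e) y.
  rewrite cutoff_r// mul0r add0r subr0 mem_set ?mul1r//=.
  by rewrite in_itv/=; apply/andP; split; lra.
rewrite !mem_set/= ?in_itv/=.
- by ring.
- by apply/andP; split; lra.
- by apply/andP; split; lra.
Qed.

Lemma line_mean_suppC n A : measurable A -> A `&` `[- 1 - e, 1 + e]%classic = set0 ->
  line_mean n (\1_A) = 0.
Proof.
move=> mA Ae; apply/eqP; rewrite eq_le; apply/andP; split.
  have mI : measurable `[- 1 - e, 1 + e]%classic by exact: measurable_itv.
  suff : line_mean n (\1_A) + line_mean n (\1_(`[- 1 - e, 1 + e]%classic)) <= line_mean n (fun=> 1).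
    by rewrite line_mean_supp line_mean1; lra.
  rewrite -line_mean_add; [|exact: bm_indic..]; apply: line_mean_le.
  - by apply: bm_add; exact: bm_indic.
  - exact: bm_cst.
  - move=> x; rewrite !indicE; have [/set_mem h|_] := boolP (x \in A); last first.
      by rewrite /= add0r; case: (_ \in _).
    rewrite memNset ?addr0// => h'.
    by have : (A `&` `[- 1 - e, 1 + e]%classic) x by []; rewrite Ae.
rewrite /line_mean (_ : 0 = dual_mean n (fun=> 0)).
  apply: (dual_mean_le g e0); [exact: bm_cst|exact/bL/bm_indic|move=> x].
  by rewrite -(lift_avg_cst e 0 x); apply: lift_avg_le.
apply/esym/eqP; rewrite -normr_le0; apply: (dual_mean_norm g e0); first exact: bm_cst.
by move=> y; rewrite normr0.
Qed.

End BorelBound.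

(** * Invariant measure *)

Section DominatedMeasure.
Variables (R : realType) (ell : set R -> R) (W : set R) (C : R).
Implicit Types (A B : set R).
Local Notation mu := (@lebesgue_measure R).
Hypotheses (mW : measurable W) (Wfin : (@lebesgue_measure R W < +oo)%E)
  (ell_ge0 : forall A, measurable A -> 0 <= ell A)
  (ellU : forall A B, measurable A -> measurable B -> A `&` B = set0 ->
    ell (A `|` B) = ell A + ell B)
  (ell_le : forall A (d : R), measurable A -> (@lebesgue_measure R A < d%:E)%E ->
    ell A <= C * d)
  (ell_out : forall A, measurable A -> A `&` W = set0 -> ell A = 0).

(** Nothing is known of [ell] on non-measurable sets, hence the value 0 there. *)
Definition dominated_measure A : \bar R :=
  if `[< measurable A >] then (ell A)%:E else 0%E.

Let dmE A : measurable A -> dominated_measure A = (ell A)%:E.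
Proof. by move=> mA; rewrite /dominated_measure asboolT. Qed.

Let dm0 : dominated_measure set0 = 0%E.
Proof.
rewrite dmE//; congr EFin.
have := ellU measurable0 measurable0 (setI0 set0); rewrite setU0; lra.
Qed.

Let dm_ge0 A : (0 <= dominated_measure A)%E.
Proof.
rewrite /dominated_measure; case: asboolP => // mA.
by rewrite lee_fin ell_ge0.
Qed.

(** Continuity at the empty set is what separates additivity from sigma-additivity. It is inherited
    from Lebesgue measure, restricted to the set [W] of finite measure that carries [ell]. *)
Let ell_vanish (F : nat -> set R) : (forall i, measurable (F i)) ->
  nonincreasing_seq F -> \bigcap_n F n = set0 -> ell (F n) @[n --> \oo] --> 0.
Proof.
move=> mF nF F0.
have mFW i : measurable (F i `&` W) by exact: measurableI.
have ellFW i : ell (F i) = ell (F i `&` W).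
  rewrite -{1}(setUIDK (F i) W) ellU//; last 2 first.
  - exact: measurableD.
  - by apply/seteqP; split => // x [[_ +] [_]].
  rewrite (ell_out (A := F i `\` W)) ?addr0//; first exact: measurableD.
  by apply/seteqP; split => // x [[_ +] +].
have C0 : 0 <= C.
  have /(ell_le measurable0) : (@lebesgue_measure R set0 < 1%:E)%E.
    by rewrite measure0 lte_fin.
  by rewrite mulr1; apply: le_trans; exact: ell_ge0.
have muFW : @lebesgue_measure R (F i `&` W) @[i --> \oo] --> 0%E.
  rewrite -(measure0 (@lebesgue_measure R)).
  have -> : set0 = \bigcap_n (F n `&` W).
    apply/esym/seteqP; split => // x h.
    by rewrite -F0 => i _; have [] := h i I.
  apply: nonincreasing_cvg_mu => //.
  - apply: le_lt_trans Wfin; apply: (@le_measure _ _ _ mu); last exact: subIsetr.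
      by apply/mem_set; exact: mFW.
    by apply/mem_set.
  - by apply: bigcapT_measurable.
  - move=> m n mn; apply/subsetPset; apply: setSI.
    by apply/subsetPset; exact: nF.
apply/cvgrPdist_le => /= eps eps0.
pose d := eps / (C + 1).
have d0 : 0 < d by rewrite divr_gt0// ltr_wpDl.
have : \forall n \near \oo, (@lebesgue_measure R (F n `&` W) < d%:E)%E.
  have h0 : open_nbhs 0%E [set y : \bar R | (y < d%:E)%E].
    by split; [exact: open_ereal_lt_ereal|rewrite /= lte_fin].
  exact: muFW (open_nbhs_nbhs h0).
apply: filterS => n hn; rewrite sub0r normrN ger0_norm; last exact: ell_ge0.
rewrite ellFW; apply: le_trans (ell_le (mFW n) hn) _.
by rewrite /d mulrCA ler_piMr ?(ltW eps0)// ler_pdivrMr ?mul1r ?ltr_wpDl// lerDl.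
Qed.

Let dm_sigma : semi_sigma_additive dominated_measure.
Proof.
move=> F mF tF mUF; rewrite dmE//.
have mT n : measurable (\bigcup_(i in [set i | (n <= i)%N]) F i).
  by apply: bigcup_measurable.
have mB n : measurable (\big[setU/set0]_(i < n) F i).
  by apply: bigsetU_measurable.
have ellB n : ell (\big[setU/set0]_(i < n) F i) = \sum_(0 <= i < n) ell (F i).
  elim: n => [|n IH].
    by rewrite big_ord0 big_geq//; have := dm0; rewrite dmE// => -[].
  rewrite big_ord_recr big_nat_recr//= -IH ellU//; first exact: mB.
  rewrite -bigcup_mkord; apply/seteqP; split => // x [[i /= ni Fi] Fn].
  have /= iE := @tF i n I I (ex_intro _ x (conj Fi Fn)).
  by rewrite iE ltnn in ni.
rewrite (_ : (fun n => _) = fun n => (ell (\bigcup_k F k) -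
    ell (\bigcup_(i in [set i | (n <= i)%N]) F i))%:E); last first.
  apply/funext => n; under eq_bigr do rewrite dmE//.
  rewrite sumEFin -ellB; congr EFin.
  suff -> : \bigcup_k F k = \big[setU/set0]_(i < n) F i `|`
      \bigcup_(i in [set i | (n <= i)%N]) F i.
    have := ellU (mB n) (mT n) => -> //; first by ring.
    rewrite -bigcup_mkord; apply/seteqP; split => // x [[i /= ni Fi] [j /= nj Fj]].
    have /= iE := @tF i j I I (ex_intro _ x (conj Fi Fj)).
    by move: ni nj; rewrite iE => /leq_trans h /h; rewrite ltnn.
  rewrite -bigcup_mkord -bigcup_setU; apply/seteqP; split => x [k kn Fk];
    exists k => //=; by case: (ltnP k n); [left|right].
apply: cvg_EFin; first by near=> n.
rewrite -[X in _ --> X]subr0; apply: cvgB; first exact: cvg_cst.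
apply: ell_vanish => //.
- move=> m n mn; apply/subsetPset => x [i /= ni Fi]; exists i => //=.
  exact: leq_trans ni.
- apply/seteqP; split => // x h.
  have [i _ Fi] := h 0%N I; have [j /= ij Fj] := h i.+1 I.
  have /= iE := @tF i j I I (ex_intro _ x (conj Fi Fj)).
  by rewrite iE ltnn in ij.
Unshelve. all: by end_near. Qed.

HB.instance Definition _ :=
  isMeasure.Build _ _ _ dominated_measure dm0 dm_ge0 dm_sigma.

Let dm_fin : fin_num_fun dominated_measure.
Proof. by move=> A mA; rewrite dmE. Qed.

HB.instance Definition _ := Measure_isFinite.Build _ _ _ dominated_measure dm_fin.

Lemma dominated_measure_ex : exists m : {finite_measure set R -> \bar R},
  forall A, measurable A -> m A = (ell A)%:E.
Proof. by exists dominated_measure => A; exact: dmE. Qed.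

End DominatedMeasure.

(** By compactness the image filter has a cluster point, and an ultrafilter converges to each of its
    cluster points. *)
Lemma ultra_cvg_itv (R : realType) (T : Type) (F : set_system T) (f : T -> R) (a b : R) :
  UltraFilter F -> (forall t, a <= f t <= b) -> exists2 l, a <= l <= b & f @ F --> l.
Proof.
move=> FU fab; have PF := @ultra_proper _ _ FU.
have [//|l [/= lab cl]] := @segment_compact R a b (f @ F) _.
  by apply: (@filterS _ F _ setT); [move=> t _; rewrite /= in_itv/= fab|exact: filterT].
exists l; first by move: lab; rewrite in_itv.
move=> U lU; have [//|nU] := in_ultra_setVsetC (f @^-1` U) FU.
have [y [/= + +]] := cl (~` U) U nU lU.
by [].
Qed.

(** * Averages of the lifted measures, and their limit along an ultrafilter *)

Section InvariantMeasure.
Variables (R : realType) (g e : R).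
Hypotheses (e0 : 0 < e) (e1 : e < 1) (eg : (1 + e) ^+ 2 < `|g|).
Variable F : set_system nat.
Hypotheses (FU : UltraFilter F) (F_oo : \oo `<=` F).
Implicit Types (A B : set R) (f : R -> R).
Local Notation bm := (@bounded_measurable _ R R).
Local Notation line_mean := (line_mean g e).
Local Notation V := (variation_bound g e).

Let PF : ProperFilter F := @ultra_proper _ _ FU.

Definition avg f (N : nat) : R := N.+1%:R^-1 * \sum_(0 <= n < N.+1) line_mean n f.
(** The ultrafilter gives a limit for all measurable sets at once, and this limit is additive. *)
Definition mean f : R := lim (avg f @ F).

Let b_indic A : measurable A -> bm (\1_A). Proof. exact: bm_indic. Qed.

Lemma avg_le f (c : R) N : (forall n, line_mean n f <= c) -> avg f N <= c.
Proof.
move=> hc; rewrite /avg mulrC ler_pdivrMr//.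
apply: (@le_trans _ _ (\sum_(0 <= n < N.+1) c)); first by apply: ler_sum.
by rewrite sumr_const_nat subn0 mulr_natr.
Qed.

Lemma avg_ge f (c : R) N : (forall n, c <= line_mean n f) -> c <= avg f N.
Proof.
move=> hc; rewrite /avg mulrC ler_pdivlMr//.
apply: (@le_trans _ _ (\sum_(0 <= n < N.+1) c)); last by apply: ler_sum.
by rewrite sumr_const_nat subn0 mulr_natr.
Qed.

Lemma line_mean_indic_itv n A : measurable A -> 0 <= line_mean n (\1_A) <= 1.
Proof.
move=> mA; have bA := b_indic mA; have b0 := b_indic measurable0.
have h1 : line_mean n (\1_A) <= line_mean n (fun=> 1).
  by apply: (line_mean_le g e0) => //; exact: bm_cst.
have h0 : line_mean n (\1_set0) <= line_mean n (\1_A).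
  by apply: (line_mean_le g e0) => // y; rewrite !indicE in_set0; case: (_ \in _).
move: h1 h0; rewrite (line_mean1 e0 e1 eg) (line_mean_suppC e0 e1 eg n measurable0 (set0I _)) => -> ->.
by [].
Qed.

Lemma avg_cvg A : measurable A -> avg (\1_A) @ F --> mean (\1_A).
Proof.
move=> mA.
have [|l _ h] := @ultra_cvg_itv R _ F (avg (\1_A)) 0 1 FU.
  move=> N; apply/andP; split; [apply: avg_ge|apply: avg_le] => n;
    by have /andP[? ?] := line_mean_indic_itv n mA.
by rewrite /mean (cvg_lim _ h).
Qed.

Lemma mean_le A (c : R) : measurable A -> (forall n, line_mean n (\1_A) <= c) ->
  mean (\1_A) <= c.
Proof.
move=> mA hc; apply: (cvgr_to_le (avg_cvg mA)).
by apply: nearW => N; exact: avg_le.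
Qed.

Lemma mean_ge A (c : R) : measurable A -> (forall n, c <= line_mean n (\1_A)) ->
  c <= mean (\1_A).
Proof.
move=> mA hc; apply: (cvgr_to_ge (avg_cvg mA)).
by apply: nearW => N; exact: avg_ge.
Qed.

Lemma meanU A B : measurable A -> measurable B -> A `&` B = set0 ->
  mean (\1_(A `|` B)) = mean (\1_A) + mean (\1_B).
Proof.
move=> mA mB AB; have mAB : measurable (A `|` B) by exact: measurableU.
apply: (@cvg_unique _ (@norm_hausdorff _ R) (avg (\1_(A `|` B)) @ F)); first exact: avg_cvg.
rewrite (_ : avg _ = fun N => avg (\1_A) N + avg (\1_B) N); last first.
  apply/funext => N; rewrite /avg -mulrDr -big_split/=; congr (_ * _).
  apply: eq_bigr => n _; rewrite -(line_mean_add _ e0); [|exact: b_indic..].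
  congr (line_mean n _); apply/funext => x; rewrite !indicE in_setU.
  have [/set_mem xA|_] := boolP (x \in A); last by rewrite add0r.
  rewrite (memNset (A := B)) ?addr0// => xB.
  by have : (A `&` B) x by []; rewrite AB.
by apply: cvgD; exact: avg_cvg.
Qed.

(** On periodic sets the inversion replaces [n] by [n + 1], so the two averages differ by two
    boundary terms divided by N + 1. *)
Lemma mean_inversion A : measurable A -> periodic2 (fun x => A x) ->
  mean (\1_((fun t => g / t) @^-1` A)) = mean (\1_A).
Proof.
move=> mA pA; set J := (fun t => g / t).
have mJ : measurable (J @^-1` A).
  rewrite -[X in measurable X]setTI; apply: measurable_funM => //.
  exact: measurable_invr.
have p1 : periodic2 (\1_A : R -> R).
  by move=> x; rewrite !indicE; congr ((_ : bool)%:R); apply/idP/idP; rewrite !inE pA.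
apply/eqP; rewrite -subr_eq0; apply/eqP.
have c1 : (avg (\1_(J @^-1` A)) N - avg (\1_A) N) @[N --> F] -->
    mean (\1_(J @^-1` A)) - mean (\1_A) by apply: cvgB; exact: avg_cvg.
apply: (@cvg_unique _ (@norm_hausdorff _ R) _ _ _ _ c1).
suff : (avg (\1_(J @^-1` A)) N - avg (\1_A) N) @[N --> \oo] --> (0 : R).
  by apply: cvg_trans; exact: cvg_app.
rewrite (_ : (fun N => _) = fun N => N.+1%:R^-1 * (line_mean N.+1 (\1_A) - line_mean 0 (\1_A))); last first.
  apply/funext => N; rewrite /avg -mulrBr -sumrB; congr (_ * _).
  rewrite (eq_bigr (fun n => line_mean n.+1 (\1_A) - line_mean n (\1_A))) ?telescope_sumr// => n _.
  congr (_ - _); rewrite [RHS](line_mean_periodic g e n.+1 p1).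
  by rewrite -(line_mean_inversion e0 e1 eg n (b_indic mA)).
have hb : \forall N \near \oo, - harmonic N <=
    N.+1%:R^-1 * (line_mean N.+1 (\1_A) - line_mean 0 (\1_A)) <= (harmonic N : R).
  near=> N; rewrite /harmonic /=.
  have /andP[a1 a2] := line_mean_indic_itv N.+1 mA; have /andP[b1 b2] := line_mean_indic_itv 0 mA.
  have q0 : 0 <= N.+1%:R^-1 :> R by rewrite invr_ge0.
  set D := _ - _; have D1 : -1 <= D <= 1 by apply/andP; rewrite /D; split; lra.
  by rewrite -ler_norml normrM ger0_norm// ler_piMr// ler_norml.
apply: (squeeze_cvgr hb); last exact: cvg_harmonic.
by rewrite -[X in _ --> X]oppr0; apply: cvgN; exact: cvg_harmonic.
Unshelve. all: by end_near. Qed.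

Lemma mean_measure : exists h : {finite_measure set R -> \bar R},
  [/\ forall A, measurable A -> @lebesgue_measure R A = 0%E -> h A = 0%E,
      h setT = 1%E,
      h (~` `[- 1 - e, 1 + e]%classic) = 0%E &
      forall E, measurable E -> periodic2 (fun x => E x) ->
        h ((fun t => g / t) @^-1` E) = h E].
Proof.
have mW : measurable `[- 1 - e, 1 + e]%classic by exact: measurable_itv.
have hle A (d : R) : measurable A -> (@lebesgue_measure R A < d%:E)%E ->
    mean (\1_A) <= 17 * (1 + V) * d.
  by move=> mA Ad; apply: mean_le => // n; exact: line_mean_borel.
have hout A : measurable A -> A `&` `[- 1 - e, 1 + e]%classic = set0 -> mean (\1_A) = 0.
  move=> mA A0; apply/eqP; rewrite eq_le; apply/andP.
  by split; [apply: mean_le|apply: mean_ge] => // n; rewrite line_mean_suppC.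
have hW : (@lebesgue_measure R `[(- 1 - e)%R, (1 + e)%R]%classic < +oo)%E.
  by rewrite /= lebesgue_measure_itv/=; case: ifP => _; rewrite ?ltry.
have hge A : measurable A -> 0 <= mean (\1_A).
  by move=> mA; apply: mean_ge => // n; have /andP[] := line_mean_indic_itv n mA.
have [h hE] := dominated_measure_ex mW hW hge meanU hle hout.
exists h; split.
- move=> A mA A0; rewrite hE//; congr EFin; apply/eqP; rewrite eq_le; apply/andP; split.
    apply/ler_addgt0Pr => d d0; rewrite add0r.
    have V0 := variation_bound_ge0 e0 eg.
    have V1 : 0 < 17 * (1 + V) by rewrite mulr_gt0// ltr_wpDr.
    have := hle A (d / (17 * (1 + V))) mA; rewrite A0 lte_fin divr_gt0// => /(_ isT).
    by rewrite mulrC divfK// gt_eqF.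
  by apply: mean_ge => // n; have /andP[] := line_mean_indic_itv n mA.
- rewrite hE//; congr EFin.
  have hT n : line_mean n (\1_setT) = 1.
    rewrite -[RHS](line_mean1 e0 e1 eg n); congr (line_mean n _).
    by apply/funext => x; rewrite indicE in_setT.
  apply/eqP; rewrite eq_le; apply/andP.
  by split; [apply: mean_le|apply: mean_ge] => // n; rewrite hT.
- rewrite hE; last exact: measurableC.
  by rewrite hout ?setICl//; exact: measurableC.
- move=> E mE pE; rewrite !hE ?mean_inversion//.
  rewrite -[X in measurable X]setTI; apply: measurable_funM => //.
  exact: measurable_invr.
Qed.

End InvariantMeasure.

Lemma invariant_measure (R : realType) (g : R) : 1 < `|g| ->
  exists (h : {finite_measure set R -> \bar R}) (r : R), [/\ 0 < r, r ^+ 2 < `|g|,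
      forall A, measurable A -> @lebesgue_measure R A = 0%E -> h A = 0%E,
      h setT = 1%E /\ h (~` `[- r, r]%classic) = 0%E &
      forall E, measurable E -> periodic2 (fun x => E x) ->
        h ((fun t => g / t) @^-1` E) = h E].
Proof.
move=> g1; have [F [FU F_oo]] := @ultraFilterLemma nat \oo _.
(* From [e <= 1 / 2] follows (1 + e)^2 <= 1 + 5 e / 2, and the other bound makes this less than
   |g|. *)
pose e := Num.min (1 / 2) ((`|g| - 1) / 3).
have e0 : 0 < e by rewrite lt_min !divr_gt0// subr_gt0.
have e2 : e <= 1 / 2 by rewrite ge_min lexx.
have e3 : e <= (`|g| - 1) / 3 by rewrite ge_min lexx orbT.
have e1 : e < 1 by lra.
have eg : (1 + e) ^+ 2 < `|g|.
  have : e * e <= e * (1 / 2) by rewrite ler_pM2l.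
  by rewrite expr2; lra.
have [h [h1 h2 h3 h4]] := mean_measure e0 e1 eg FU F_oo.
exists h, (1 + e); split => //; first by rewrite addr_gt0.
by split => //; rewrite opprD.
Qed.

(** * Charges, image measures and null sets *)

Section FiniteMeasureIntegrals.
Context d (X : measurableType d) (R : realType).
Implicit Types (m n : {finite_measure set X -> \bar R}).

Lemma bm_eq_measure m1 m2 (f : X -> R) :
  (forall A, measurable A -> m1 A = m2 A) -> \int[m1]_x f x = \int[m2]_x f x.
Proof. by move=> h; rewrite /Rintegral; congr fine; apply: eq_measure_integral => A mA _; exact: h. Qed.

Lemma bm_integral_cross m1 m2 n1 n2 (f : X -> R) : bounded_measurable f ->
  (forall A, measurable A -> (m1 A + n2 A = m2 A + n1 A)%E) ->
  \int[m1]_x f x - \int[m2]_x f x = \int[n1]_x f x - \int[n2]_x f x.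
Proof.
move=> bf h.
have key : \int[m1]_x f x + \int[n2]_x f x = \int[m2]_x f x + \int[n1]_x f x.
  have fi (m : {finite_measure set X -> \bar R}) : (\int[m]_x (f x)%:E)%E \is a fin_num.
    exact: integrable_fin_num (bm_integrable m bf).
  rewrite /Rintegral -fineD ?fi// -[RHS]fineD ?fi//; congr (fine _).
  rewrite -!integral_measure_add//; try exact: bm_integrable.
  by apply: eq_measure_integral => A mA _; have := h A mA; rewrite -!measure_addE.
by lra.
Qed.

(** The Jordan parts and [m1], [m2] have the same difference; adding crosswise turns this into an
    equality of positive measures, which can be integrated. *)
Lemma charge_integral_diff (nu : {charge set X -> \bar R}) m1 m2 (f : X -> R) :
  bounded_measurable f -> (forall A, measurable A -> (nu A = m1 A - m2 A)%E) ->
  charge_integral nu f = \int[m1]_x f x - \int[m2]_x f x.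
Proof.
move=> bf h; rewrite /charge_integral.
set hh := projT2 (cid (projT2 (cid (Hahn_decomposition nu)))).
apply: bm_integral_cross => // A mA.
have := jordan_decomp hh mA; rewrite h// /cadd /= cscaleN1 /= => e.
move: e; rewrite -(fineK (fin_num_measure m1 A mA)) -(fineK (fin_num_measure m2 A mA)).
rewrite -(fineK (fin_num_measure (jordan_pos hh) A mA)).
rewrite -(fineK (fin_num_measure (jordan_neg hh) A mA)).
rewrite -!EFinN -!EFinD => -[e]; congr EFin; lra.
Qed.

End FiniteMeasureIntegrals.

Section Push.
Context d1 d2 (X : measurableType d1) (Y : measurableType d2) (R : realType).
Variables (m : {finite_measure set X -> \bar R}) (phi : X -> Y).
Hypothesis mphi : measurable_fun [set: X] phi.

Definition push : set Y -> \bar R := fun A => m (phi @^-1` A).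

Let mpre A : measurable A -> measurable (phi @^-1` A).
Proof. by move=> mA; rewrite -[X in measurable X]setTI; exact: mphi. Qed.

Let push0 : push set0 = 0%E.
Proof. by rewrite /push preimage_set0 measure0. Qed.

Let push_ge0 A : (0 <= push A)%E. Proof. exact: measure_ge0. Qed.

Let push_sigma : semi_sigma_additive push.
Proof.
move=> F mF tF mUF; rewrite /push preimage_bigcup.
apply: measure_semi_sigma_additive.
- by move=> n; exact: mpre.
- apply/trivIsetP => /= i j _ _ ij; rewrite -preimage_setI.
  by move/trivIsetP : tF => /(_ _ _ _ _ ij) ->//; rewrite preimage_set0.
- by rewrite -preimage_bigcup; exact: mpre.
Qed.

HB.instance Definition _ := isMeasure.Build _ _ _ push push0 push_ge0 push_sigma.

Let push_fin : fin_num_fun push.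
Proof. by move=> A mA; apply: fin_num_measure; exact: mpre. Qed.

HB.instance Definition _ := Measure_isFinite.Build _ _ _ push push_fin.

Lemma push_ex : exists m' : {finite_measure set Y -> \bar R},
  (forall A, m' A = m (phi @^-1` A)) /\
  forall f, bounded_measurable f -> \int[m']_y f y = \int[m]_x f (phi x).
Proof.
exists push; split => // f bf; have [mf [M hM]] := bf.
rewrite /Rintegral; congr fine.
rewrite (@integral_pushforward _ _ _ _ _ _ mphi m setT (EFin \o f)) ?preimage_setT//.
  exact/measurable_EFinP.
apply: (@bm_integrable _ _ _ m (fun x => f (phi x))); split; last by exists M.
exact: measurableT_comp.
Qed.

End Push.

(** * Images of null sets under functions that are merely differentiable *)

Section NullImages.
Variable R : realType.
Local Notation mu := (@lebesgue_measure R).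
Implicit Types (A D : set R) (f : R -> R).

Lemma negligible_cover A : (forall d : R, 0 < d -> exists u v : nat -> R,
    [/\ forall i, u i <= v i, A `<=` \bigcup_i `[u i, v i]%classic &
        forall n, \sum_(0 <= i < n) (v i - u i) <= d]) -> mu.-negligible A.
Proof.
move=> h.
have {}h k : exists M, [/\ measurable M, A `<=` M & (mu M <= (k.+1%:R^-1)%:E)%E].
  have [|u [v [uv Auv hd]]] := h (k.+1%:R^-1); first by rewrite invr_gt0.
  have mI i : measurable `[u i, v i]%classic by exact: measurable_itv.
  exists (\bigcup_i `[u i, v i]%classic); split => //; first exact: bigcup_measurable.
  have mU : measurable (\bigcup_i `[u i, v i]%classic) by exact: bigcup_measurable.
  apply: le_trans (@measure_sigma_subadditive _ _ _ mu _ _ mI mU (@subset_refl _ _)) _.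
  apply: lime_le; first by apply: is_cvg_nneseries.
  apply: nearW => n; apply: (@le_trans _ _ (\sum_(0 <= i < n) (v i - u i))%:E); last first.
    by rewrite lee_fin.
  rewrite -sumEFin; apply: lee_sum => i _; rewrite /= lebesgue_measure_itv/= lte_fin.
  by case: ltP => // _; rewrite lee_fin subr_ge0.
have /choice[M hM] := h.
exists (\bigcap_k M k); split.
- by apply: bigcapT_measurable => k; have [] := hM k.
- apply/eqP; rewrite -measure_le0; apply/lee_addgt0Pr => e e0; rewrite add0e.
  pose k := Num.truncn e^-1.
  have ke : k.+1%:R^-1 < e.
    by rewrite invf_plt ?posrE// truncnS_gt// invr_ge0 ltW.
  have [mM _ hk] := hM k.
  apply: (@le_trans _ _ (mu (M k))); last by apply: le_trans hk _; rewrite lee_fin ltW.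
  have mMk : measurable (\bigcap_j M j) by apply: bigcapT_measurable => j; have [] := hM j.
  apply: (@le_measure _ _ _ mu); [exact/mem_set|exact/mem_set|].
  by move=> x; apply.
- by move=> x Ax k _; have [_ + _] := hM k; apply.
Qed.

(** One natural number serves both as Lipschitz constant and as inverse scale, so that points fall
    into countably many classes. *)
Lemma derivable_locally_lipschitz f (t : R) : derivable f t 1 ->
  exists k : nat, forall s, `|s - t| < k.+1%:R^-1 -> `|f s - f t| <= k.+1%:R * `|s - t|.
Proof.
move=> /cvg_ex[l /cvgrPdist_le/(_ 1 ltr01)].
rewrite near_withinE => /nbhs_ballP[r /= r0 hr].
pose k := Num.truncn (r^-1 + (`|l| + 1)).
have kb : r^-1 + (`|l| + 1) < k.+1%:R.
  by rewrite truncnS_gt// addr_ge0// ?invr_ge0 ?(ltW r0)// addr_ge0.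
exists k => s st; have [->|st0] := eqVneq s t; first by rewrite !subrr normr0 mulr0.
have st1 : s - t != 0 by rewrite subr_eq0.
have kr : k.+1%:R^-1 < r.
  rewrite invf_plt ?posrE//; apply: le_lt_trans kb; rewrite lerDl addr_ge0//.
have /hr/(_ st1) : ball (0 : R) r (s - t).
  by rewrite /ball /= sub0r normrN; apply: lt_trans kr.
rewrite /= -[X in f (X + t)]/((s - t) * 1) mulr1 subrK => hq.
have {}hq : `|(s - t)^-1 * (f s - f t)| <= `|l| + 1.
  rewrite -[X in `|X|](subrK l) addrC.
  apply: le_trans (ler_normD _ _) _; rewrite lerD2l.
  by rewrite distrC.
rewrite -[f s - f t](mulKf (invr_neq0 st1)) invrK normrM mulrC.
apply: ler_wpM2r => //; apply: le_trans hq _; apply/ltW; apply: le_lt_trans kb.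
by rewrite lerDr invr_ge0 ltW.
Qed.

(** The derivative may be unbounded, so [D] is split into countably many pieces with a common
    Lipschitz constant and scale. A covering interval shorter than the scale meets such a piece in a
    set whose image has comparable length. *)
Lemma negligible_image f D : mu D = 0%E -> (forall t, D t -> derivable f t 1) ->
  mu.-negligible (f @` D).
Proof.
move=> D0 df.
pose Dk (k : nat) := [set t | D t /\ forall s, `|s - t| < k.+1%:R^-1 ->
  `|f s - f t| <= k.+1%:R * `|s - t|].
have -> : f @` D = \bigcup_k (f @` Dk k).
  apply/seteqP; split=> [_ [t Dt <-]|_ [k _ [t [Dt _] <-]]]; last by exists t.
  by have [k hk] := derivable_locally_lipschitz (df t Dt); exists k => //; exists t.
apply: negligible_bigcup => k; apply: negligible_cover => d d0.
have k0 : 0 < k.+1%:R :> R by [].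
(* The first bound keeps covering intervals below the scale; the second compensates the enlargement
   of lengths by 2 (k + 1). *)
pose d' := Num.min (k.+1%:R^-1) (d / (2 * k.+1%:R)).
have d'0 : 0 < d' by rewrite lt_min invr_gt0 k0 divr_gt0// mulr_gt0.
have [u [v [uv Duv hd]]] : exists u v : nat -> R, [/\ forall i, u i <= v i,
    D `<=` \bigcup_i `]u i, v i[%classic & forall n, \sum_(0 <= i < n) (v i - u i) <= d'].
  by apply: lebesgue_cover; rewrite D0 lte_fin.
have uvk i : v i - u i <= k.+1%:R^-1.
  have := hd i.+1; rewrite big_nat_recr//= => h.
  have : 0 <= \sum_(0 <= j < i) (v j - u j) by apply: sumr_ge0 => j _; rewrite subr_ge0.
  have : d' <= k.+1%:R^-1 by rewrite ge_min lexx.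
  by move: h; move: (\sum_(0 <= j < i) (v j - u j)) (d') (v i - u i) (k.+1%:R^-1) => S D1 x y; lra.
have /choice[w hw] : forall i, exists w, forall t, Dk k t -> `]u i, v i[%classic t ->
    `|f t - w| <= k.+1%:R * (v i - u i).
  move=> i; have [[t0 [[_ ht0] t0i]]|no] := pselect (exists t, Dk k t /\ `]u i, v i[%classic t).
    exists (f t0) => t _ ti; move: t0i ti; rewrite /= !in_itv/= => /andP[a1 a2] /andP[b1 b2].
    have tt0 : `|t - t0| < v i - u i by rewrite ltr_norml; apply/andP; split; lra.
    apply: le_trans (ht0 t (lt_le_trans tt0 (uvk i))) _.
    by rewrite ler_pM2l// ltW.
  by exists 0 => t ht ti; case: no; exists t.
exists (fun i => w i - k.+1%:R * (v i - u i)), (fun i => w i + k.+1%:R * (v i - u i)); split.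
- move=> i; have := mulr_ge0 (ltW k0) (_ : 0 <= v i - u i); rewrite subr_ge0 => /(_ (uv i)).
  by lra.
- move=> _ [t kt <-]; have [Dt _] := kt; have [i _ ti] := Duv t Dt; exists i => //=.
  by have := hw i t kt ti; rewrite ler_norml in_itv/= => /andP[a b]; apply/andP; split; lra.
- move=> n; rewrite (eq_bigr (fun i => 2 * k.+1%:R * (v i - u i))); last by move=> i _; ring.
  rewrite -mulr_sumr.
  have : d' <= d / (2 * k.+1%:R) by rewrite ge_min lexx orbT.
  rewrite ler_pdivlMr ?mulr_gt0// mulrC; apply: le_trans.
  by rewrite ler_wpM2l// mulr_ge0.
Qed.

End NullImages.

(** * Necessity *)

Section ArcLength.
Variable R : realType.
Local Notation mu := (@lebesgue_measure R).
Implicit Types (c : smooth_curve R) (A : set (R * R)).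

Lemma curve_continuous_x c (k : nat) :
  {within [set` curve_dom c], continuous (curve_x c)^`(k)}.
Proof. by apply: derivable_within_continuous => t tD; exact: curve_smooth_x. Qed.

Lemma curve_continuous_y c (k : nat) :
  {within [set` curve_dom c], continuous (curve_y c)^`(k)}.
Proof. by apply: derivable_within_continuous => t tD; exact: curve_smooth_y. Qed.

Lemma measurable_curve_preimage c A : measurable A ->
  measurable ([set` curve_dom c] `&` curve_point c @^-1` A).
Proof.
move=> mA; set D := [set` curve_dom c].
have mD : measurable D by exact: measurable_itv.
have mx : measurable_fun D (curve_x c).
  have cf : {within D, continuous (curve_x c)} := @curve_continuous_x c 0.
  exact: subspace_continuous_measurable_fun.
have my : measurable_fun D (curve_y c).
  have cf : {within D, continuous (curve_y c)} := @curve_continuous_y c 0.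
  exact: subspace_continuous_measurable_fun.
rewrite (_ : D `&` _ = D `&`
  (fun t => ((curve_x c \_ D) t, (curve_y c \_ D) t)) @^-1` A); last first.
  apply/seteqP; split=> t [Dt]; rewrite /= /patch mem_set//.
apply: measurableI => //; rewrite -[X in measurable X]setTI.
have mp : measurable_fun [set: R] (fun t => ((curve_x c \_ D) t, (curve_y c \_ D) t)).
  by apply: measurable_fun_pair; apply/(measurable_restrictT _ mD).
exact: mp.
Qed.

Lemma measurable_curve_speed c : measurable_fun [set` curve_dom c] (curve_speed c).
Proof.
have mD : measurable [set` curve_dom c] by exact: measurable_itv.
apply: (measurableT_comp (continuous_measurable_fun (@sqrt_continuous R))).
have cx : {within [set` curve_dom c], continuous (curve_x c)^`()} := @curve_continuous_x c 1.
have cy : {within [set` curve_dom c], continuous (curve_y c)^`()} := @curve_continuous_y c 1.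
by apply: measurable_funD; apply: measurable_funX; exact: subspace_continuous_measurable_fun.
Qed.

Lemma curve_speed_gt0 c t : t \in curve_dom c -> 0 < curve_speed c t.
Proof.
move=> /curve_regular; rewrite xpair_eqE negb_and sqrtr_gt0 => /orP[|] h.
  by rewrite ltr_pwDl ?sqr_ge0// exprn_even_gt0.
by rewrite ltr_wpDl ?sqr_ge0// exprn_even_gt0.
Qed.

(** Regularity makes the speed positive, so a vanishing integral means a null set of parameters. *)
Lemma arc_length_eq0 n (c : 'I_n -> smooth_curve R) A : measurable A ->
  arc_length c A = 0%E <->
  forall i, mu ([set` curve_dom (c i)] `&` curve_point (c i) @^-1` A) = 0%E.
Proof.
move=> mA; rewrite /arc_length.
have mDi i := measurable_curve_preimage (c i) mA.
have ms i : measurable_fun ([set` curve_dom (c i)] `&` curve_point (c i) @^-1` A)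
    (EFin \o curve_speed (c i)).
  have := measurable_funS (measurable_itv _)
    (@subIsetl _ _ (curve_point (c i) @^-1` A)) (@measurable_curve_speed (c i)).
  by move=> ?; exact/measurable_EFinP.
split=> [h i|h]; last first.
  apply: big1 => i _; rewrite -[RHS](@integral_abs_eq0 _ _ _ mu _ _ (mDi i) (ms i) (h i)).
  by apply: eq_integral => t _; rewrite /= ger0_norm// sqrtr_ge0.
have {}h : (\int[mu]_(t in [set` curve_dom (c i)] `&` curve_point (c i) @^-1` A)
    (curve_speed (c i) t)%:E = 0)%E.
  move/eqP: h; rewrite seq_psume_eq0; last first.
    by move=> j _; apply: integral_ge0 => t _; rewrite lee_fin sqrtr_ge0.
  by move=> /allP/(_ i (mem_index_enum _))/implyP/(_ isT)/eqP.
have : ae_eq mu ([set` curve_dom (c i)] `&` curve_point (c i) @^-1` A)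
    (EFin \o curve_speed (c i)) (cst 0%E).
  apply/(ae_eq_integral_abs mu (mDi i) (ms i)); rewrite -[RHS]h.
  by apply: eq_integral => t _; rewrite /= ger0_norm// sqrtr_ge0.
move=> [N [mN N0 hN]]; apply: (subset_measure0 _ mN _ N0) ; first exact: mDi.
move=> t Dt; apply: hN => /= /(_ Dt) /eqP; rewrite eqe => /eqP h0.
by have := @curve_speed_gt0 (c i) t Dt.1; rewrite h0 ltxx.
Qed.

End ArcLength.

(** The parametrization of the hyperbola is arbitrary here. Its null parameter sets are carried to
    the line by one coordinate function, which is differentiable and so preserves null sets; the
    single point 0 is treated apart. *)
Lemma pullback_null (R : realType) (eps a : R) n (c : 'I_n -> smooth_curve R)
    (iota : R -> R * R) (coord : smooth_curve R -> R -> R) (A : set (R * R)) :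
  hyperbola eps = \bigcup_i curve_image (c i) ->
  (forall t, t != 0 -> hyperbola eps (iota t)) ->
  (forall t i s, t != 0 -> curve_point (c i) s = iota t -> t = a * coord (c i) s) ->
  (forall i t, t \in curve_dom (c i) -> derivable (coord (c i)) t 1) ->
  measurable_fun [set: R] iota -> measurable A -> arc_length c A = 0%E ->
  @lebesgue_measure R (iota @^-1` A) = 0%E.
Proof.
move=> hyp hiota hcoord dcoord miota mA /(arc_length_eq0 c mA) A0.
have mB : measurable (iota @^-1` A).
  by rewrite -[X in measurable X]setTI; exact: miota.
pose D i := [set` curve_dom (c i)] `&` curve_point (c i) @^-1` A.
(* The finite family of curves is extended by empty sets to a sequence, as a countable union
   requires. *)
pose F k := if insub k is Some i then (fun t => a * coord (c i) t) @` D i else set0.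
have nF k : (@lebesgue_measure R).-negligible (F k).
  rewrite /F; case: insubP => [i _ _|_]; last exact: negligible_set0.
  apply: negligible_image; first exact: A0.
  move=> t [Dt _]; apply: (@derivableM _ _ (fun=> a) (coord (c i))) => //.
  exact: dcoord.
have n0 : (@lebesgue_measure R).-negligible [set (0 : R)].
  by exists [set 0]; split => //; exact: lebesgue_measure_set1.
have [N [mN N0 hN]] := negligibleU n0 (negligible_bigcup nF).
apply: (subset_measure0 _ mN _ N0); first exact: mB.
apply: subset_trans hN => t At.
have [->|t0] := eqVneq t 0; [by left|right].
have := hiota t t0; rewrite hyp => -[i _ [s si si_t]].
exists i => //; rewrite /F valK; exists s; last by rewrite (hcoord t i s).
by split => //; rewrite /= si_t.
Qed.

(** * The counterexample for [1 < |g|], carried to the hyperbola *)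

Section Necessity.
Variables (R : realType) (eps alpha beta : R).
Hypotheses (eps0 : eps != 0) (alpha0 : 0 < alpha) (beta0 : 0 < beta).
Let g := alpha * beta * eps.

Let g0 : g != 0. Proof. by rewrite !mulf_neq0// gt_eqF. Qed.

(** At [t = 0] the value is (0, 0), off the hyperbola; this is harmless since the measures involved
    do not charge 0. *)
Definition hyperbola_point (t : R) : R * R := (t / alpha, eps * alpha / t).
Local Notation iota := hyperbola_point.

Lemma hyperbola_pointP t : t != 0 -> hyperbola eps (iota t).
Proof. by move=> t0; rewrite /hyperbola /=; field; rewrite t0 gt_eqF. Qed.

Lemma measurable_hyperbola_point : measurable_fun [set: R] iota.
Proof.
apply: measurable_fun_pair; apply: measurable_funM => //.
exact: measurable_invr.
Qed.

Lemma measurable_inversion : measurable_fun [set: R] (fun t => g / t).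
Proof. by apply: measurable_funM => //; exact: measurable_invr. Qed.

Lemma inversion_eq0 t : (g / t == 0) = (t == 0).
Proof. by rewrite mulf_eq0 (negbTE g0) invr_eq0. Qed.

Lemma closed_hyperbola : closed (hyperbola eps).
Proof.
rewrite (_ : hyperbola eps = (fun x : R * R => x.1 * x.2) @^-1` [set eps]); last first.
  by apply/seteqP; split.
apply: closed_comp => [x _|]; last exact: closed_eq.
by apply: cvgM; [exact: cvg_fst|exact: cvg_snd].
Qed.

(** Invariance on periodic sets says that the images of [h] and of its inversion under [mod2] agree,
    and a periodic function factors through [mod2]. *)
Lemma invariant_integral (h : {finite_measure set R -> \bar R}) (f : R -> R) :
  (forall E, measurable E -> periodic2 (fun x => E x) ->
    h ((fun t => g / t) @^-1` E) = h E) ->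
  bounded_measurable f -> periodic2 f -> \int[h]_t f (g / t) = \int[h]_t f t.
Proof.
move=> hJ bf pf.
have [hj [hjE hjI]] := push_ex h measurable_inversion.
rewrite -hjI//.
have [m1 [m1E m1I]] := push_ex h (@measurable_mod2 R).
have [m2 [m2E m2I]] := push_ex hj (@measurable_mod2 R).
have fE : f = fun x => f (mod2 x) by apply/funext => x; rewrite periodic2_mod2.
rewrite [in LHS]fE [in RHS]fE -m1I// -m2I//; apply: bm_eq_measure => A mA.
rewrite m1E m2E hjE hJ//.
  by rewrite -[X in measurable X]setTI; exact: measurable_mod2.
by move=> x; have := mod2D x 1; rewrite /preimage /= mulr1 => ->.
Qed.

Lemma hup_necessary :
  heisenberg_uniqueness_pair (hyperbola eps) (lattice_cross alpha beta) ->
  alpha * beta <= 1 / `|eps|.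
Proof.
move=> [n [c [[_ _ hyp] huniq]]]; rewrite leNgt; apply/negP => ab.
have g1 : 1 < `|g|.
  rewrite /g normrM gtr0_norm ?mulr_gt0//.
  by move: ab; rewrite ltr_pdivrMr// normr_gt0.
have [h [r [r0 rg h_ac [h1 hr] hJ]]] := invariant_measure g1.
have [m1 [m1E m1I]] := push_ex h measurable_hyperbola_point.
have miJ : measurable_fun [set: R] (fun t => iota (g / t)).
  exact: (measurableT_comp measurable_hyperbola_point measurable_inversion).
have [m2 [m2E m2I]] := push_ex h miJ.
pose nu : {charge set (R * R)%type -> \bar R} :=
  cadd (charge_of_finite_measure m1) (copp (charge_of_finite_measure m2)).
have nuE A : nu A = (m1 A - m2 A)%E by [].
pose m : complex_measure (R * R)%type R := ComplexMeasure nu czero.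
have h0 : h [set 0] = 0%E by apply: h_ac => //; exact: lebesgue_measure_set1.
have hsub N B : measurable N -> h N = 0%E -> measurable B -> B `<=` N -> h B = 0%E.
  by move=> mN N0 mB BN; apply: (subset_measure0 _ mN BN N0).
have mi A : measurable A -> measurable (iota @^-1` A).
  by move=> mA; rewrite -[X in measurable X]setTI; exact: measurable_hyperbola_point.
have mj A : measurable A -> measurable ((fun t => iota (g / t)) @^-1` A).
  by move=> mA; rewrite -[X in measurable X]setTI; exact: miJ.
have off A : measurable A -> A `<=` ~` hyperbola eps -> nu A = 0%E.
  move=> mA AU; rewrite nuE m1E m2E.
  rewrite (hsub [set 0])//; [|exact: mi|].
    rewrite (hsub [set 0]) ?sube0//; first exact: mj.
    move=> t /AU; apply: contra_notP => /= /eqP t0; apply: hyperbola_pointP.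
    by rewrite inversion_eq0.
  by move=> t /AU; apply: contra_notP => /= /eqP; exact: hyperbola_pointP.
have msupp : supp m `<=` hyperbola eps.
  move=> x xs; apply: contrapT => xh.
  have [|A [mA AU /eqP]] := xs (~` hyperbola eps).
    by split => //; apply: closed_openC; exact: closed_hyperbola.
  by apply; rewrite /complex_measure_val /= off.
have mac : absolutely_continuous m (arc_length c).
  split=> N hN A mA AN /=; last by [].
  have A0 := hN A mA AN.
  rewrite [LHS]nuE m1E m2E.
  rewrite h_ac ?h_ac ?sube0//; try exact: mi; try exact: mj.
    apply: (@pullback_null _ eps beta n c _ (@curve_y R) A hyp) => //.
    + by move=> t t0; apply: hyperbola_pointP; rewrite inversion_eq0.
    + move=> t i s t0 [_ ->]; rewrite /g; field.
      by rewrite t0 eps0 !gt_eqF.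
    + by move=> i t; exact: (@curve_smooth_y R (c i) 0).
  apply: (@pullback_null _ eps alpha n c _ (@curve_x R) A hyp) => //.
  + by move=> t t0; exact: hyperbola_pointP.
  + by move=> t i s t0 [-> _]; field; rewrite gt_eqF.
  + by move=> i t; exact: (@curve_smooth_x R (c i) 0).
  + exact: measurable_hyperbola_point.
have czero0 f : bounded_measurable f ->
    charge_integral (@czero _ (R * R)%type R) f = 0.
  move=> bf; rewrite (@charge_integral_diff _ _ _ _ m1 m1)// ?subrr// => A mA.
  by rewrite subee ?fin_num_measure.
have four xi : lattice_cross alpha beta xi -> fourier m xi = 0.
  move=> hxi.
  pose ph (x : R * R) := pi * (x.1 * xi.1 + x.2 * xi.2).
  have mph : measurable_fun [set: (R * R)%type] ph.
    by apply: measurable_funM => //; apply: measurable_funD; apply: measurable_funM.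
  have bc : bounded_measurable (fun x => cos (ph x)).
    split; first exact: (measurableT_comp (continuous_measurable_fun (@continuous_cos R))).
    by exists 1 => x; rewrite ler_norml cos_geN1 cos_le1.
  have bs : bounded_measurable (fun x => sin (ph x)).
    split; first exact: (measurableT_comp (continuous_measurable_fun (@continuous_sin R))).
    by exists 1 => x; rewrite ler_norml sin_geN1 sin_le1.
  (* Cosine and sine are treated together: only measurability, the bound 1 and the period are
     used. *)
  suff key (f : R -> R) : (forall t (k : int), f (pi * (t + 2 * k%:~R)) = f (pi * t)) ->
      measurable_fun [set: R] f -> (forall t, `|f t| <= 1) ->
      bounded_measurable (fun x => f (ph x)) ->
      charge_integral nu (fun x => f (ph x)) = 0.
    rewrite /fourier /complex_integral /=.
    have kc : charge_integral nu (fun x => cos (ph x)) = 0.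
      apply: key => //; [exact: cos_periodic2|exact: (continuous_measurable_fun (@continuous_cos R))|].
      by move=> t; rewrite ler_norml cos_geN1 cos_le1.
    have ks : charge_integral nu (fun x => sin (ph x)) = 0.
      apply: key => //; [exact: sin_periodic2|exact: (continuous_measurable_fun (@continuous_sin R))|].
      by move=> t; rewrite ler_norml sin_geN1 sin_le1.
    have zc := czero0 _ bc; have zs := czero0 _ bs; rewrite /ph in kc ks zc zs.
    by rewrite kc ks zc zs subr0 addr0.
  move=> fp mf f1 bf; rewrite (charge_integral_diff bf (fun A _ => nuE A)) m1I// m2I//.
  have periodic (k : int) : periodic2 (fun t => f (pi * (k%:~R * t))).
    by move=> t; rewrite mulrDr (mulrC _ 2) fp.
  have bk (k : int) : bounded_measurable (fun t : R => f (pi * (k%:~R * t)) : R).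
    by split; [apply: (measurableT_comp mf); apply: measurable_funM => //; exact: measurable_funM|exists 1].
  apply/eqP; rewrite subr_eq0; apply/eqP.
  case: hxi => -[].
    move=> [k _ xk] x0.
    have pE t : f (ph (iota t)) = f (pi * (k%:~R * t)).
      rewrite /ph /= x0 -xk mulr0 addr0; congr (f (pi * _)).
      by field; rewrite gt_eqF.
    under [LHS]eq_Rintegral do rewrite pE.
    under [RHS]eq_Rintegral do rewrite pE.
    by rewrite -(invariant_integral hJ (bk k) (periodic k)).
  move=> x0 [k _ xk].
  have pE t : f (ph (iota t)) = f (pi * (k%:~R * (g / t))).
    rewrite /ph /= x0 -xk mulr0 add0r; congr (f (pi * _)).
    rewrite /g; ring.
  under [LHS]eq_Rintegral do rewrite pE.
  (* On the second axis the inversion, being an involution, exchanges the roles of the two image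
     measures. *)
  have gg t : g / (g / t) = t by rewrite invf_div mulrCA divff// mulr1.
  under [RHS]eq_Rintegral do rewrite pE gg.
  by rewrite -(invariant_integral hJ (bk k) (periodic k)).
pose W := `[- r, r]%classic.
have mW : measurable W by exact: measurable_itv.
have hW : h W = 1%E.
  have e : h setT = (h W + h (~` W))%E.
    rewrite -(setUv W); exact: (@measureU _ _ _ h _ _ mW (measurableC mW) (setICr W)).
  by rewrite -h1 e /W hr adde0.
(* This strip separates the two parts: it has mass 1 for the first image and mass 0 for the
   second. *)
pose A := [set x : (R * R)%type | `|alpha * x.1| <= r].
have mA : measurable A.
  rewrite (_ : A = (fun x => `|alpha * x.1|) @^-1` `]-oo, r]%classic); last first.
    by apply/seteqP; split => x; rewrite /A /= in_itv.
  rewrite -[X in measurable X]setTI.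
  have mf : measurable_fun [set: (R * R)%type] (fun x => `|alpha * x.1|).
    by apply: measurableT_comp => //; apply: measurable_funM.
  by apply: mf => //; exact: measurable_itv.
have := huniq m msupp mac four A mA.
rewrite /complex_measure_val /= => -[]; rewrite [cadd _ _ _]nuE m1E m2E.
have -> : iota @^-1` A = W.
  apply/seteqP; split => t; rewrite /A /W /= in_itv/= mulrC divfK ?gt_eqF//;
    by rewrite ler_norml.
have mJA := mj A mA.
rewrite hW (hsub (~` W `|` [set 0])) ?sube0//=; first by move/eqP; rewrite oner_eq0.
- by apply: measurableU => //; exact: measurableC.
- by rewrite measureU0//; exact: measurableC.
(* If |t| <= r and |g / t| <= r with t nonzero, then |g| <= r^2, a contradiction. The point 0 must
   be added because [g / 0 = 0]. *)
- move=> t; rewrite /A /= mulrC divfK ?gt_eqF// => gt.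
  have [->|t0] := eqVneq t 0; [by right|left].
  rewrite /W /= in_itv/= -ler_norml => tr.
  have : `|g| <= r * r.
    by rewrite -(divfK t0 g) normrM ler_pM.
  by rewrite -expr2 leNgt rg.
Qed.

End Necessity.

(** * Trigonometric uniqueness *)

Section PowerBounds.
Variable R : realType.
Implicit Types (y r : R) (n K : nat).

Lemma onem_exp_ge y K : 0 <= y <= 1 -> 1 - K%:R * y <= (1 - y) ^+ K.
Proof.
move=> /andP[y0 y1]; elim: K => [|K IH]; first by rewrite mul0r subr0 expr0.
rewrite exprS -[K.+1%:R]natr1.
have h : (1 - y) * (1 - K%:R * y) <= (1 - y) * (1 - y) ^+ K by rewrite ler_wpM2l// subr_ge0.
apply: le_trans h; have : 0 <= K%:R * (y * y) by rewrite mulr_ge0// mulr_ge0.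
lra.
Qed.

(** Bernoulli's inequality for 1 + y, combined with (1 - y)(1 + y) <= 1. *)
Lemma onem_exp_le y K : 0 <= y <= 1 -> (1 - y) ^+ K <= (1 + K%:R * y)^-1.
Proof.
move=> /andP[y0 y1].
have Ky : 0 <= K%:R * y by rewrite mulr_ge0.
rewrite -[leRHS]mul1r ler_pdivlMr ?ltr_pwDl//.
have h : 1 + K%:R * y <= (1 + y) ^+ K.
  elim: K {Ky} => [|K IH]; first by rewrite mul0r addr0 expr0.
  rewrite exprS -[K.+1%:R]natr1.
  have h : (1 + y) * (1 + K%:R * y) <= (1 + y) * (1 + y) ^+ K.
    by rewrite ler_wpM2l// addr_ge0.
  apply: le_trans h; have : 0 <= K%:R * (y * y) by rewrite mulr_ge0// mulr_ge0.
  lra.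
apply: (@le_trans _ _ ((1 - y) ^+ K * (1 + y) ^+ K)).
  by rewrite ler_wpM2l// exprn_ge0// subr_ge0.
rewrite -exprMn exprn_ile1//.
  by rewrite mulr_ge0 ?subr_ge0// addr_ge0.
have : 0 <= y * y by rewrite mulr_ge0.
lra.
Qed.

Lemma cvg_natr_expr r : 0 <= r < 1 -> n%:R * r ^+ n @[n --> \oo] --> (0 : R).
Proof.
(* Writing r^n as s^n s^n lets one factor absorb [n] while the other tends to 0. *)
move=> /andP[r0 r1]; pose s := Num.sqrt r.
have s0 : 0 <= s by exact: sqrtr_ge0.
have s2 : s ^+ 2 = r by rewrite sqr_sqrtr.
have s1 : s < 1 by rewrite -(ltr_pXn2r (n := 2))// ?nnegrE// expr1n s2.
have os : 0 < 1 - s by rewrite subr_gt0.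
have bound n : 0 <= n%:R * r ^+ n <= (1 - s)^-1 * s ^+ n.
  apply/andP; split; first by rewrite mulr_ge0// exprn_ge0.
  rewrite -s2 exprAC expr2 mulrA ler_wpM2r// ?exprn_ge0//.
  have : s ^+ n <= (1 + n%:R * (1 - s))^-1.
    rewrite -{1}(subKr 1 s); apply: onem_exp_le; apply/andP; split; lra.
  have ns : 0 <= n%:R * (1 - s) by rewrite mulr_ge0// ltW.
  move=> /(ler_wpM2l (ler0n R n)) h; apply: le_trans h _.
  rewrite ler_pdivrMr ?ltr_pwDl//.
  by rewrite mulrDr mulr1 mulrCA mulVf ?gt_eqF// mulr1 lerDr invr_ge0 ltW.
have c0 : (1 - s)^-1 * s ^+ n @[n --> \oo] --> (0 : R).
  by rewrite -(mulr0 (1 - s)^-1); apply: cvgM; [exact: cvg_cst|apply: cvg_expr; rewrite ger0_norm].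
by apply: (squeeze_cvgr _ (cvg_cst 0) c0); apply: nearW => n; exact: bound.
Qed.

(* [K = n 2^n] makes the threshold exact: [K q^n] tends to [0] below [1/2] and
   to [+oo] at and above it. *)
Lemma cvg_threshold r : 0 <= r <= 1 ->
  (1 - r ^+ n) ^+ (n * 2 ^ n) @[n --> \oo] --> (((r < 1 / 2)%R : bool)%:R : R).
Proof.
move=> /andP[r0 r1].
have rn n : 0 <= r ^+ n <= 1 by rewrite exprn_ge0//= exprn_ile1.
have Kr n : (n * 2 ^ n)%:R * r ^+ n = n%:R * (2 * r) ^+ n :> R.
  by rewrite natrM natrX exprMn mulrA.
have [h|h] := ltP r (1 / 2).
  have c0 : 1 - n%:R * (2 * r) ^+ n @[n --> \oo] --> (1 : R).
    rewrite -[X in _ --> X]subr0; apply: cvgB; first exact: cvg_cst.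
    by apply: cvg_natr_expr; apply/andP; split; lra.
  rewrite (_ : true%:R = 1 :> R)//.
  apply: (squeeze_cvgr _ c0 (cvg_cst (1 : R))); apply: nearW => n.
  rewrite -Kr onem_exp_ge//= exprn_ile1// ?subr_ge0; have /andP[a b] := rn n => //.
  by rewrite lerBlDr lerDl.
have c0 : n.+1%:R^-1 @[n --> \oo] --> (0 : R) by exact: cvg_harmonic.
rewrite (_ : false%:R = 0 :> R)//.
apply: (squeeze_cvgr _ (cvg_cst (0 : R)) c0); apply: nearW => n.
have /andP[a b] := rn n; rewrite exprn_ge0 ?subr_ge0//=.
apply: le_trans (onem_exp_le _ (rn n)) _; rewrite Kr lef_pV2 ?posrE//.
  rewrite -natr1 addrC lerD2l ler_peMr// exprn_ege1//; lra.
by rewrite ltr_pwDl// mulr_ge0// exprn_ge0//; lra.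
Qed.

End PowerBounds.

(** * A finite measure on one period is determined by its trigonometric moments *)

Section TrigUniqueness.
Variable R : realType.
Variables m1 m2 : {finite_measure set R -> \bar R}.
Local Notation bm := (@bounded_measurable _ R R).
Implicit Types (f : R -> R) (k : int).
Let C k (x : R) := cos (pi * (k%:~R * x)).
Let S k (x : R) := sin (pi * (k%:~R * x)).
Hypothesis trig_eq : forall k,
  \int[m1]_x C k x = \int[m2]_x C k x /\ \int[m1]_x S k x = \int[m2]_x S k x.

Let bmC k : bm (C k).
Proof.
split; last by exists 1 => x; rewrite ler_norml cos_geN1 cos_le1.
apply: (measurableT_comp (continuous_measurable_fun (@continuous_cos R))).
by apply: measurable_funM => //; exact: measurable_funM.
Qed.

Let bmS k : bm (S k).
Proof.
split; last by exists 1 => x; rewrite ler_norml sin_geN1 sin_le1.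
apply: (measurableT_comp (continuous_measurable_fun (@continuous_sin R))).
by apply: measurable_funM => //; exact: measurable_funM.
Qed.

(* The space of multipliers of the trigonometric system on which both measures
   agree; unlike the space of all [f] with equal integrals, it is visibly stable
   under multiplication by [cos (pi x)] and [sin (pi x)]. *)
Definition trig_agree f := bm f /\ forall k,
  \int[m1]_x (f x * C k x) = \int[m2]_x (f x * C k x) /\
  \int[m1]_x (f x * S k x) = \int[m2]_x (f x * S k x).

Lemma trig_agree1 : trig_agree (fun=> 1).
Proof.
split=> [|k]; first exact: bm_cst.
have [h1 h2] := trig_eq k; split.
  by under [LHS]eq_Rintegral do rewrite mul1r; under [RHS]eq_Rintegral do rewrite mul1r.
by under [LHS]eq_Rintegral do rewrite mul1r; under [RHS]eq_Rintegral do rewrite mul1r.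
Qed.

Lemma trig_agree_integral f : trig_agree f -> \int[m1]_x f x = \int[m2]_x f x.
Proof.
move=> [_ /(_ 0)[+ _]]; have C0 x : C 0 x = 1 by rewrite /C mul0r mulr0 cos0.
under [LHS]eq_Rintegral do rewrite C0 mulr1.
by under [RHS]eq_Rintegral do rewrite C0 mulr1.
Qed.

Lemma trig_agree_lin (a b : R) f h : trig_agree f -> trig_agree h ->
  trig_agree (fun x => a * f x + b * h x).
Proof.
move=> [bf hf] [bh hh]; split=> [|k]; first by apply: bm_add; exact: bm_scale.
have [f1 f2] := hf k; have [g1 g2] := hh k.
have key (F : R -> R) : bm F -> \int[m1]_x (f x * F x) = \int[m2]_x (f x * F x) ->
    \int[m1]_x (h x * F x) = \int[m2]_x (h x * F x) ->
    \int[m1]_x ((a * f x + b * h x) * F x) = \int[m2]_x ((a * f x + b * h x) * F x).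
  move=> bF e1 e2.
  have E x : (a * f x + b * h x) * F x = a * (f x * F x) + b * (h x * F x) by ring.
  have b1 : bm (fun x => f x * F x) by exact: bm_mul.
  have b2 : bm (fun x => h x * F x) by exact: bm_mul.
  under [LHS]eq_Rintegral do rewrite E; under [RHS]eq_Rintegral do rewrite E.
  rewrite !bm_integralD; try exact: bm_scale.
  by rewrite !bm_integralZ// e1 e2.
by split; apply: key.
Qed.

Let CD k x : C (k + 1) x = C k x * C 1 x - S k x * S 1 x.
Proof. by rewrite /C /S -cosD; congr cos; rewrite intrD; ring. Qed.
Let CB k x : C (k - 1) x = C k x * C 1 x + S k x * S 1 x.
Proof. by rewrite /C /S -cosB; congr cos; rewrite intrB; ring. Qed.
Let SD k x : S (k + 1) x = S k x * C 1 x + C k x * S 1 x.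
Proof. by rewrite /C /S -sinD; congr sin; rewrite intrD; ring. Qed.
Let SB k x : S (k - 1) x = S k x * C 1 x - C k x * S 1 x.
Proof. by rewrite /C /S -sinB; congr sin; rewrite intrB; ring. Qed.

Lemma trig_agree_cos f : trig_agree f -> trig_agree (fun x => f x * C 1 x).
Proof.
move=> [bf hf]; split=> [|k]; first exact: bm_mul.
have [c1 s1] := hf (k + 1); have [c2 s2] := hf (k - 1).
have key (F G H : R -> R) : bm F -> bm G -> bm H ->
    (forall x, H x * C 1 x = 2^-1 * F x + 2^-1 * G x) ->
    \int[m1]_x (f x * F x) = \int[m2]_x (f x * F x) ->
    \int[m1]_x (f x * G x) = \int[m2]_x (f x * G x) ->
    \int[m1]_x (f x * C 1 x * H x) = \int[m2]_x (f x * C 1 x * H x).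
  move=> bF bG bH E e1 e2.
  have {}E x : f x * C 1 x * H x = 2^-1 * (f x * F x) + 2^-1 * (f x * G x).
    by rewrite -mulrA (mulrC (C 1 x)) E; ring.
  have b1 : bm (fun x => f x * F x) by exact: bm_mul.
  have b2 : bm (fun x => f x * G x) by exact: bm_mul.
  under [LHS]eq_Rintegral do rewrite E; under [RHS]eq_Rintegral do rewrite E.
  rewrite !bm_integralD; try exact: bm_scale.
  by rewrite !bm_integralZ// e1 e2.
split.
  by apply: (key (C (k + 1)) (C (k - 1))) => // x; rewrite CD CB; field.
by apply: (key (S (k + 1)) (S (k - 1))) => // x; rewrite SD SB; field.
Qed.

Lemma trig_agree_sin f : trig_agree f -> trig_agree (fun x => f x * S 1 x).
Proof.
move=> [bf hf]; split=> [|k]; first exact: bm_mul.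
have [c1 s1] := hf (k + 1); have [c2 s2] := hf (k - 1).
have key (a : R) (F G H : R -> R) : bm F -> bm G -> bm H ->
    (forall x, H x * S 1 x = a * F x + (- a) * G x) ->
    \int[m1]_x (f x * F x) = \int[m2]_x (f x * F x) ->
    \int[m1]_x (f x * G x) = \int[m2]_x (f x * G x) ->
    \int[m1]_x (f x * S 1 x * H x) = \int[m2]_x (f x * S 1 x * H x).
  move=> bF bG bH E e1 e2.
  have {}E x : f x * S 1 x * H x = a * (f x * F x) + (- a) * (f x * G x).
    by rewrite -mulrA (mulrC (S 1 x)) E; ring.
  have b1 : bm (fun x => f x * F x) by exact: bm_mul.
  have b2 : bm (fun x => f x * G x) by exact: bm_mul.
  under [LHS]eq_Rintegral do rewrite E; under [RHS]eq_Rintegral do rewrite E.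
  rewrite !bm_integralD; try exact: bm_scale.
  by rewrite !bm_integralZ// e1 e2.
split.
  by apply: (key (2^-1) (S (k + 1)) (S (k - 1))) => // x; rewrite SD SB; field.
by apply: (key (- 2^-1) (C (k + 1)) (C (k - 1))) => // x; rewrite CD CB; field.
Qed.

(** Equal to 1/2 - sin(pi x / 2) sin(pi (x - a) / 2) / 2: a trigonometric polynomial of degree one
    that takes the value 1/2 on the period exactly at 0 and [a]. The form chosen shows that it lies
    in the span of 1, cos(pi x) and sin(pi x). *)
Let q (a x : R) := 1 / 2 - (cos (pi * (a / 2)) - cos (pi * (x - a / 2))) / 4.

Lemma trig_agree_q a f : trig_agree f -> trig_agree (fun x => f x * q a x).
Proof.
move=> hf.
have := trig_agree_lin (cos (pi * (a / 2)) / 4) (sin (pi * (a / 2)) / 4)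
  (trig_agree_cos hf) (trig_agree_sin hf).
move=> /(trig_agree_lin (1 / 2 - cos (pi * (a / 2)) / 4) 1 hf).
congr trig_agree; apply/funext => x.
by rewrite /q /C /S mulr1z (mul1r x) (mulrBr pi) cosB; field.
Qed.

Lemma trig_agree_threshold a n K :
  trig_agree (fun x => (1 - q a x ^+ n) ^+ K).
Proof.
have pw f : trig_agree f -> trig_agree (fun x => f x * q a x ^+ n).
  move=> hf; elim: n => [|j IH].
    by congr trig_agree: hf; apply/funext => x; rewrite expr0 mulr1.
  have := trig_agree_q a IH; congr trig_agree; apply/funext => x.
  by rewrite exprSr mulrA.
elim: K => [|K IH].
  by have := trig_agree1; congr trig_agree; apply/funext => x; rewrite expr0.
have := trig_agree_lin 1 (-1) IH (pw _ IH); congr trig_agree; apply/funext => x.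
by rewrite exprSr; ring.
Qed.

Lemma q_lt_half a x : 0 <= a < 2 -> 0 <= x < 2 -> (q a x < 1 / 2) = (a < x).
Proof.
move=> /andP[a0 a2] /andP[x0 x2].
have p0 := @pi_gt0 R.
have -> : q a x = 1 / 2 - sin (pi * (x / 2)) * sin (pi * ((x - a) / 2)) / 2.
  rewrite /q (_ : pi * (a / 2) = pi * (x / 2) - pi * ((x - a) / 2)); last by field.
  rewrite (_ : pi * (x - a / 2) = pi * (x / 2) + pi * ((x - a) / 2)); last by field.
  by rewrite cosB cosD; field.
have pos (y : R) : 0 < y < 2 -> 0 < sin (pi * (y / 2)).
  move=> /andP[y0 y2]; apply: sin_gt0_pi; rewrite mulr_gt0 ?divr_gt0//=.
  by rewrite -[ltRHS]mulr1 ltr_pM2l//; lra.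
have [ax|xa] := ltP a x.
  have h1 : 0 < sin (pi * (x / 2)) by apply: pos; lra.
  have h2 : 0 < sin (pi * ((x - a) / 2)) by apply: pos; lra.
  have := mulr_gt0 h1 h2; lra.
apply/negbTE; rewrite -leNgt.
suff : sin (pi * (x / 2)) * sin (pi * ((x - a) / 2)) <= 0 by lra.
have h1 : 0 <= sin (pi * (x / 2)).
  have [->|x_neq0] := eqVneq x 0; first by rewrite mul0r mulr0 sin0.
  by apply/ltW/pos; rewrite x2 andbT lt_neqAle eq_sym x_neq0.
have h2 : sin (pi * ((x - a) / 2)) <= 0.
  have [->|xa_neq] := eqVneq x a; first by rewrite subrr mul0r mulr0 sin0.
  rewrite -oppr_ge0 -sinN -mulrN -mulNr opprB; apply/ltW/pos.
  have : x < a by rewrite lt_neqAle xa_neq.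
  lra.
by rewrite mulr_ge0_le0.
Qed.

Lemma q_itv a x : 0 <= q a x <= 1.
Proof.
have := cos_le1 (pi * (a / 2)); have := cos_geN1 (pi * (a / 2)).
have := cos_le1 (pi * (x - a / 2)); have := cos_geN1 (pi * (x - a / 2)).
by rewrite /q => *; apply/andP; split; lra.
Qed.

Hypotheses (m1_itv : m1 (~` `[0, 2[%classic) = 0%E) (m2_itv : m2 (~` `[0, 2[%classic) = 0%E).

Let mW : measurable (`[0, 2[%classic : set R). Proof. exact: measurable_itv. Qed.

Let restr (m : {finite_measure set R -> \bar R}) (A B : set R) : m (~` `[0, 2[%classic) = 0%E ->
  measurable A -> measurable B ->
  (forall x, 0 <= x < 2 -> A x <-> B x) -> m A = m B.
Proof.
move=> m0 mA mB AB.
have h D : measurable D -> m D = m (D `&` `[0, 2[%classic).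
  move=> mD; rewrite -{1}(setUIDK D `[0, 2[%classic).
  rewrite measureU0//; [exact: measurableI|exact: measurableD|].
  apply: (subset_measure0 _ (measurableC mW) _ m0); first exact: measurableD.
  by move=> x [].
rewrite (h A)// (h B)//; congr (m _); apply/seteqP.
by split => x [+ /=]; rewrite in_itv/= => + xW; move/(AB x xW) => ?.
Qed.

(** Rays generate the Borel sets. Within the period the ray above [a] is the set where
    [q a x < 1 / 2], and its indicator is a bounded limit of the polynomials of
    [trig_agree_threshold]. Rays starting outside [0, 2) reduce to the whole line or to the empty
    set. *)
Lemma trig_measure_eq A : measurable A -> m1 A = m2 A.
Proof.
move=> mA.
have mT : m1 setT = m2 setT.
  have := trig_agree_integral trig_agree1.
  rewrite !Rintegral_cst// !mul1r => h.
  by rewrite -(fineK (fin_num_measure m1 _ measurableT)) h fineK// fin_num_measure.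
pose G := [set A : set R | exists x, A = `]x, +oo[%classic].
apply: (@g_sigma_algebra_measure_unique _ _ _ G _ (fun i => `]- i%:R, +oo[%classic)).
- by move=> _ [x ->]; exact: measurable_itv.
- by move=> i; exists (- i%:R).
- rewrite -subTset => x _; exists (Num.truncn `|x|).+1 => //=.
  rewrite in_itv/= andbT ltrNl; apply: (@le_lt_trans _ _ `|x|); last by rewrite truncnS_gt.
  by rewrite -normrN ler_norm.
- move=> _ _ [x ->] [y ->]; exists (Num.max x y).
  by apply/seteqP; split => z; rewrite /= !in_itv/= !andbT gt_max => /andP.
- move=> _ [a ->].
  have mI : measurable `]a, +oo[%classic by exact: measurable_itv.
  have via (B : set R) : measurable B -> m1 B = m2 B ->
      (forall x, 0 <= x < 2 -> `]a, +oo[%classic x <-> B x) ->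
      m1 `]a, +oo[%classic = m2 `]a, +oo[%classic.
    move=> mB e hB.
    exact: etrans (restr m1_itv mI mB hB) (etrans e (esym (restr m2_itv mI mB hB))).
  have [a0|a0] := ltP a 0.
    apply: (via setT) => // x /andP[x0 _]; split => // _.
    by rewrite /= in_itv/= andbT; apply: lt_le_trans x0.
  have [a2|a2] := leP 2 a.
    apply: (via set0) => // [|x /andP[_ x2]]; first exact: (etrans (measure0 m1) (esym (measure0 m2))).
    by split => //; rewrite /= in_itv/= andbT; lra.
  have a02 : 0 <= a < 2 by rewrite a0.
  pose J := [set x | q a x < 1 / 2].
  have mJ : measurable J.
    have [[mq _] _] := trig_agree_q a trig_agree1.
    rewrite (_ : J = (fun x => 1 * q a x) @^-1` `]-oo, 1 / 2[%classic); last first.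
      by apply/seteqP; split => x; rewrite /J /= in_itv/= (mul1r (q a x)).
    by rewrite -[X in measurable X]setTI; apply: mq => //; exact: measurable_itv.
  have IJ x : 0 <= x < 2 -> `]a, +oo[%classic x <-> J x.
    by move=> x02; rewrite /J /= in_itv/= andbT q_lt_half.
  apply: (via J) => //.
  pose F n x := (1 - q a x ^+ n) ^+ (n * 2 ^ n).
  have lim (m : {finite_measure set R -> \bar R}) :
      \int[m]_x F n x @[n --> \oo] --> fine (m J).
    rewrite -(bm_integral_indic m mJ).
    apply: (@bm_integral_cvg _ _ _ m F (\1_J) 1).
    + move=> n; have [[mF _] _] := trig_agree_threshold a n (n * 2 ^ n).
      exact: mF.
    + move=> n x; have /andP[q0 q1] := q_itv a x.
      rewrite ger0_norm ?exprn_ge0 ?subr_ge0 ?exprn_ile1// ?subr_ge0 ?exprn_ile1//.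
      by rewrite lerBlDr lerDl exprn_ge0.
    + move=> x; rewrite indicE (_ : (x \in J) = (q a x < 1 / 2)); last first.
        by apply/idP/idP; rewrite inE.
      exact/cvg_threshold/q_itv.
  have l1 := lim m1; have := lim m2.
  rewrite (_ : (fun n => \int[m2]_x F n x) = fun n => \int[m1]_x F n x); last first.
    by apply/funext => n; rewrite (trig_agree_integral (trig_agree_threshold a n _)).
  move=> /(cvg_unique (@norm_hausdorff _ R) l1) h.
  by rewrite -(fineK (fin_num_measure m1 _ mJ)) h fineK// fin_num_measure.
- by move=> k; rewrite ltey_eq fin_num_measure//; exact: measurable_itv.
- by have := mA; rewrite [X in X A](RGenOInfty.measurableE R).
Qed.

End TrigUniqueness.

(** * Uniqueness on the line *)

(** The moments of [theta] see it only modulo 2, and so does a periodic set: the images under [mod2]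
    of [theta] are compared. *)
Lemma trig_pullback_eq d (X : measurableType d) (R : realType)
    (p n : {finite_measure set X -> \bar R}) (theta : X -> R) (E : set R) :
  measurable_fun [set: X] theta ->
  (forall k : int,
    \int[p]_x cos (pi * (k%:~R * theta x)) = \int[n]_x cos (pi * (k%:~R * theta x)) /\
    \int[p]_x sin (pi * (k%:~R * theta x)) = \int[n]_x sin (pi * (k%:~R * theta x))) ->
  measurable E -> periodic2 (fun t => E t) ->
  p (theta @^-1` E) = n (theta @^-1` E).
Proof.
move=> mtheta trig mE pE.
have mphi : measurable_fun [set: X] (fun x => mod2 (theta x)).
  exact: (measurableT_comp (@measurable_mod2 R) mtheta).
have [m1 [m1E m1I]] := push_ex p mphi.
have [m2 [m2E m2I]] := push_ex n mphi.
have out (m : {finite_measure set X -> \bar R}) :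
    m ((fun x => mod2 (theta x)) @^-1` (~` `[0, 2[%classic)) = 0%E.
  rewrite (_ : _ @^-1` _ = set0) ?measure0//; apply/seteqP; split => x //=.
  by rewrite in_itv/= mod2_itv.
have -> : theta @^-1` E = (fun x => mod2 (theta x)) @^-1` E.
  by apply/seteqP; split => x /=; rewrite (periodic2_mod2 _ pE).
rewrite -m1E -m2E; apply: trig_measure_eq => // [k||].
- have pc : periodic2 (fun t : R => cos (pi * (k%:~R * t))).
    by move=> t; rewrite mulrDr (mulrC _ 2) cos_periodic2.
  have ps : periodic2 (fun t : R => sin (pi * (k%:~R * t))).
    by move=> t; rewrite mulrDr (mulrC _ 2) sin_periodic2.
  have bc : bounded_measurable (fun t : R => cos (pi * (k%:~R * t)) : R).
    split; last by exists 1 => x; rewrite ler_norml cos_geN1 cos_le1.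
    apply: (measurableT_comp (continuous_measurable_fun (@continuous_cos R))).
    by apply: measurable_funM => //; exact: measurable_funM.
  have bs : bounded_measurable (fun t : R => sin (pi * (k%:~R * t)) : R).
    split; last by exists 1 => x; rewrite ler_norml sin_geN1 sin_le1.
    apply: (measurableT_comp (continuous_measurable_fun (@continuous_sin R))).
    by apply: measurable_funM => //; exact: measurable_funM.
  have [c s] := trig k; rewrite m1I// m2I// m1I// m2I//; split.
    under [LHS]eq_Rintegral => x _ do rewrite (periodic2_mod2 (theta x) pc).
    by under [RHS]eq_Rintegral => x _ do rewrite (periodic2_mod2 (theta x) pc).
  under [LHS]eq_Rintegral => x _ do rewrite (periodic2_mod2 (theta x) ps).
  by under [RHS]eq_Rintegral => x _ do rewrite (periodic2_mod2 (theta x) ps).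
- exact: (etrans (m1E _) (out p)).
- exact: (etrans (m2E _) (out n)).
Qed.

Lemma foldN (R : realType) (t : R) : fold (- t) = fold t.
Proof.
have [k [u [-> /andP[u1 u2] ->]]] := fold_decomp t.
have -> : - (u + 2 * k%:~R) = - u + 2 * (- k)%:~R by rewrite intrN; ring.
rewrite foldD; move: u1; rewrite le_eqVlt => /orP[/eqP<-|u1].
  have {1}-> : - - 1 = -1 + 2 * 1%:~R :> R by rewrite mulr1z; ring.
  by rewrite foldD fold_id//; apply/andP; split; lra.
by rewrite fold_id ?normrN//; apply/andP; split; lra.
Qed.

Lemma fold_norm (R : realType) (t : R) : fold `|t| = fold t.
Proof. by have [t0|t0] := leP 0 t; [rewrite ger0_norm|rewrite ltr0_norm ?foldN]. Qed.

(** * Wandering of mass out of the period cell *)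

Section Wandering.
Variable R : realType.
Implicit Types (B P : set R) (phi : R -> R) (p n : {finite_measure set R -> \bar R}).

(** The representative modulo 2 in [-1, 1): the cell is centred at 0 so that its modulus is
    [fold]. *)
Definition rep (s : R) : R := mod2 (s + 1) - 1.

Lemma measurable_rep : measurable_fun [set: R] rep.
Proof.
apply: measurable_funB => //; apply: (measurableT_comp (@measurable_mod2 R)).
exact: measurable_funD.
Qed.

Lemma rep_id s : -1 <= s < 1 -> rep s = s.
Proof. by move=> /andP[s0 s1]; rewrite /rep mod2_id ?addrK//; apply/andP; split; lra. Qed.

Lemma rep_periodic s : rep (s + 2) = rep s.
Proof. by rewrite /rep (addrAC s 2 1); have := mod2D (s + 1) 1; rewrite mulr1 => ->. Qed.

Lemma fold_rep s : fold s = `|rep s|.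
Proof.
have [k hk] := mod2_eq (s + 1); have /andP[m0 m2] := mod2_itv (s + 1).
rewrite -(fold_id (t := rep s)); last by rewrite /rep; apply/andP; split; lra.
rewrite -(foldD k (rep s)); congr fold; rewrite /rep.
by move: hk; move: (mod2 (s + 1)) (k%:~R : R) => x y; lra.
Qed.

Definition period_cell : set R := [set s | -1 < s < 1].
(** For [B] inside the cell, the union of the B + 2 k over nonzero integers k. *)
Definition translates B : set R := [set s | B (rep s) /\ ~ period_cell s].

Lemma measurable_period_cell : measurable period_cell.
Proof.
rewrite (_ : period_cell = `]-1, 1[%classic); first exact: measurable_itv.
by apply/seteqP; split => s /=; rewrite in_itv.
Qed.

Lemma measurable_translates B : measurable B -> measurable (translates B).
Proof.
move=> mB; apply: (measurableI (rep @^-1` B) (~` period_cell)).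
  by rewrite -[X in measurable X]setTI; exact: measurable_rep.
by apply: measurableC; exact: measurable_period_cell.
Qed.

(* Mass of [p] inside the period cell is carried, by periodicity, to mass of
   [n] outside of it, because inside the cell [p] and [n] are disjoint. *)
Lemma wander_le p n P phi B : measurable P -> p (~` P) = 0%E -> n P = 0%E ->
  measurable_fun [set: R] phi -> involutive phi ->
  (forall E, measurable E -> periodic2 (fun t => E t) ->
    p (phi @^-1` E) = n (phi @^-1` E)) ->
  measurable B -> B `<=` period_cell ->
  (p (phi @^-1` B) <= n (phi @^-1` translates B))%E.
Proof.
move=> mP pP nP mphi phiK pn mB B1.
have mpre (f : R -> R) A : measurable_fun [set: R] f -> measurable A -> measurable (f @^-1` A).
  by move=> mf mA; rewrite -[X in measurable X]setTI; exact: mf.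
have mI := measurable_period_cell.
(* As [phi] is an involution, the preimage of [B'] is the part in [P] of the preimage of [B]: it
   carries all of the [p]-mass and none of the [n]-mass. *)
pose B' := B `&` phi @^-1` P.
have mB' : measurable B' by apply: measurableI => //; exact: mpre.
have mE : measurable (rep @^-1` B') by apply: mpre => //; exact: measurable_rep.
have mEI : measurable (rep @^-1` B' `&` period_cell) by exact: measurableI.
have mED : measurable (rep @^-1` B' `\` period_cell) by exact: measurableD.
have mpB : measurable (phi @^-1` B) by exact: mpre.
have pBE : p (phi @^-1` B) = p (phi @^-1` B').
  have mC : measurable (phi @^-1` B `\` P) by exact: measurableD.
  rewrite -(setUIDK (phi @^-1` B) P) measureU0//; first 1 last.
  - exact: measurableI.
  - by apply: (subset_measure0 _ (measurableC mP) _ pP) => // t [].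
  congr (p _); apply/seteqP; split => t; rewrite /B' /= phiK//.
rewrite pBE; apply: (@le_trans _ _ (p (phi @^-1` (rep @^-1` B')))).
  apply: le_measure; [apply/mem_set; exact: mpre|apply/mem_set; exact: mpre|].
  move=> t [Bt Pt]; have /andP[b1 b2] := B1 _ Bt.
  by split; rewrite /= rep_id ?(ltW b1)//; rewrite b2.
rewrite pn//; last by move=> s; rewrite /preimage/= rep_periodic.
rewrite -(setUIDK (rep @^-1` B') period_cell) preimage_setU.
rewrite setUC measureU0; first 1 last.
- exact: mpre.
- exact: mpre.
- apply: (subset_measure0 _ mP _ nP); first exact: mpre.
  move=> t [[_ +] h]; rewrite /= rep_id ?phiK//.
  by have /andP[h1 h2] := h; rewrite (ltW h1).
apply: le_measure; [apply/mem_set; exact: mpre|apply/mem_set|by move=> t [[h _] h']].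
by apply: (mpre _ (translates B) mphi); exact: measurable_translates.
Qed.

End Wandering.

Arguments period_cell {R}.

(* Lebesgue measure as a measure on the canonical measurable type [R], which
   does not unify with [measurableTypeR R]. *)
Definition lebesgue_on (R : realType) : set R -> \bar R := @lebesgue_measure R.

HB.instance Definition _ (R : realType) := isMeasure.Build _ R R (@lebesgue_on R)
  (@measure0 _ _ _ (@lebesgue_measure R)) (@measure_ge0 _ _ _ (@lebesgue_measure R))
  (@measure_semi_sigma_additive _ _ _ (@lebesgue_measure R)).

Lemma finite_measure_continuous (R : realType) (m : {finite_measure set R -> \bar R}) :
  (forall A, measurable A -> @lebesgue_measure R A = 0%E -> m A = 0%E) ->
  forall e : R, 0 < e -> exists2 d : R, 0 < d &
  forall A, measurable A -> (@lebesgue_measure R A < d%:E)%E -> (m A < e%:E)%E.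
Proof.
move=> mac e e0; pose nu : {charge set R -> \bar R} := charge_of_finite_measure m.
have numu : nu `<< (@lebesgue_on R).
  by apply/null_content_dominatesP => A mA A0; exact: mac.
have [P [N PN]] := Hahn_decomposition nu.
have [d [d0 hd]] :=
  @charge_variation_continuous _ _ _ nu _ _ PN
    (@lebesgue_on R) numu e e0.
exists d => // A mA Ad; apply: le_lt_trans (hd A mA Ad).
apply: le_trans (abse_charge_variation PN mA).
by rewrite gee0_abs.
Qed.

(** * Uniqueness on the line for [|g| <= 1] *)

Section LineUniqueness.
Variables (R : realType) (g : R) (p n : {finite_measure set R -> \bar R}) (P : set R).
Implicit Types (A B : set R) (phi : R -> R).
Local Notation c := (`|g|).
Local Notation lambda := (@lebesgue_measure R).
Hypotheses (g0 : g != 0) (g1 : `|g| <= 1).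
Hypotheses (mP : measurable P) (pP : p (~` P) = 0%E) (nP : n P = 0%E).
Hypotheses (p_ac : forall A, measurable A -> lambda A = 0%E -> p A = 0%E)
  (n_ac : forall A, measurable A -> lambda A = 0%E -> n A = 0%E).
Hypothesis trig_id : forall k : int,
  \int[p]_t cos (pi * (k%:~R * t)) = \int[n]_t cos (pi * (k%:~R * t)) /\
  \int[p]_t sin (pi * (k%:~R * t)) = \int[n]_t sin (pi * (k%:~R * t)).
Hypothesis trig_inv : forall k : int,
  \int[p]_t cos (pi * (k%:~R * (g / t))) = \int[n]_t cos (pi * (k%:~R * (g / t))) /\
  \int[p]_t sin (pi * (k%:~R * (g / t))) = \int[n]_t sin (pi * (k%:~R * (g / t))).

(** The total variation of the signed measure with positive part [p] and negative part [n]. *)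
Let rho A : \bar R := (p A + n A)%E.
Let npre A phi : set R := [set t | A `|phi t|].
Let unit_range : set R := [set s | 0 <= s < 1].

Let c0 : 0 < c. Proof. by rewrite normr_gt0. Qed.

Let mpre (f : R -> R) A : measurable_fun [set: R] f -> measurable A -> measurable (f @^-1` A).
Proof. by move=> mf mA; rewrite -[X in measurable X]setTI; exact: mf. Qed.

Let minv : measurable_fun [set: R] (fun t => g / t).
Proof. by apply: measurable_funM => //; exact: measurable_invr. Qed.

Let nrm (t : R) : R := `|t|.
Let mnrm : measurable_fun [set: R] nrm. Proof. exact: normr_measurable. Qed.

Let le_rho A B : measurable A -> measurable B -> A `<=` B -> (rho A <= rho B)%E.
Proof. by move=> mA mB AB; apply: leeD; apply: le_measure; rewrite ?inE. Qed.

Let fold_preimage_range A : A `<=` unit_range -> fold_preimage c A `<=` unit_range.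
Proof.
move=> A1 s [/andP[s0 sc] As]; rewrite /unit_range /= (ltW s0)/= lt_neqAle.
rewrite (le_trans sc g1) andbT; apply/eqP => s1; move: sc As; rewrite s1 => c1.
(* The endpoint [s = 1] can occur only for [c = 1], and there [fold 1 = 1] is outside [A]. *)
have -> : c = 1 by apply/eqP; rewrite eq_le g1.
rewrite divr1 (_ : 1 = -1 + 2 * 1%:~R :> R); last by rewrite mulr1z; ring.
rewrite foldD fold_id; last by apply/andP; split; lra.
by rewrite normrN1 => /A1; rewrite /unit_range /= ltxx andbF.
Qed.

(** On the nontrivial translates |phi| >= 1, so s = |g / phi| lies in (0, c] and [c / s] is |phi|,
    whose fold is in [A]. One wandering step thus becomes one preimage under the folded map, with
    [phi] replaced by its inversion and with the two parts exchanged. *)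
Let wander_fold phi A : measurable_fun [set: R] phi -> involutive phi ->
  (forall k : int,
    \int[p]_t cos (pi * (k%:~R * phi t)) = \int[n]_t cos (pi * (k%:~R * phi t)) /\
    \int[p]_t sin (pi * (k%:~R * phi t)) = \int[n]_t sin (pi * (k%:~R * phi t))) ->
  measurable A -> A `<=` unit_range ->
  (rho (npre A phi) <= rho (npre (fold_preimage c A) (fun t => (g / phi t)%R)))%E.
Proof.
move=> mphi phiK trig mA A1.
pose B : set R := [set s | A `|s|].
have mB : measurable B by exact: (mpre (f := nrm)).
have B1 : B `<=` period_cell.
  by move=> s /A1; rewrite /unit_range /period_cell /= -ltr_norml => /andP[].
have pn E : measurable E -> periodic2 (fun t => E t) -> p (phi @^-1` E) = n (phi @^-1` E).
  by move=> mE pE; exact: trig_pullback_eq.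
have mT := measurable_translates mB.
apply: (@le_trans _ _ (rho (phi @^-1` translates B))).
  rewrite /rho addeC [X in (_ <= X)%E]addeC addeC; apply: leeD.
    exact: (wander_le mP pP nP mphi phiK pn mB B1).
  apply: (wander_le (measurableC mP) _ pP mphi phiK _ mB B1); first by rewrite setCK.
  by move=> E mE pE; rewrite pn.
apply: le_rho; [exact: mpre| |].
  apply: (mpre (f := fun t => `|g / phi t|)); last exact: measurable_fold_preimage.
  apply: measurableT_comp; first exact: normr_measurable.
  exact: (measurableT_comp minv mphi).
move=> t [Bt ct].
have s1 : 1 <= `|phi t|.
  by rewrite leNgt ltr_norml; apply/negP.
have s0 : 0 < `|phi t| by apply: lt_le_trans s1.
rewrite /npre /fold_preimage /= normf_div; split.
  by rewrite divr_gt0// ler_pdivrMr// ler_peMr// ltW.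
by rewrite invf_div mulrCA divff ?gt_eqF// mulr1 fold_norm fold_rep.
Qed.

(** A step for the identity followed by a step for the inversion returns to the coordinate [t],
    which is why iterates come in pairs. *)
Let wander_fold2 A : measurable A -> A `<=` unit_range ->
  (rho (npre A id) <= rho (npre (preim_iter c 2 A) id))%E.
Proof.
move=> mA A1.
apply: le_trans (@wander_fold id A _ (fun=> erefl) trig_id mA A1) _ => //.
have JK : involutive (fun t => g / t).
  by move=> t; rewrite invf_div mulrCA divff// mulr1.
apply: le_trans (@wander_fold _ _ minv JK trig_inv (measurable_fold_preimage _ mA) (fold_preimage_range A1)) _.
have -> : npre (fold_preimage c (fold_preimage c A)) (fun t => g / (g / t)) =
    npre (preim_iter c 2 A) id by apply/seteqP; split => t; rewrite /npre /= JK.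
by [].
Qed.

Let wander_fold_iter k A : measurable A -> A `<=` unit_range ->
  (rho (npre A id) <= rho (npre (preim_iter c k.*2 A) id))%E.
Proof.
elim: k A => // k IH A mA A1; rewrite doubleS !preim_iterS.
apply: le_trans (wander_fold2 mA A1) _; apply: IH; first exact: measurable_preim_iter.
by do 2 apply: fold_preimage_range.
Qed.

Let norm_ac (m : {finite_measure set R -> \bar R}) :
  (forall A, measurable A -> lambda A = 0%E -> m A = 0%E) ->
  forall e : R, 0 < e -> exists2 d : R, 0 < d &
  forall A, measurable A -> (lambda A < d%:E)%E -> (m (npre A id) < e%:E)%E.
Proof.
move=> m_ac e e0.
have [m' [m'E _]] := push_ex m mnrm.
suff m'_ac A : measurable A -> lambda A = 0%E -> m' A = 0%E.
  have [d d0 hd] := finite_measure_continuous m'_ac e0.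
  by exists d => // A mA Ad; rewrite -[npre A id]/(nrm @^-1` A) -m'E; exact: hd.
move=> mA A0; rewrite m'E; apply: m_ac; first exact: mpre.
have neg : lambda.-negligible (A `|` (-%R @` A)).
  apply: negligibleU; first by exists A; split.
  by apply: negligible_image => // t _; exact: derivableN.
have [N [mN N0 hN]] := neg.
apply: (subset_measure0 _ mN _ N0); first exact: mpre.
move=> t At; apply: hN; have [t0|t0] := leP 0 t; [left|right].
  by move: At; rewrite /= /nrm ger0_norm.
by exists `|t| => //; rewrite /nrm ltr0_norm// opprK.
Qed.

(** The mass is bounded by that of preimages whose Lebesgue measure is as small as desired by
    [fold_escape]; absolute continuity then makes it zero. *)
Let rho_Icc (a : R) : 0 <= a < 1 -> rho [set t | `|t| <= a] = 0%E.
Proof.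
move=> /andP[a0 a1]; apply/eqP; rewrite eq_le adde_ge0// andbT.
have mA : measurable `[0, a]%classic by exact: measurable_itv.
apply/lee_addgt0Pr => e e0; rewrite add0e.
have e2 : 0 < e / 2 by rewrite divr_gt0.
have [d1 d10 h1] := norm_ac p_ac e2.
have [d2 d20 h2] := norm_ac n_ac e2.
have d0 : 0 < Num.min d1 d2 by rewrite lt_min d10.
have a01 : 0 <= a < 1 by rewrite a0.
have [k hk] := fold_escape c0 g1 a01 d0.
have -> : [set t | `|t| <= a] = npre `[0, a]%classic id.
  by apply/seteqP; split => t; rewrite /npre /= in_itv/= normr_ge0.
apply: le_trans (@wander_fold_iter k _ mA _) _.
  by move=> s; rewrite /= in_itv/= => /andP[s0 sa]; rewrite /unit_range /= s0 (le_lt_trans sa).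
rewrite [e]splitr EFinD; apply: leeD; apply/ltW; [apply: h1|apply: h2];
  try exact: measurable_preim_iter; apply: lt_le_trans hk _; rewrite lee_fin ge_min lexx ?orbT//.
Qed.

Let rho_itv : rho [set t | `|t| < 1] = 0%E.
Proof.
have hE : [set t : R | `|t| < 1] = \bigcup_k [set t | `|t| <= 1 - k.+1%:R^-1].
  apply/seteqP; split=> [t /= t1|t [k _ /= tk]]; last first.
    by apply: le_lt_trans tk _; rewrite ltrBlDr ltrDl invr_gt0.
  exists (Num.truncn (1 - `|t|)^-1) => //=.
  have d0 : 0 < 1 - `|t| by rewrite subr_gt0.
  rewrite lerBrDr addrC -lerBrDr; apply/ltW; rewrite invf_plt ?posrE//.
  by rewrite truncnS_gt// invr_ge0 ltW.
have mk (k : nat) : measurable [set t : R | `|t| <= 1 - k.+1%:R^-1].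
  rewrite (_ : [set t | _] = (nrm @^-1` `]-oo, 1 - k.+1%:R^-1]%classic)).
    by apply: mpre => //; exact: measurable_itv.
  by apply/seteqP; split => t; rewrite /= in_itv.
have z (k : nat) : rho [set t : R | `|t| <= 1 - k.+1%:R^-1] = 0%E.
  apply: rho_Icc; rewrite subr_ge0 invf_le1// ler1n/= ltrBlDr ltrDl invr_gt0//.
have zz (m : {finite_measure set R -> \bar R}) :
    (forall k : nat, m [set t : R | `|t| <= 1 - k.+1%:R^-1] = 0%E) ->
    m [set t : R | `|t| < 1] = 0%E.
  move=> mz; have : m.-negligible [set t : R | `|t| < 1].
    by rewrite hE; apply: negligible_bigcup => k; eexists; split; [exact: mk| exact: mz|].
  by move/measure_negligible; apply; rewrite hE; exact: bigcup_measurable.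
have pz k := padde_eq0 (measure_ge0 p _) (measure_ge0 n [set t : R | `|t| <= 1 - k.+1%:R^-1]).
rewrite /rho !zz ?adde0// => k; have /eqP := z k; rewrite pz => /andP[/eqP ? /eqP ?] //.
Qed.

(** The sets |t| < 1 and |t| > |g| are null and cover the line up to the points 1 and -1, which
    absolute continuity disposes of. *)
Lemma line_uniqueness : p setT = 0%E /\ n setT = 0%E.
Proof.
have JK : involutive (fun t => g / t).
  by move=> t; rewrite invf_div mulrCA divff// mulr1.
have m1 : measurable [set t : R | `|t| < 1].
  rewrite (_ : [set t | _] = (nrm @^-1` `]-oo, 1[%classic)).
    by apply: mpre => //; exact: measurable_itv.
  by apply/seteqP; split => t; rewrite /= in_itv.
have mc : measurable [set t : R | c < `|t|].
  rewrite (_ : [set t | _] = (nrm @^-1` `]c, +oo[%classic)).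
    by apply: mpre => //; exact: measurable_itv.
  by apply/seteqP; split => t; rewrite /= in_itv/= andbT.
have mU : measurable unit_range.
  rewrite (_ : unit_range = `[0, 1[%classic); first exact: measurable_itv.
  by apply/seteqP; split => s; rewrite /= in_itv.
have rc : rho [set t | c < `|t|] = 0%E.
  apply/eqP; rewrite eq_le adde_ge0// andbT -[leRHS]rho_itv.
  apply: (@le_trans _ _ (rho (npre unit_range (fun t => g / t)))).
    apply: le_rho => //.
      apply: (mpre (f := fun t => `|g / t|)) => //.
      by apply: measurableT_comp; first exact: normr_measurable.
    move=> t /= ct; rewrite /npre /unit_range /= normr_ge0/=.
    have t0 : 0 < `|t| by apply: lt_trans ct.
    by rewrite normf_div ltr_pdivrMr// mul1r.
  (* A single step from |g / t| < 1 lands in |t| < 1, already known to be null. *)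
  apply: le_trans (@wander_fold _ _ minv JK trig_inv mU _) _ => //.
  apply: le_rho => //.
    apply: (mpre (f := fun t => `|g / (g / t)|)); last exact: measurable_fold_preimage.
    apply: measurableT_comp; first exact: normr_measurable.
    exact: (measurableT_comp minv minv).
  by move=> t; rewrite /npre /= JK => /(fold_preimage_range (@subset_refl _ _)) /andP[].
have key (m : {finite_measure set R -> \bar R}) :
    (forall A, measurable A -> lambda A = 0%E -> m A = 0%E) ->
    m [set t : R | `|t| < 1] = 0%E -> m [set t : R | c < `|t|] = 0%E -> m setT = 0%E.
  move=> m_ac h1 h2.
  have n1 : m.-negligible [set t : R | `|t| < 1] by exists [set t : R | `|t| < 1]; split; [exact: m1|exact: h1|].
  have n2 : m.-negligible [set t : R | c < `|t|] by exists [set t : R | c < `|t|]; split; [exact: mc|exact: h2|].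
  have n3 : m.-negligible [set 1 : R].
    by exists [set 1]; split => //; apply: m_ac => //; exact: lebesgue_measure_set1.
  have n4 : m.-negligible [set -1 : R].
    by exists [set -1]; split => //; apply: m_ac => //; exact: lebesgue_measure_set1.
  have := negligibleU (negligibleU n1 n2) (negligibleU n3 n4).
  suff -> : ([set t : R | `|t| < 1] `|` [set t | c < `|t|]) `|` ([set 1] `|` [set -1]) = setT.
    by move/measure_negligible; apply.
  rewrite -subTset => t _.
  have [t1|t1] := ltP `|t| 1; first by left; left.
  have [ct|tc] := ltP c `|t|; first by left; right.
  right; have /eqP : `|t| = 1 by apply/eqP; rewrite eq_le t1 (le_trans tc g1).
  by rewrite eqr_norml ler01 andbT => /orP[/eqP ->|/eqP ->]; [left|right].
have := rho_itv; have := rc; rewrite /rho => /eqP + /eqP.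
rewrite !padde_eq0// => /andP[/eqP pc /eqP nc] /andP[/eqP pi1 /eqP ni1].
by split; apply: key.
Qed.

End LineUniqueness.

(** * Sufficiency *)

Section HyperbolaCurves.
Variable R : realType.
Implicit Types (a b t : R) (k : nat).

Lemma is_derive_invX a k t : t != 0 ->
  is_derive t (1 : R) (fun s : R => a * s^-1 ^+ k.+1) (- (a * k.+1%:R) * t^-1 ^+ k.+2).
Proof.
move=> t0.
have hV : is_derive t (1 : R) (fun s : R => s^-1) (- t ^- 2 *: (1 : R)).
  exact: (@is_deriveV R id t (1 : R) (1 : R) t0).
have hX : is_derive t (1 : R) (fun s : R => s^-1 ^+ k.+1)
    ((k.+1%:R * t^-1 ^+ k) *: (- t ^- 2 *: (1 : R))).
  by have := @is_deriveX _ _ (fun s : R => s^-1) k.+1 t (1 : R) _ hV; rewrite exprfctE.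
rewrite (_ : - (a * k.+1%:R) * t^-1 ^+ k.+2 =
    a * (k.+1%:R * t^-1 ^+ k * (- t ^- 2 * 1))); last first.
  rewrite -exprVn -[k.+2]addn2 exprD; move: (t^-1) (k.+1%:R) => x y; ring.
exact: is_derive_scale.
Qed.

Lemma open_neq0 : open [set s : R | s != 0].
Proof.
rewrite (_ : [set s : R | _] = ~` [set 0]); first by apply: closed_openC; exact: closed_eq.
by apply/seteqP; split => s /= /eqP.
Qed.

Lemma derive1n_inv a k : exists b, forall t, t != 0 ->
  ((fun s : R => a / s)^`(k))%classic t = b * t^-1 ^+ k.+1.
Proof.
elim: k => [|k [b hb]]; first by exists a => t t0; rewrite expr1.
exists (- (b * k.+1%:R)) => t t0.
rewrite derive1nS derive1E.
have nt : \forall s \near t, b * s^-1 ^+ k.+1 = ((fun s : R => a / s)^`(k))%classic s.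
  have : \forall s \near t, s != 0 by apply: open_nbhs_nbhs; split; first exact: open_neq0.
  by apply: filterS => s s0; rewrite hb.
have := near_eq_is_derive nt (is_derive_invX b k t0).
by move=> h; exact: derive_val.
Qed.

End HyperbolaCurves.

Section HyperbolaParametrization.
Variables (R : realType) (alpha eps : R) (I : interval R).
Hypotheses (alpha0 : alpha != 0) (I_int : ([set` I]° !=set0)%classic)
  (I0 : forall t, t \in I -> t != 0).

Let x (s : R) := s / alpha.
Let y (s : R) := eps * alpha / s.

Let derive1n_x k (t : R) : derivable ((x^`(k))%classic) t 1.
Proof.
have cstk (b : R) n s : derivable (((cst b : R -> R)^`(n))%classic) s 1.
  elim: n b => [|n IH] b; first exact: derivable_cst.
  rewrite derive1Sn (_ : ((cst b : R -> R)^`())%classic = cst 0)//.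
  by apply/funext => u; exact: derive1_cst.
have dx (s : R) : is_derive s (1 : R) x alpha^-1.
  rewrite /x -[alpha^-1]mulr1 (_ : (fun s => _) = fun s => alpha^-1 * s).
    exact: is_derive_scale.
  by apply/funext => u; rewrite mulrC mulr1.
case: k => [|k]; first exact: ex_derive.
rewrite derive1Sn (_ : (x^`())%classic = cst alpha^-1)//.
by apply/funext => s; rewrite derive1E; exact: derive_val.
Qed.

Let derive1n_y k (t : R) : t \in I -> derivable ((y^`(k))%classic) t 1.
Proof.
move=> /I0 t0; have [b hb] := derive1n_inv (eps * alpha) k.
have nt : \forall s \near t, b * s^-1 ^+ k.+1 = (y^`(k))%classic s.
  have : \forall s \near t, s != 0 by apply: open_nbhs_nbhs; split; first exact: open_neq0.
  by apply: filterS => s s0; rewrite hb.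
by apply: (near_eq_derivable nt); case: (is_derive_invX b k t0).
Qed.

Let regular t : t \in I -> ((x^`() t)%classic, (y^`() t)%classic) != (0, 0).
Proof.
move=> _; rewrite xpair_eqE negb_and; apply/orP; left.
rewrite derive1E /x.
have dx : is_derive t (1 : R) (fun s => alpha^-1 * s) (alpha^-1 * 1) by exact: is_derive_scale.
rewrite (_ : (fun s => _) = fun s => alpha^-1 * s); last first.
  by apply/funext => u; rewrite mulrC.
by rewrite derive_val mulr1 invr_eq0.
Qed.

Let inj : {in I &, injective (fun t => (x t, y t))}.
Proof. by move=> s t _ _ [st _]; apply: (mulIf _ st); rewrite invr_eq0. Qed.

Definition hyperbola_branch : smooth_curve R :=
  SmoothCurve I_int (fun k t _ => @derive1n_x k t) derive1n_y regular inj.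

End HyperbolaParametrization.

(** * From charges on the hyperbola to the line *)

Section Sufficiency.
Variables (R : realType) (eps alpha beta : R).
Hypotheses (eps0 : eps != 0) (alpha0 : 0 < alpha) (beta0 : 0 < beta).
Let g := alpha * beta * eps.
Local Notation iota := (hyperbola_point eps alpha).
Local Notation lambda := (@lebesgue_measure R).

Let a0 : alpha != 0. Proof. by rewrite gt_eqF. Qed.
Let g0 : g != 0. Proof. by rewrite !mulf_neq0// gt_eqF. Qed.

Let posI : interval R := (`]0, +oo[)%R.
Let negI : interval R := (`]-oo, 0[)%R.

Let posI_int : [set` posI]°%classic !=set0.
Proof.
exists 1; apply: open_nbhs_nbhs; split; first exact: interval_open.
by rewrite /= in_itv/= ltr01.
Qed.

Let negI_int : [set` negI]°%classic !=set0.
Proof.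
exists (-1); apply: open_nbhs_nbhs; split; first exact: interval_open.
by rewrite /= in_itv/= ltrN10.
Qed.

Let posI0 t : t \in posI -> t != 0.
Proof. by rewrite in_itv/= andbT => /gt_eqF ->. Qed.
Let negI0 t : t \in negI -> t != 0.
Proof. by rewrite in_itv/= => /lt_eqF ->. Qed.

Definition branches (i : 'I_2) : smooth_curve R :=
  if i == ord0 then hyperbola_branch eps a0 posI_int posI0
  else hyperbola_branch eps a0 negI_int negI0.

Lemma branches_point i t : curve_point (branches i) t = iota t.
Proof. by rewrite /branches; case: ifP. Qed.

Lemma branches_dom i t : (t \in curve_dom (branches i)) = if i == ord0 then 0 < t else t < 0.
Proof. by rewrite /branches; case: ifP => _ /=; rewrite in_itv/= ?andbT. Qed.

Lemma hyperbola_pointK (x : R * R) : hyperbola eps x -> iota (alpha * x.1) = x.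
Proof.
case: x => x1 x2; rewrite /hyperbola /= => h.
have x10 : x1 != 0 by apply: contra_neq eps0 => x10; rewrite -h x10 mul0r.
by rewrite /hyperbola_point -h; congr (_, _); field; rewrite ?a0 ?x10.
Qed.

Lemma branches_hyperbola : disjoint_union_of_curves (hyperbola eps) branches.
Proof.
split => //.
- move=> i j _ _ [x [[s si sx] [t tj tx]]].
  have st : s = t.
    move: sx; rewrite -tx !branches_point => -[h _].
    by apply: (mulIf _ h); rewrite invr_eq0.
  move: si tj; rewrite /= !branches_dom st; case: ifPn => i0; case: ifPn => j0 h1 h2.
  + by rewrite (eqP i0) (eqP j0).
  + by have := lt_trans h1 h2; rewrite ltxx.
  + by have := lt_trans h1 h2; rewrite ltxx.
  + by apply/val_inj; move: i j i0 j0 {sx tx h1 h2} => [[|[|i]] ?] [[|[|j]] ?].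
- apply/seteqP; split=> [x hx|_ [i _ [t ti <-]]]; last first.
    rewrite branches_point; apply: hyperbola_pointP => //.
    move: ti; rewrite /= branches_dom; case: ifP => _ h; [by rewrite gt_eqF|by rewrite lt_eqF].
  have x10 : x.1 != 0 by apply: contra_neq eps0 => x10; rewrite -hx x10 mul0r.
  have [xp|xn] := ltP 0 x.1.
    exists ord0 => //; exists (alpha * x.1).
      change (alpha * x.1 \in curve_dom (branches ord0)); rewrite branches_dom/= mulr_gt0//.
    by rewrite branches_point hyperbola_pointK.
  exists (lift ord0 ord0) => //; exists (alpha * x.1).
    change (alpha * x.1 \in curve_dom (branches (lift ord0 ord0))); rewrite branches_dom/= pmulr_rlt0// lt_neqAle x10//.
  by rewrite branches_point hyperbola_pointK.
Qed.

Lemma measurable_hyperbola : measurable (hyperbola eps).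
Proof.
rewrite (_ : hyperbola eps = (fun x : R * R => x.1 * x.2) @^-1` [set eps]); last first.
  by apply/seteqP; split.
rewrite -[X in measurable X]setTI.
have mf : measurable_fun [set: (R * R)%type] (fun x => x.1 * x.2) by apply: measurable_funM.
by apply: mf => //; exact: measurable_set1.
Qed.

Let mtheta : measurable_fun [set: (R * R)%type] (fun x => alpha * x.1).
Proof. exact: measurable_funM. Qed.

Let arc_null (A : set R) : measurable A -> lambda A = 0%E ->
  (arc_length branches).-null_set ((fun x => alpha * x.1) @^-1` A).
Proof.
move=> mA A0 M mM MA; apply/(arc_length_eq0 branches mM) => i.
have mD := measurable_curve_preimage (branches i) mM.
apply: (@subset_measure0 _ _ _ lambda _ A) => //.
move=> t [_]; rewrite /= branches_point => /MA.
by rewrite /= mulrC divfK.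
Qed.

Let off_null : (arc_length branches).-null_set (~` hyperbola eps).
Proof.
move=> M mM MA; apply/(arc_length_eq0 branches mM) => i.
rewrite (_ : _ `&` _ = set0) ?measure0//; apply/seteqP; split => // t [ti /=].
rewrite branches_point => /MA; apply; apply: hyperbola_pointP => //.
move: ti; rewrite /= branches_dom; case: ifP => _ h; [by rewrite gt_eqF|by rewrite lt_eqF].
Qed.

Lemma charge_unique (nu : {charge set (R * R)%type -> \bar R}) :
  `|g| <= 1 -> nu `<< arc_length branches ->
  (forall k : int,
    charge_integral nu (fun x => cos (pi * (k%:~R * (alpha * x.1)))) = 0 /\
    charge_integral nu (fun x => sin (pi * (k%:~R * (alpha * x.1)))) = 0) ->
  (forall k : int,
    charge_integral nu (fun x => cos (pi * (k%:~R * (beta * x.2)))) = 0 /\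
    charge_integral nu (fun x => sin (pi * (k%:~R * (beta * x.2)))) = 0) ->
  forall A, measurable A -> nu A = 0%E.
Proof.
move=> g1 nu_ac trig1 trig2.
(* This is the very decomposition chosen inside [charge_integral], so that [ciE] holds by
   definition. *)
pose hh := projT2 (cid (projT2 (cid (Hahn_decomposition nu)))).
have ciE f : charge_integral nu f = \int[jordan_pos hh]_x f x - \int[jordan_neg hh]_x f x.
  by [].
move: hh ciE; set P := projT1 _; set N := projT1 _ => hh ciE.
have [[mP posP] [mN negN] PUN PIN] := hh.
set p' := jordan_pos hh in ciE *; set n' := jordan_neg hh in ciE *.
have p'E A : measurable A -> p' A = nu (A `&` P).
  by move=> mA; rewrite /p' jordan_posE cjordan_posE /crestr0 mem_set.
have n'E A : measurable A -> n' A = (- nu (A `&` N))%E.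
  by move=> mA; rewrite /n' jordan_negE cjordan_negE /crestr0 mem_set.
have mG := measurableC measurable_hyperbola.
have off A : measurable A -> A `<=` ~` hyperbola eps -> nu A = 0%E.
  by move=> mA Ah; exact: (nu_ac _ off_null).
have [p [pE pI]] := push_ex p' mtheta.
have [n [nE nI]] := push_ex n' mtheta.
have mth A : measurable A -> measurable ((fun x : R * R => alpha * x.1) @^-1` A).
  by move=> mA; rewrite -[X in measurable X]setTI; exact: mtheta.
have mio A : measurable A -> measurable (iota @^-1` A).
  by move=> mA; rewrite -[X in measurable X]setTI; exact: measurable_hyperbola_point.
have p'G : p' (~` hyperbola eps) = 0%E.
  by rewrite p'E//; exact: (off _ (measurableI _ _ mG mP) (@subIsetl _ _ _)).
have n'G : n' (~` hyperbola eps) = 0%E.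
  by rewrite n'E// (off _ (measurableI _ _ mG mN) (@subIsetl _ _ _)) oppe0.
have bm_trig (f : R -> R) (k : int) (ph : R * R -> R) :
    measurable_fun [set: R] f -> (forall t, `|f t| <= 1) ->
    measurable_fun [set: (R * R)%type] ph ->
    bounded_measurable (fun x => f (pi * (k%:~R * ph x))).
  move=> mf f1 mph; split; last by exists 1.
  by apply: (measurableT_comp mf); apply: measurable_funM => //; exact: measurable_funM.
have bm_line (f : R -> R) (k : int) (ph : R -> R) :
    measurable_fun [set: R] f -> (forall t, `|f t| <= 1) ->
    measurable_fun [set: R] ph ->
    bounded_measurable (fun t : R => f (pi * (k%:~R * ph t)) : R).
  move=> mf f1 mph; split; last by exists 1.
  by apply: (measurableT_comp mf); apply: measurable_funM => //; exact: measurable_funM.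
have mcos : measurable_fun [set: R] (@cos R).
  exact: (continuous_measurable_fun (@continuous_cos R)).
have msin : measurable_fun [set: R] (@sin R).
  exact: (continuous_measurable_fun (@continuous_sin R)).
have cos1 (t : R) : `|cos t| <= 1 by rewrite ler_norml cos_geN1 cos_le1.
have sin1 (t : R) : `|sin t| <= 1 by rewrite ler_norml sin_geN1 sin_le1.
have minv : measurable_fun [set: R] (fun t => g / t).
  by apply: measurable_funM => //; exact: measurable_invr.
have on_hyp (m : {finite_measure set (R * R)%type -> \bar R}) (f h : R * R -> R) :
    m (~` hyperbola eps) = 0%E -> bounded_measurable f -> bounded_measurable h ->
    (forall x, hyperbola eps x -> f x = h x) -> \int[m]_x f x = \int[m]_x h x.
  move=> m0 [mf _] [mh _] fh; rewrite /Rintegral; congr fine.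
  apply: ae_eq_integral => //; try exact/measurable_EFinP.
  exists (~` hyperbola eps); split => // x /=; apply: contra_not => hx _.
  by rewrite fh.
have inv_hyp x : hyperbola eps x -> g / (alpha * x.1) = beta * x.2.
  case: x => x1 x2; rewrite /hyperbola /= => h.
  have x10 : x1 != 0 by apply: contra_neq eps0 => x10; rewrite -h x10 mul0r.
  by rewrite /g -h; field; rewrite a0 x10.
have trig_id_of (f : R -> R) (k : int) : measurable_fun [set: R] f -> (forall t, `|f t| <= 1) ->
    charge_integral nu (fun x => f (pi * (k%:~R * (alpha * x.1)))) = 0 ->
    \int[p]_t f (pi * (k%:~R * t)) = \int[n]_t f (pi * (k%:~R * t)).
  move=> mf f1 /eqP; rewrite ciE subr_eq0 => /eqP h.
  by rewrite pI ?nI; [exact: h|exact: (bm_line f k id)|exact: (bm_line f k id)].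
have trig_inv_of (f : R -> R) (k : int) : measurable_fun [set: R] f -> (forall t, `|f t| <= 1) ->
    charge_integral nu (fun x => f (pi * (k%:~R * (beta * x.2)))) = 0 ->
    \int[p]_t f (pi * (k%:~R * (g / t))) = \int[n]_t f (pi * (k%:~R * (g / t))).
  move=> mf f1 /eqP; rewrite ciE subr_eq0 => /eqP h.
  have b1 := bm_trig f k (fun x => g / (alpha * x.1)) mf f1 (measurableT_comp minv mtheta).
  have mbeta : measurable_fun [set: (R * R)%type] (fun x => beta * x.2) by exact: measurable_funM.
  have b2 := bm_trig f k (fun x => beta * x.2) mf f1 mbeta.
  have fh x : hyperbola eps x ->
      f (pi * (k%:~R * (g / (alpha * x.1)))) = f (pi * (k%:~R * (beta * x.2))).
    by move=> /inv_hyp ->.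
  have bg := bm_line f k (fun t => g / t) mf f1 minv.
  by rewrite pI// nI// (on_hyp p' _ _ p'G b1 b2 fh) (on_hyp n' _ _ n'G b1 b2 fh).
have mP2 := mio P mP.
(* Replacing a set by its trace in the line coordinate alters it only off the hyperbola, where the
   charge vanishes. *)
have sat (A : set (R * R)) x : ~ (A x <-> A (iota (alpha * x.1))) -> ~ hyperbola eps x.
  by apply: contra_not => hx; rewrite hyperbola_pointK.
have pP2 : p (~` (iota @^-1` P)) = 0%E.
  rewrite pE [LHS]p'E; last by apply: mth; exact: measurableC.
  apply: off; first by apply: measurableI => //; apply: mth; exact: measurableC.
  by move=> x [nPx Px]; apply: (sat P) => -[/(_ Px)].
have nP2 : n (iota @^-1` P) = 0%E.
  rewrite nE [LHS]n'E; last exact: mth.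
  rewrite off ?oppe0//; first by apply: measurableI => //; exact: mth.
  move=> x [Px Nx]; apply: (sat P) => -[_ /(_ Px) Px'].
  by have : (P `&` N) x by []; rewrite PIN.
have p_ac A : measurable A -> lambda A = 0%E -> p A = 0%E.
  move=> mA A0; rewrite pE [LHS]p'E; last exact: mth.
  apply: (nu_ac _ (arc_null mA A0)); first by apply: measurableI => //; exact: mth.
  exact: subIsetl.
have n_ac A : measurable A -> lambda A = 0%E -> n A = 0%E.
  move=> mA A0; rewrite nE [LHS]n'E; last exact: mth.
  have mAN := measurableI _ _ (mth A mA) mN.
  by rewrite (nu_ac _ (arc_null mA A0) _ mAN (@subIsetl _ _ _)) oppe0.
have [pT nT] := @line_uniqueness R g p n _ g0 g1 mP2 pP2 nP2 p_ac n_ac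
  (fun k => conj (trig_id_of _ k mcos cos1 (trig1 k).1) (trig_id_of _ k msin sin1 (trig1 k).2))
  (fun k => conj (trig_inv_of _ k mcos cos1 (trig2 k).1) (trig_inv_of _ k msin sin1 (trig2 k).2)).
move: pT nT; rewrite pE nE preimage_setT => pT nT A mA.
rewrite (jordan_decomp hh mA) /cadd /= cscaleN1 /=.
have -> : jordan_pos hh A = 0%E.
  by apply: (subset_measure0 mA measurableT _ pT).
have -> : jordan_neg hh A = 0%E.
  by apply: (subset_measure0 mA measurableT _ nT).
by rewrite oppe0 adde0.
Qed.

Lemma hup_sufficient : alpha * beta <= 1 / `|eps| ->
  heisenberg_uniqueness_pair (hyperbola eps) (lattice_cross alpha beta).
Proof.
move=> ab; have g1 : `|g| <= 1.
  by rewrite /g normrM gtr0_norm ?mulr_gt0// -ler_pdivlMr ?normr_gt0.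
exists 2%N, branches; split; first exact: branches_hyperbola.
move=> m _ [re_ac im_ac] four A mA.
pose ph (xi x : R * R) := pi * (x.1 * xi.1 + x.2 * xi.2).
(* The Fourier transform mixes the two parts of the measure. The cross is symmetric, and passing to
   the opposite frequency changes the sign of the sine terms only, so sums and differences separate
   the four integrals. *)
have key xi : lattice_cross alpha beta xi -> lattice_cross alpha beta (- xi.1, - xi.2) ->
    [/\ charge_integral (re_part m) (fun x => cos (ph xi x)) = 0,
        charge_integral (re_part m) (fun x => sin (ph xi x)) = 0,
        charge_integral (im_part m) (fun x => cos (ph xi x)) = 0 &
        charge_integral (im_part m) (fun x => sin (ph xi x)) = 0].
  move=> h1 h2.
  have mph : measurable_fun [set: (R * R)%type] (ph xi).
    by apply: measurable_funM => //; apply: measurable_funD; apply: measurable_funM.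
  have bs : bounded_measurable (fun x => sin (ph xi x)).
    split; first exact: (measurableT_comp (continuous_measurable_fun (@continuous_sin R))).
    by exists 1 => x; rewrite ler_norml sin_geN1 sin_le1.
  have ciN (nu : {charge set (R * R)%type -> \bar R}) :
      charge_integral nu (fun x => - sin (ph xi x)) =
      - charge_integral nu (fun x => sin (ph xi x)).
    rewrite /charge_integral /= (_ : (fun x => - sin (ph xi x)) =
      fun x => -1 * sin (ph xi x)); last by apply/funext => x; rewrite mulN1r.
    by rewrite !bm_integralZ//; ring.
  have phN x : pi * (x.1 * - xi.1 + x.2 * - xi.2) = - ph xi x by rewrite /ph; ring.
  have := four _ h1; have := four _ h2; rewrite /fourier /complex_integral /=.
  rewrite (_ : (fun x : R * R => cos (pi * (x.1 * - xi.1 + x.2 * - xi.2))) =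
    fun x => cos (ph xi x)); last by apply/funext => x; rewrite phN cosN.
  rewrite (_ : (fun x : R * R => sin (pi * (x.1 * - xi.1 + x.2 * - xi.2))) =
    fun x => - sin (ph xi x)); last by apply/funext => x; rewrite phN sinN.
  rewrite !ciN -/(ph xi) => -[e1 e2] -[e3 e4].
  rewrite -!/(ph xi _) in e3 e4.
  by split; lra.
have ph1 k : ph (alpha * k%:~R, 0) = fun x => pi * (k%:~R * (alpha * x.1)).
  by apply/funext => x; rewrite /ph /=; ring.
have ph2 k : ph (0, beta * k%:~R) = fun x => pi * (k%:~R * (beta * x.2)).
  by apply/funext => x; rewrite /ph /=; ring.
have in1 k : lattice_cross alpha beta (alpha * k%:~R, 0) by left; split => //=; exists k.
have in2 k : lattice_cross alpha beta (0, beta * k%:~R) by right; split => //=; exists k.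
have in1N k : lattice_cross alpha beta (- (alpha * k%:~R), - 0).
  by have := in1 (- k); rewrite intrN mulrN oppr0.
have in2N k : lattice_cross alpha beta (- 0, - (beta * k%:~R)).
  by have := in2 (- k); rewrite intrN mulrN oppr0.
have key1 k := key _ (in1 k) (in1N k).
have key2 k := key _ (in2 k) (in2N k).
have re0 : re_part m A = 0%E.
  apply: charge_unique => // k; [have [a b _ _] := key1 k; rewrite ph1 in a b|
    have [a b _ _] := key2 k; rewrite ph2 in a b]; by split.
have im0 : im_part m A = 0%E.
  apply: charge_unique => // k; [have [_ _ a b] := key1 k; rewrite ph1 in a b|
    have [_ _ a b] := key2 k; rewrite ph2 in a b]; by split.
by rewrite /complex_measure_val re0 im0.
Qed.

End Sufficiency.

Theorem corollary1p3 (R : realType) (eps alpha beta : R) :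
  eps != 0 -> 0 < alpha -> 0 < beta ->
  (heisenberg_uniqueness_pair (hyperbola eps) (lattice_cross alpha beta) <->
  alpha * beta <= 1 / `|eps|).
Proof.
by move=> eps0 alpha0 beta0; split; [exact: hup_necessary|exact: hup_sufficient].
Qed.
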